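(* Let $\Omega\subset\mathbb{R}^3$ be an open bounded domain with $C^{1,1}$ boundary, let $e\in\mathbb{R}^3$ be a fixed (known) unit vector, and let $\mathbf{C}^0$ be the homogeneous isotropic elastic tensor $$C^0_{ijkl}=\lambda^0\delta_{ij}\delta_{kl}+\mu^0(\delta_{ik}\delta_{jl}+\delta_{il}\delta_{jk}),$$ where the constants $\lambda^0,\mu^0\in\mathbb{R}$ satisfy $\mu^0>0$ and $3\lambda^0+2\mu^0>0$. Let $\rho^0_{ik}=\rho^0\delta_{ik}$ be a homogeneous isotropic density, with constant $\rho^0>0$. Let $\omega_1,\omega_2>0$ be two distinct frequencies such that neither $\omega_1^2$ nor $\omega_2^2$ is a Dirichlet eigenvalue of $-(\rho^0)^{-1}\mathrm{div}(\mathbf{C}^0\nabla\,\cdot\,)$ in $\Omega$. Let $\delta\mathbf{C}=(\delta C_{ijkl})$ and $\delta\rho=(\delta\rho_{ik})$ have components in $L^\infty(\Omega)$ and be transversely isotropic with axis of symmetry $e$. If $$\dot{\Lambda}_{\mathbf{C}^0,\rho^0,\omega_1}(\delta\mathbf{C},\delta\rho)=0\quad\text{and}\quad\dot{\Lambda}_{\mathbf{C}^0,\rho^0,\omega_2}(\delta\mathbf{C},\delta\rho)=0,$$ then $\delta\mathbf{C}=0$ and $\delta\rho=0$ (almost everywhere in $\Omega$).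
   Context: Repeated indices are summed over $\{1,2,3\}$ and $\delta_{ij}$ is the Kronecker delta. An elastic perturbation $\delta\mathbf{C}=(\delta C_{ijkl})_{1\le i,j,k,l\le 3}$ is a real-valued tensor field on $\Omega$ with components in $L^\infty(\Omega)$ satisfying the symmetries $\delta C_{ijkl}=\delta C_{jikl}=\delta C_{klij}$. A density perturbation $\delta\rho=(\delta\rho_{ik})_{1\le i,k\le 3}$ is a real symmetric matrix field on $\Omega$ with components in $L^\infty(\Omega)$. Neither perturbation depends on the frequency. Transverse isotropy. Let $\mathcal{Q}$ be the set of $3\times 3$ matrices consisting of the three reflections $\mathrm{diag}(-1,1,1)$, $\mathrm{diag}(1,-1,1)$, $\mathrm{diag}(1,1,-1)$ and all rotations $$\begin{pmatrix}\cos\theta&-\sin\theta&0\\ \sin\theta&\cos\theta&0\\0&0&1\end{pmatrix},\qquad 0\le\theta\le 2\pi .$$ $\delta\mathbf{C}$ and $\delta\rho$ are transversely isotropic with axis of symmetry $x_3$ (that is, $e=e_3=(0,0,1)$) if for almost every $x\in\Omega$ and every $Q\in\mathcal{Q}$, $$Q_{ip}Q_{jq}Q_{kr}Q_{ls}\,\delta C_{pqrs}(x)=\delta C_{ijkl}(x),\qquad Q_{ip}Q_{jq}\,\delta\rho_{pq}(x)=\delta\rho_{ij}(x).$$ For a general unit vector $e$ (the same at every point $x$), they are transversely isotropic with axis of symmetry $e$ if the same identities hold for almost every $x\in\Omega$ and all matrices $RQR^T$ (in place of $Q$) with $Q\in\mathcal{Q}$, where $R$ is a fixed rotation with $Re_3=e$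 (the condition does not depend on the choice of $R$). Dirichlet eigenvalues. The operator $\mathrm{div}(\mathbf{C}^0\nabla u)$ equals $\mu^0\Delta u+(\lambda^0+\mu^0)\nabla(\nabla\cdot u)$. That $\omega^2$ is not a Dirichlet eigenvalue of $-(\rho^0)^{-1}\mathrm{div}(\mathbf{C}^0\nabla\,\cdot\,)$ means that the only $u\in H^1_0(\Omega)$ with $\mu^0\Delta u+(\lambda^0+\mu^0)\nabla(\nabla\cdot u)+\omega^2\rho^0u=0$ in $\Omega$ is $u=0$. Linearized Dirichlet-to-Neumann map at frequency $\omega$. For $\omega>0$ with $\omega^2$ not a Dirichlet eigenvalue of $-(\rho^0)^{-1}\mathrm{div}(\mathbf{C}^0\nabla\,\cdot\,)$ in $\Omega$, $\dot{\Lambda}_{\mathbf{C}^0,\rho^0,\omega}$ is the Fréchet derivative at $(\mathbf{C}^0,\rho^0)$ of the map $(\mathbf{C},\rho)\mapsto\Lambda_{\mathbf{C},\rho,\omega}$, where $\Lambda_{\mathbf{C},\rho,\omega}f=\left(C_{ijkl}\nu_j\partial_k u^f_l|_{\partial\Omega}\right)_{i}$, $\nu$ is the outer unit normal, and $u^f\in H^1(\Omega)$ solves $\partial_j (C_{ijkl}\partial_k u^f_l)+\omega^2\rho_{ik}u^f_k=0$ in $\Omega$ for $i=1,2,3$, with $u^f|_{\partial\Omega}=f$. The operator $\dot{\Lambda}_{\mathbf{C}^0,\rho^0,\omega}(\delta\mathbf{C},\delta\rho):H^{1/2}(\partial\Omega)\to H^{-1/2}(\partial\Omega)$ (on vector-valued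 functions with three components) is the bounded linear operator characterized by $$\langle\dot{\Lambda}_{\mathbf{C}^0,\rho^0,\omega}(\delta\mathbf{C},\delta\rho)f,g\rangle=\int_\Omega\left(\delta C_{ijkl}(x)\,\partial_iu_j(x)\,\partial_kv_l(x)-\omega^2\,\delta\rho_{ik}(x)\,u_i(x)\,v_k(x)\right)dx\qquad\text{for all } f,g\in H^{1/2}(\partial\Omega),$$ where the pairing is bilinear (no complex conjugation) and $u,v\in H^1(\Omega)$ are the unique solutions of $$\mu^0\Delta u+(\lambda^0+\mu^0)\nabla(\nabla\cdot u)+\omega^2\rho^0u=0\ \text{in }\Omega,\quad u|_{\partial\Omega}=f;$$ $$\mu^0\Delta v+(\lambda^0+\mu^0)\nabla(\nabla\cdot v)+\omega^2\rho^0v=0\ \text{in }\Omega,\quad v|_{\partial\Omega}=g.$$ *)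

(* Defs.v *)
From HB Require Import structures.
From mathcomp Require Import all_boot all_order all_algebra complex.
From mathcomp Require Import all_classical all_reals all_analysis.
Set Implicit Arguments.
Unset Strict Implicit.
Unset Printing Implicit Defensive.
Import Order.TTheory GRing.Theory Num.Theory.
Import numFieldNormedType.Exports.
Local Open Scope classical_set_scope.
Local Open Scope complex_scope.
Local Open Scope ring_scope.

(* Points of R^3 are triples (x.1.1, x.1.2, x.2) in R * R * R.
   A Lebesgue-measurable function on R^n is a.e. equal to a Borel one, so it
   loses nothing to represent L^2 and L^oo classes by functions measurable for
   the (Borel) product sigma-algebra.                                         *)
Definition leb2 (R : realType) := (@lebesgue_measure R \x @lebesgue_measure R)%E.
HB.instance Definition _ (R : realType) := Measure.on (@leb2 R).
Definition leb3 (R : realType) := (@leb2 R \x @lebesgue_measure R)%E.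
HB.instance Definition _ (R : realType) := Measure.on (@leb3 R).
Arguments leb2 R : clear implicits.
Arguments leb3 R : clear implicits.

Definition to_col (R : realType) (x : R * R * R) : 'cV[R]_3 :=
  \col_i nth 0 [:: x.1.1; x.1.2; x.2] i.
Definition of_col (R : realType) (v : 'cV[R]_3) : R * R * R :=
  (v 0 0, v 1 0, v 2%:R 0).

Definition partial (R : realType) (k : 'I_3) (f : R * R * R -> R) :
  R * R * R -> R := fun x => 'D_(of_col (delta_mx k 0)) f x.

Definition smooth (R : realType) (f : R * R * R -> R) : Prop :=
  forall (s : seq 'I_3) x, differentiable (foldr (@partial R) f s) x.

Definition test_fun (R : realType) (Om : set (R * R * R))
    (phi : R * R * R -> R) : Prop :=
  [/\ smooth phi, compact (closure [set x | phi x != 0])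
    & closure [set x | phi x != 0] `<=` Om].

Definition re (R : realType) T (f : T -> R[i]) : T -> R :=
  fun x => complex.Re (f x).
Definition im (R : realType) T (f : T -> R[i]) : T -> R :=
  fun x => complex.Im (f x).
Definition sqnorm (R : realType) (z : R[i]) : R :=
  complex.Re z ^+ 2 + complex.Im z ^+ 2.

Definition cpartial (R : realType) (k : 'I_3) (f : R * R * R -> R[i]) :
  R * R * R -> R[i] := fun x => partial k (re f) x +i* partial k (im f) x.

Definition cmeasurable (R : realType) d (T : measurableType d) (A : set T)
    (f : T -> R[i]) : Prop :=
  measurable_fun A (re f) /\ measurable_fun A (im f).

Definition cint (R : realType) (A : set (R * R * R)) (f : R * R * R -> R[i]) :
  R[i] := (\int[leb3 R]_(x in A) re f x) +i* (\int[leb3 R]_(x in A) im f x).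

Definition sqint (R : realType) (A : set (R * R * R))
    (f : R * R * R -> R[i]) : \bar R :=
  (\int[leb3 R]_(x in A) (sqnorm (f x))%:E)%E.

Definition in_L2 (R : realType) (A : set (R * R * R)) (f : R * R * R -> R[i]) :
  Prop := cmeasurable A f /\ (sqint A f < +oo)%E.

Definition in_Linfty (R : realType) (A : set (R * R * R)) (f : R * R * R -> R) :
  Prop := measurable_fun A f /\
  exists M : R, {ae leb3 R, forall x, A x -> `|f x| <= M}.

Definition weak_partial (R : realType) (Om : set (R * R * R)) (k : 'I_3)
    (u g : R * R * R -> R[i]) : Prop :=
  forall phi, test_fun Om phi ->
    cint Om (fun x => u x * (partial k phi x)%:C) =
    - cint Om (fun x => g x * (phi x)%:C).

(* u \in H^1(Om) with weak gradient G, G k being the k-th partial derivative. *)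
Definition in_H1 (R : realType) (Om : set (R * R * R)) (u : R * R * R -> R[i])
    (G : 'I_3 -> R * R * R -> R[i]) : Prop :=
  in_L2 Om u /\ forall k, in_L2 Om (G k) /\ weak_partial Om k u (G k).

(* phi n --> u in H^1(Om), for phi n smooth and u with weak gradient G. *)
Definition cvg_H1 (R : realType) (Om : set (R * R * R))
    (phi : nat -> R * R * R -> R[i]) (u : R * R * R -> R[i])
    (G : 'I_3 -> R * R * R -> R[i]) : Prop :=
  sqint Om (fun x => phi n x - u x) @[n --> \oo] --> (0 : \bar R) /\
  forall k, sqint Om (fun x => cpartial k (phi n) x - G k x) @[n --> \oo]
    --> (0 : \bar R).

Definition vfield (R : realType) := 'I_3 -> R * R * R -> R[i].
(* The gradient Du of a field u is indexed so that Du i j is the i-th partial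
   derivative of the component u j.                                           *)
Definition gradient (R : realType) := 'I_3 -> 'I_3 -> R * R * R -> R[i].

Definition H1_field (R : realType) (Om : set (R * R * R)) (u : vfield R)
    (Du : gradient R) : Prop := forall j, in_H1 Om (u j) (fun i => Du i j).

Definition H10_field (R : realType) (Om : set (R * R * R)) (u : vfield R)
    (Du : gradient R) : Prop :=
  H1_field Om u Du /\
  forall j, exists2 phi : nat -> R * R * R -> R[i],
    forall n, test_fun Om (re (phi n)) /\ test_fun Om (im (phi n))
    & cvg_H1 Om phi (u j) (fun i => Du i j).

Definition H1_sqnorm (R : realType) (Om : set (R * R * R)) (u : vfield R)
    (Du : gradient R) : \bar R :=
  (\sum_j sqint Om (u j) + \sum_i \sum_j sqint Om (Du i j))%E.

Definition boundary (R : realType) (Om : set (R * R * R)) : set (R * R * R) :=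
  closure Om `\` interior Om.

Definition rotation (R : realType) (Q : 'M[R]_3) : Prop :=
  Q^T *m Q = 1%:M /\ \det Q = 1.

Definition square (R : realType) (r : R) : set (R * R) := [set y | `|y| < r].

Definition C11_on (R : realType) (D : set (R * R)) (g : R * R -> R) : Prop :=
  (forall y, D y -> differentiable g y) /\
  exists K : R, forall y z, D y -> D z ->
    `|'D_(1, 0) g y - 'D_(1, 0) g z| <= K * `|y - z| /\
    `|'D_(0, 1) g y - 'D_(0, 1) g z| <= K * `|y - z|.

Record chart (R : realType) := Chart {
  chart_ctr : R * R * R ; chart_rot : 'M[R]_3 ;
  chart_rad : R ; chart_hgt : R ; chart_fun : R * R -> R }.

Definition chart_map (R : realType) (c : chart R) (y : R * R) (t : R) :
  R * R * R := chart_ctr c + of_col (chart_rot c *m to_col (y, t)).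

(* In the rotated coordinates (y, t) centred at chart_ctr c, Om is, within the
   box |y| < chart_rad c, |t| < chart_hgt c, the part above the graph of
   chart_fun c. The norm on R * R is the maximum norm.                        *)
Definition C11_chart (R : realType) (Om : set (R * R * R)) (c : chart R) :
  Prop :=
  [/\ rotation (chart_rot c), 0 < chart_rad c /\ 0 < chart_hgt c,
      C11_on (square (chart_rad c)) (chart_fun c),
      forall y, square (chart_rad c) y -> `|chart_fun c y| < chart_hgt c
    & forall y t, square (chart_rad c) y -> `|t| < chart_hgt c ->
        Om (chart_map c y t) <-> chart_fun c y < t].

Definition C11_boundary (R : realType) (Om : set (R * R * R)) : Prop :=
  forall x, boundary Om x -> exists2 c, chart_ctr c = x & C11_chart Om c.

Definition on_graph (R : realType) (c : chart R) (f : R * R * R -> R[i]) :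
  R * R -> R[i] := fun y => f (chart_map c y (chart_fun c y)).

(* Integral of |f|^2 for the surface measure over the piece of boundary
   parametrized by the chart c.                                               *)
Definition surf_sqint (R : realType) (c : chart R) (f : R * R * R -> R[i]) :
  \bar R :=
  (\int[leb2 R]_(y in square (chart_rad c))
     (sqnorm (on_graph c f y) *
      Num.sqrt (1 + 'D_(1, 0) (chart_fun c) y ^+ 2
                  + 'D_(0, 1) (chart_fun c) y ^+ 2))%:E)%E.

(* Functions on the boundary are represented by functions on R^3, of which only
   the values on the boundary matter. Finitely many charts cover the boundary
   of a bounded C^{1,1} domain, so that membership and convergence in L^2 of
   the boundary can be tested chart by chart.                                 *)
Definition L2_boundary (R : realType) (Om : set (R * R * R))
    (f : R * R * R -> R[i]) : Prop :=
  forall c, C11_chart Om c ->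
    cmeasurable (square (chart_rad c)) (on_graph c f) /\
    (surf_sqint c f < +oo)%E.

(* f is the trace of u on the boundary of Om: the trace operator is the
   extension by continuity, from H^1 to L^2 of the boundary, of the restriction
   of smooth functions.                                                       *)
Definition trace (R : realType) (Om : set (R * R * R)) (u : R * R * R -> R[i])
    (G : 'I_3 -> R * R * R -> R[i]) (f : R * R * R -> R[i]) : Prop :=
  L2_boundary Om f /\
  exists phi : nat -> R * R * R -> R[i],
    [/\ forall n, smooth (re (phi n)) /\ smooth (im (phi n)),
        cvg_H1 Om phi u G
      & forall c, C11_chart Om c ->
          surf_sqint c (fun x => phi n x - f x) @[n --> \oo] --> (0 : \bar R)].

Definition trace_field (R : realType) (Om : set (R * R * R)) (u : vfield R)
    (Du : gradient R) (f : vfield R) : Prop :=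
  forall j, trace Om (u j) (fun i => Du i j) (f j).

Definition Hhalf (R : realType) (Om : set (R * R * R)) (f : vfield R) : Prop :=
  exists u Du, H1_field Om u Du /\ trace_field Om u Du f.

(* mu Laplacian(u) + (lam + mu) grad(div u) + w^2 rho u = 0 in Om, in the sense
   of distributions, for u in H^1 with weak gradient Du.                      *)
Definition lame_eq (R : realType) (Om : set (R * R * R)) (lam mu rho w : R)
    (u : vfield R) (Du : gradient R) : Prop :=
  forall phi, test_fun Om phi -> forall j,
    cint Om (fun x =>
      - (mu%:C * \sum_i Du i j x * (partial i phi x)%:C)
      - (lam + mu)%:C * (\sum_k Du k k x) * (partial j phi x)%:C
      + (w ^+ 2 * rho)%:C * u j x * (phi x)%:C) = 0.

Definition not_dirichlet_eigenvalue (R : realType) (Om : set (R * R * R))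
    (lam mu rho w : R) : Prop :=
  forall u Du, H10_field Om u Du -> lame_eq Om lam mu rho w u Du ->
    {ae leb3 R, forall x, Om x -> forall j, u j x = 0}.

Definition tensor4 (R : realType) :=
  'I_3 -> 'I_3 -> 'I_3 -> 'I_3 -> R * R * R -> R.
Definition tensor2 (R : realType) := 'I_3 -> 'I_3 -> R * R * R -> R.

Definition elastic_perturbation (R : realType) (Om : set (R * R * R))
    (dC : tensor4 R) : Prop :=
  (forall i j k l, in_Linfty Om (dC i j k l)) /\
  {ae leb3 R, forall x, Om x -> forall i j k l,
     dC i j k l x = dC j i k l x /\ dC i j k l x = dC k l i j x}.

Definition density_perturbation (R : realType) (Om : set (R * R * R))
    (drho : tensor2 R) : Prop :=
  (forall i k, in_Linfty Om (drho i k)) /\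
  {ae leb3 R, forall x, Om x -> forall i k, drho i k x = drho k i x}.

Definition reflection (R : realType) (k : 'I_3) : 'M[R]_3 :=
  diag_mx (\row_j (if j == k then -1 else 1)).
Definition rotation3 (R : realType) (theta : R) : 'M[R]_3 :=
  \matrix_(i, j) nth 0 (nth [::] [:: [:: cos theta; - sin theta; 0];
                                     [:: sin theta;   cos theta; 0];
                                     [::         0;           0; 1]] i) j.

Definition TI_matrices (R : realType) : set 'M[R]_3 :=
  [set Q | (exists k, Q = reflection R k) \/
           exists2 theta, 0 <= theta <= 2 * pi & Q = rotation3 theta].

Definition transversely_isotropic (R : realType) (Om : set (R * R * R))
    (e : 'cV[R]_3) (dC : tensor4 R) (drho : tensor2 R) : Prop :=
  exists S : 'M[R]_3, [/\ rotation S, S *m delta_mx 2%:R 0 = e &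
    {ae leb3 R, forall x, Om x -> forall Q0, TI_matrices Q0 ->
      let Q := S *m Q0 *m S^T in
      (forall i j k l,
         \sum_p \sum_q \sum_r \sum_s
           Q i p * Q j q * Q k r * Q l s * dC p q r s x = dC i j k l x) /\
      (forall i j, \sum_p \sum_q Q i p * Q j q * drho p q x = drho i j x)}].

(* A bounded linear operator from H^{1/2} to its dual H^{-1/2} is represented
   by the bounded bilinear form (f, g) |-> <L f, g>; the norm of H^{1/2} is the
   infimum of the H^1 norms of the extensions.                                *)
Definition bounded_operator (R : realType) (Om : set (R * R * R))
    (L : vfield R -> vfield R -> R[i]) : Prop :=
  [/\ forall (a : R[i]) f f' g, Hhalf Om f -> Hhalf Om f' -> Hhalf Om g ->
        L (fun j x => a * f j x + f' j x) g = a * L f g + L f' g,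
      forall (a : R[i]) f g g', Hhalf Om f -> Hhalf Om g -> Hhalf Om g' ->
        L f (fun j x => a * g j x + g' j x) = a * L f g + L f g'
    & exists K : R, forall f g u Du v Dv,
        H1_field Om u Du -> trace_field Om u Du f ->
        H1_field Om v Dv -> trace_field Om v Dv g ->
        ((sqnorm (L f g))%:E <=
           K%:E * (H1_sqnorm Om u Du * H1_sqnorm Om v Dv))%E].

Definition linearized_DN (R : realType) (Om : set (R * R * R))
    (lam mu rho w : R) (dC : tensor4 R) (drho : tensor2 R)
    (L : vfield R -> vfield R -> R[i]) : Prop :=
  bounded_operator Om L /\
  forall f g u Du v Dv,
    H1_field Om u Du -> lame_eq Om lam mu rho w u Du -> trace_field Om u Du f ->
    H1_field Om v Dv -> lame_eq Om lam mu rho w v Dv -> trace_field Om v Dv g ->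
    L f g = cint Om (fun x =>
      \sum_i \sum_j \sum_k \sum_l (dC i j k l x)%:C * Du i j x * Dv k l x
      - (w ^+ 2)%:C * \sum_i \sum_k (drho i k x)%:C * u i x * v k x).

Definition zero_operator (R : realType) (Om : set (R * R * R))
    (L : vfield R -> vfield R -> R[i]) : Prop :=
  forall f g, Hhalf Om f -> Hhalf Om g -> L f g = 0.

(* Main.v *)
Require Import Defs.
From HB Require Import structures.
From mathcomp Require Import all_boot all_order all_algebra complex.
From mathcomp Require Import all_classical all_reals all_analysis.
From mathcomp Require Import measurable_realfun.
From mathcomp Require Import ring lra.
Set Implicit Arguments.
Unset Strict Implicit.
Unset Printing Implicit Defensive.
Import Order.TTheory GRing.Theory Num.Theory.
Import numFieldNormedType.Exports.
Local Open Scope classical_set_scope.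
Local Open Scope ring_scope.
Local Open Scope complex_scope.

(** The linearized map is tested on complex plane waves [x |-> exp (z . x) a] with
    [z] a complex vector. Such a field solves the isotropic system at frequency
    [w] in two cases: shear waves, with [z . a = 0] and
    [z . z = - w ^ 2 rho / mu], and pressure waves, with [a = z] and
    [z . z = - w ^ 2 rho / (lam + 2 mu)]. When the two wave vectors add up to
    [i xi] with [xi] real, the product of two waves is the Fourier kernel at
    [xi], and the vanishing of the linearized map becomes a linear relation
    between the Fourier coefficients at [xi] of the components of the
    perturbation ([wave_pair_identity]).

    A transversely isotropic perturbation has seven coefficient functions: five
    for the elastic tensor ([ti_tensorE]) and two for the density
    ([ti_densityE]). Contracting the normal form with the waves gives a bilinear
    symbol ([symbol_contraction]), and the heart of the proof is that this
    symbol, known to vanish on all pairs of waves with [z + z' = i xi], has zero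
    coefficients ([symbol_injective]). If [xi] is not parallel to the axis [e],
    the wave vectors are [z = i xi / 2 + eta] and [z' = i xi / 2 - eta] where the
    component [s] of [eta] along [e] can be chosen freely ([split_wave_vector]).
    Every relation is thus a polynomial identity in [s].
    - Shear waves polarized along [cross e z] ([symbol_SH]) involve only [C2], [C4]
      and [r1]. The term in [s ^ 4] gives [C4 = 0]. What remains equates [C2]
      times an affine function of [w ^ 2] with [w ^ 2 r1]. At a single frequency
      this has nonzero solutions, whereas two frequencies force
      [C2 = r1 = 0].
    - Shear waves polarized in the plane of [e] and [z] ([symbol_SV]) then give
      [C5 = r2 = 0].
    - Pressure waves ([symbol_PP]) then give [C3 = C1 = 0].

    The Fourier coefficients of the seven functions therefore vanish off the line
    spanned by [e], and by continuity everywhere ([coefficient_null]). It remains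
    to know that an integrable function on a bounded set with vanishing Fourier
    transform is zero almost everywhere ([fourier_uniqueness]). The transform
    tests the function against all trigonometric polynomials; products of steep
    periodic profiles converge boundedly on the domain to indicators of octants,
    and octants generate the Borel sets. *)
(** * Integrals of complex functions *)

Section ComplexIntegral.
Variable R : realType.
Implicit Types (A Om : set (R * R * R)) (f g : R * R * R -> R[i]).

Lemma cReD (x y : R[i]) : complex.Re (x + y) = complex.Re x + complex.Re y.
Proof. by case: x y => ? ? []. Qed.
Lemma cImD (x y : R[i]) : complex.Im (x + y) = complex.Im x + complex.Im y.
Proof. by case: x y => ? ? []. Qed.
Lemma cReN (x : R[i]) : complex.Re (- x) = - complex.Re x.
Proof. by case: x. Qed.
Lemma cImN (x : R[i]) : complex.Im (- x) = - complex.Im x.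
Proof. by case: x. Qed.
Lemma cReM (x y : R[i]) :
  complex.Re (x * y) = complex.Re x * complex.Re y - complex.Im x * complex.Im y.
Proof. by case: x y => ? ? []. Qed.
Lemma cImM (x y : R[i]) :
  complex.Im (x * y) = complex.Re x * complex.Im y + complex.Im x * complex.Re y.
Proof. by case: x y => ? ? []. Qed.
Definition cReImE := (cReD, cImD, cReN, cImN, cReM, cImM).

Lemma complexP (x y : R[i]) :
  complex.Re x = complex.Re y -> complex.Im x = complex.Im y -> x = y.
Proof. by case: x y => a b [c d] /= -> ->. Qed.

(** [cint] is a pair of real integrals, which are additive only when both parts
    are integrable. *)
Definition cintegrable A f : Prop :=
  (leb3 R).-integrable A (EFin \o re f) /\ (leb3 R).-integrable A (EFin \o im f).

Variable Om : set (R * R * R).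
Hypothesis mOm : measurable Om.

Lemma eq_cint f g : (forall x, Om x -> f x = g x) -> cint Om f = cint Om g.
Proof.
move=> fg; rewrite /cint; congr Complex.
  by apply: eq_Rintegral => x /set_mem xA; rewrite /re fg.
by apply: eq_Rintegral => x /set_mem xA; rewrite /im fg.
Qed.

Lemma eq_cintegrable f g : (forall x, Om x -> f x = g x) ->
  cintegrable Om f -> cintegrable Om g.
Proof.
by move=> fg [rf jf]; split; [apply: eq_integrable rf|apply: eq_integrable jf];
  rewrite // => x /set_mem xA; rewrite /= /re /im fg.
Qed.

Lemma cintegrableD f g : cintegrable Om f -> cintegrable Om g ->
  cintegrable Om (fun x => f x + g x).
Proof.
move=> [rf jf] [rg jg]; split.
  rewrite (_ : _ \o _ = (EFin \o re f) \+ (EFin \o re g))%E; first exact: integrableD.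
  by apply/funext => x; rewrite /= /re cReD EFinD.
rewrite (_ : _ \o _ = (EFin \o im f) \+ (EFin \o im g))%E; first exact: integrableD.
by apply/funext => x; rewrite /= /im cImD EFinD.
Qed.

Lemma cintD f g : cintegrable Om f -> cintegrable Om g ->
  cint Om (fun x => f x + g x) = cint Om f + cint Om g.
Proof.
move=> [rf jf] [rg jg]; rewrite /cint /=; congr Complex; rewrite -RintegralD//.
  by apply: eq_Rintegral => x _; rewrite /re cReD.
by apply: eq_Rintegral => x _; rewrite /im cImD.
Qed.

Lemma integrable_Rlin (a b : R) (u v : R * R * R -> R) :
  (leb3 R).-integrable Om (EFin \o u) -> (leb3 R).-integrable Om (EFin \o v) ->
  (leb3 R).-integrable Om (EFin \o (fun x => a * u x + b * v x)).
Proof.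
move=> iu iv.
rewrite (_ : _ \o _ = (fun x => a%:E * (EFin \o u) x) \+
   (fun x => b%:E * (EFin \o v) x))%E; last by apply/funext => x; rewrite /= EFinD !EFinM.
by apply: integrableD => //; exact: integrableZl.
Qed.

Lemma Rintegral_lin (a b : R) (u v : R * R * R -> R) :
  (leb3 R).-integrable Om (EFin \o u) -> (leb3 R).-integrable Om (EFin \o v) ->
  \int[leb3 R]_(x in Om) (a * u x + b * v x) =
  a * \int[leb3 R]_(x in Om) u x + b * \int[leb3 R]_(x in Om) v x.
Proof.
move=> iu iv.
have iZ (c : R) (w : R * R * R -> R) : (leb3 R).-integrable Om (EFin \o w) ->
    (leb3 R).-integrable Om (EFin \o (fun x => c * w x)).
  move=> iw; rewrite (_ : _ \o _ = (fun x => c%:E * (EFin \o w) x)%E).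
    exact: integrableZl.
  by apply/funext => x; rewrite /= EFinM.
by rewrite RintegralD ?RintegralZl//; exact: iZ.
Qed.

Lemma cintegrableZ (c : R[i]) f : cintegrable Om f ->
  cintegrable Om (fun x => c * f x).
Proof.
move=> [rf jf]; split.
  rewrite (_ : re _ = fun x => complex.Re c * re f x + (- complex.Im c) * im f x);
    first exact: integrable_Rlin.
  by apply/funext => x; rewrite /re cReM mulNr.
rewrite (_ : im _ = fun x => complex.Re c * im f x + complex.Im c * re f x);
    first exact: integrable_Rlin.
by apply/funext => x; rewrite /im cImM.
Qed.

Lemma cintZ (c : R[i]) f : cintegrable Om f ->
  cint Om (fun x => c * f x) = c * cint Om f.
Proof.
move=> [rf jf]; apply: complexP; rewrite ?cReM ?cImM /cint /=.
  rewrite -mulNr -Rintegral_lin//; apply: eq_Rintegral => x _.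
  by rewrite /re cReM mulNr.
by rewrite -Rintegral_lin//; apply: eq_Rintegral => x _; rewrite /im cImM.
Qed.

Lemma cint0 : cint Om (fun=> 0) = 0.
Proof. by rewrite /cint /re /im /= /Rintegral integral0. Qed.

Lemma cintegrable0 : cintegrable Om (fun=> 0).
Proof. by split; exact: integrable0. Qed.

Lemma cintegrable_sum (I : Type) (r : seq I) (F : I -> R * R * R -> R[i]) :
  (forall i, cintegrable Om (F i)) ->
  cintegrable Om (fun x => \sum_(i <- r) F i x).
Proof.
move=> iF; elim: r => [|i r IH].
  rewrite (_ : (fun x => \sum_(i <- [::]) F i x) = fun=> 0); first exact: cintegrable0.
  by apply/funext => x; rewrite big_nil.
rewrite (_ : (fun x => \sum_(j <- _) F j x) = fun x => F i x + \sum_(j <- r) F j x).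
  exact: cintegrableD.
by apply/funext => x; rewrite big_cons.
Qed.

Lemma cint_sum (I : Type) (r : seq I) (F : I -> R * R * R -> R[i]) :
  (forall i, cintegrable Om (F i)) ->
  cint Om (fun x => \sum_(i <- r) F i x) = \sum_(i <- r) cint Om (F i).
Proof.
move=> iF; elim: r => [|i r IH].
  by rewrite big_nil -[RHS]cint0; apply: eq_cint => x _; rewrite big_nil.
rewrite big_cons -IH -cintD//; last exact: cintegrable_sum.
by apply: eq_cint => x _; rewrite big_cons.
Qed.

End ComplexIntegral.

(** * Borel sets of space *)

(** A countable neighbourhood basis made of measurable sets makes open sets
    measurable, and passes to products. The neighbourhoods are a parameter because
    on a product the topology and the sigma-algebra are built independently of
    each other. *)
Definition measurable_basis d (T : measurableType d) (U : T -> set (set T)) :=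
  exists (I : countType) (b : I -> set T), (forall i, measurable (b i)) /\
    forall x A, U x A -> exists2 i, b i x & b i `<=` A.

Section MeasurableBasis.
Variable R : realType.

Lemma measurable_basis_real : @measurable_basis _ R (fun x => nbhs x).
Proof.
exists (rat * rat)%type, (fun q => `]ratr q.1, ratr q.2[%classic); split.
  by move=> q; exact: measurable_itv.
move=> x A /nbhs_ballP[e /= e0 eA].
have /rat_in_itvoo[p pP] : x - e < x by rewrite ltrBlDr ltrDl.
have /rat_in_itvoo[q qP] : x < x + e by rewrite ltrDl.
move: pP qP; rewrite !in_itv /= => /andP[p1 p2] /andP[q1 q2].
exists (p, q) => /=; first by rewrite in_itv /= p2 q1.
move=> y /=; rewrite in_itv /= => /andP[py yq]; apply: eA.
by rewrite /ball /= ltr_distlC; apply/andP; split; lra.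
Qed.

Lemma measurable_basis_prod d1 d2 (T1 : measurableType d1) (T2 : measurableType d2)
    (U1 : T1 -> set (set T1)) (U2 : T2 -> set (set T2)) :
  measurable_basis U1 -> measurable_basis U2 ->
  @measurable_basis _ (T1 * T2)%type
    (fun x => filter_prod (U1 x.1) (U2 x.2)).
Proof.
move=> [I [b [mb bP]]] [J [c [mc cP]]].
exists (I * J)%type, (fun ij => b ij.1 `*` c ij.2); split.
  by move=> ij; exact: measurableX.
move=> [x y] A [[B C] /= [/bP[i bix biB] /cP[j cjx cjC]] BCA].
exists (i, j) => //= z [z1 z2]; apply: BCA; split; [exact: biB|exact: cjC].
Qed.

Lemma open_measurable_basis d (T : measurableType d) (U : T -> set (set T))
    (A : set T) :
  measurable_basis U -> (forall x, A x -> U x A) -> measurable A.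
Proof.
move=> [I [b [mb bP]]] oA.
rewrite (_ : A = \bigcup_i (if `[< b i `<=` A >] then b i else set0)).
  apply: countable_bigcupT_measurable => // i; by case: ifP.
apply/seteqP; split=> [x Ax|x [i _]].
  by have [i bix biA] := bP _ _ (oA _ Ax); exists i => //; case: asboolP.
by case: asboolP => // biA /biA.
Qed.

Lemma measurable_fun_continuous_at d (T : measurableType d)
    (U : T -> set (set T)) (A : set T) (f : T -> R) :
  measurable_basis U -> (forall x B C, B `<=` C -> U x B -> U x C) ->
  (forall x, A x -> U x A) -> (forall x B C, U x B -> U x C -> U x (B `&` C)) ->
  (forall x, A x -> forall B, open B -> B (f x) -> U x (f @^-1` B)) ->
  measurable_fun A f.
Proof.
move=> bU Umon oA UI cf mA; apply: (measurability _ (RGenOpens.measurableE R)) => //.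
move=> _ [_ [a [b ->] <-]]; apply: (open_measurable_basis bU) => x [Ax fx].
by apply: UI; [exact: oA|apply: cf => //; exact: interval_open].
Qed.

Lemma basis2 : @measurable_basis _ (R * R)%type (fun x => nbhs x).
Proof. exact: (measurable_basis_prod measurable_basis_real measurable_basis_real). Qed.

Lemma basis3 : @measurable_basis _ (R * R * R)%type (fun x => nbhs x).
Proof. exact: (measurable_basis_prod basis2 measurable_basis_real). Qed.

Lemma open_measurable3 (A : set (R * R * R)) : open A -> measurable A.
Proof. by rewrite openE => oA; apply: (open_measurable_basis basis3) => x /oA. Qed.

Lemma open_measurable2 (A : set (R * R)) : open A -> measurable A.
Proof. by rewrite openE => oA; apply: (open_measurable_basis basis2) => x /oA. Qed.

Lemma continuous_measurable3 (f : R * R * R -> R) : continuous f ->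
  measurable_fun setT f.
Proof.
move=> cf; apply: (measurable_fun_continuous_at basis3) => //.
- by move=> x B C BC; exact: filterS.
- by move=> x _; exact: filterT.
- by move=> x B C; exact: filterI.
- by move=> x _ B oB Bfx; apply: (cf x B); exact: open_nbhs_nbhs.
Qed.

Lemma continuous_measurable2 (D : set (R * R)) (f : R * R -> R) : open D ->
  (forall x, D x -> {for x, continuous f}) -> measurable_fun D f.
Proof.
move=> oD cf; apply: (measurable_fun_continuous_at basis2) => //.
- by move=> x B C BC; exact: filterS.
- by move=> x B C; exact: filterI.
- by move=> x Dx B oB Bfx; apply: (cf x Dx B); exact: open_nbhs_nbhs.
Qed.

Lemma leb2_box (A B : set R) : measurable A -> measurable B ->
  leb2 R (A `*` B) = (lebesgue_measure A * lebesgue_measure B)%E.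
Proof. by move=> mA mB; exact: product_measure1E. Qed.

Lemma leb3_box (A : set (R * R)) (B : set R) : measurable A -> measurable B ->
  leb3 R (A `*` B) = (leb2 R A * lebesgue_measure B)%E.
Proof. by move=> mA mB; exact: product_measure1E. Qed.

Lemma ae3_and (P Q S : R * R * R -> Prop) :
  {ae leb3 R, forall x, P x} -> {ae leb3 R, forall x, Q x} ->
  (forall x, P x -> Q x -> S x) -> {ae leb3 R, forall x, S x}.
Proof.
move=> p q pqs; apply: negligibleS (negligibleU p q) => x nSx /=.
by apply/not_andP => -[px qx]; apply: nSx; exact: pqs.
Qed.

Definition box (M : R) : set R := `[- M, M]%classic.

Lemma box_lty M : (lebesgue_measure (box M) < +oo)%E.
Proof. by rewrite /box lebesgue_measure_itv /=; case: ifP => _; rewrite ltry. Qed.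

Lemma box2_lty M : (leb2 R (box M `*` box M) < +oo)%E.
Proof.
rewrite leb2_box; [|exact: measurable_itv..].
by apply: lte_mul_pinfty; rewrite ?ge0_fin_numE ?box_lty//.
Qed.

(* Fubini for [leb3], the product of [leb2] and a line, asks for [leb2] to be
   sigma-finite. *)
Let sigma_finite_leb2 : sigma_finite setT (leb2 R).
Proof.
exists (fun n => box n%:R `*` box n%:R) => [|n]; last first.
  by split; [apply: measurableX; exact: measurable_itv|exact: box2_lty].
apply/seteqP; split=> // -[x y] _; have [n xyn] : exists n : nat, `|x| <= n%:R /\ `|y| <= n%:R.
  exists (Num.bound (`|x| + `|y|)); have := @archi_boundP _ (`|x| + `|y|) (addr_ge0 (normr_ge0 _) (normr_ge0 _)).
  by have := normr_ge0 x; have := normr_ge0 y; split; lra.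
by exists n => //; split; rewrite /box /= in_itv /= -ler_norml; case: xyn.
Qed.

HB.instance Definition _ := Measure_isSigmaFinite.Build _ _ _ (leb2 R)
  sigma_finite_leb2.

Lemma box3_lty M : (leb3 R (box M `*` box M `*` box M) < +oo)%E.
Proof.
rewrite leb3_box; [|apply: measurableX; exact: measurable_itv|exact: measurable_itv].
by apply: lte_mul_pinfty; rewrite ?ge0_fin_numE ?box_lty ?box2_lty//.
Qed.

Lemma measurable_box3 M : measurable (box M `*` box M `*` box M).
Proof. by do 2 (apply: measurableX; last exact: measurable_itv); exact: measurable_itv. Qed.

Lemma norm3_le (x : R * R * R) (M : R) :
  (`|x| <= M) = [&& `|x.1.1| <= M, `|x.1.2| <= M & `|x.2| <= M].
Proof. by rewrite prod_normE ge_max prod_normE ge_max /= andbA. Qed.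

Lemma bounded_box (A : set (R * R * R)) : bounded_set A ->
  exists M : R, 0 < M /\ A `<=` box M `*` box M `*` box M.
Proof.
move=> [M [_ AM]]; exists (`|M| + 1); split; first by rewrite ltr_wpDl.
move=> x Ax; have : `|x| <= `|M| + 1.
  by apply: AM Ax; rewrite ltr_pwDr// ler_norm.
rewrite norm3_le => /and3P[x1 x2 x3]; split; [split|];
  by rewrite /box /= in_itv /= -ler_norml.
Qed.

Lemma bounded_leb3_lty (A : set (R * R * R)) : measurable A -> bounded_set A ->
  (leb3 R A < +oo)%E.
Proof.
move=> mA /bounded_box[M [_ AM]]; apply: le_lt_trans (box3_lty M).
by apply: le_measure; rewrite ?inE//; exact: measurable_box3.
Qed.

End MeasurableBasis.

(** * Complex exponentials *)

Section PlaneWave.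
Variable R : realType.

Definition cexp (w : R[i]) : R[i] :=
  (expR (complex.Re w) * cos (complex.Im w)) +i*
  (expR (complex.Re w) * sin (complex.Im w)).

Lemma cexpD (v w : R[i]) : cexp (v + w) = cexp v * cexp w.
Proof.
case: v w => a b [c d]; rewrite /cexp /= expRD cosD sinD.
by apply: complexP => /=; ring.
Qed.

Definition crd (x : R * R * R) (k : 'I_3) : R := nth 0 [:: x.1.1; x.1.2; x.2] k.

Definition pdot (z : 'I_3 -> R[i]) (x : R * R * R) : R[i] :=
  \sum_k z k * (crd x k)%:C.

(** The factor [i] of the usual plane wave is absorbed into [z]: growth and decay
    come from the real part of [z], oscillation from its imaginary part. *)
Definition pw (z : 'I_3 -> R[i]) (x : R * R * R) : R[i] := cexp (pdot z x).

Lemma pwD (z z' : 'I_3 -> R[i]) x :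
  pw (fun k => z k + z' k) x = pw z x * pw z' x.
Proof.
rewrite /pw -cexpD /pdot -big_split /=; congr cexp.
by apply: eq_bigr => k _; rewrite mulrDl.
Qed.

Lemma pdotE z x : pdot z x = (\sum_k complex.Re (z k) * crd x k) +i*
  (\sum_k complex.Im (z k) * crd x k).
Proof.
rewrite /pdot; apply: complexP; rewrite /= !big_ord_recl !big_ord0;
by rewrite !cReImE /=; ring.
Qed.

Lemma measurable_crd k : measurable_fun setT (crd ^~ k).
Proof.
have m1 : measurable_fun setT (fun x : R * R * R => x.1) by exact: measurable_fst.
case: k => -[|[|[|//]]] ?; rewrite /crd /=.
- exact: (measurableT_comp measurable_fst m1).
- exact: (measurableT_comp measurable_snd m1).
- exact: measurable_snd.
Qed.

Lemma measurable_lin (a : 'I_3 -> R) :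
  measurable_fun setT (fun x => \sum_k a k * crd x k).
Proof.
apply: measurable_sum => k; apply: measurable_funM => //; exact: measurable_crd.
Qed.

Lemma measurable_re_pw z : measurable_fun setT (re (pw z)).
Proof.
rewrite (_ : re _ = fun x => expR (\sum_k complex.Re (z k) * crd x k) *
  cos (\sum_k complex.Im (z k) * crd x k)); last first.
  by apply/funext => x; rewrite /re /pw pdotE.
apply: measurable_funM.
  by apply: measurableT_comp; [exact: measurable_expR|exact: measurable_lin].
apply: measurableT_comp; last exact: measurable_lin.
by apply: continuous_measurable_fun; exact: continuous_cos.
Qed.

Lemma measurable_im_pw z : measurable_fun setT (im (pw z)).
Proof.
rewrite (_ : im _ = fun x => expR (\sum_k complex.Re (z k) * crd x k) *
  sin (\sum_k complex.Im (z k) * crd x k)); last first.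
  by apply/funext => x; rewrite /im /pw pdotE.
apply: measurable_funM.
  by apply: measurableT_comp; [exact: measurable_expR|exact: measurable_lin].
apply: measurableT_comp; last exact: measurable_lin.
by apply: continuous_measurable_fun; exact: continuous_sin.
Qed.

Lemma norm_crd_le (x : R * R * R) k : `|crd x k| <= `|x|.
Proof.
have := lexx `|x|; rewrite norm3_le => /and3P[x1 x2 x3].
by case: k => -[|[|[|//]]] ?.
Qed.

Lemma bounded_pw z (A : set (R * R * R)) : bounded_set A ->
  exists M : R, 0 < M /\
    forall x, A x -> `|re (pw z) x| <= M /\ `|im (pw z) x| <= M.
Proof.
move=> [N [_ AN]]; exists (expR (\sum_k `|complex.Re (z k)| * (`|N| + 1))).
split; first exact: expR_gt0.
move=> x Ax; have xN : `|x| <= `|N| + 1 by apply: AN Ax; rewrite ltr_pwDr// ler_norm.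
have le1 : expR (\sum_k complex.Re (z k) * crd x k) <=
    expR (\sum_k `|complex.Re (z k)| * (`|N| + 1)).
  rewrite ler_expR; apply: ler_sum => k _; apply: le_trans (ler_norm _) _.
  by rewrite normrM ler_wpM2l//; apply: le_trans xN; exact: norm_crd_le.
rewrite /re /im /pw pdotE /= !normrM !(ger0_norm (expR_ge0 _)).
have c1 (t : R) : `|cos t| <= 1 by rewrite ler_norml cos_geN1 cos_le1.
by split; apply: le_trans le1; rewrite ler_piMr ?expR_ge0// ?c1// sin_max.
Qed.

End PlaneWave.

(** * Uniqueness of the Fourier transform *)

Section Plateau.
Variable R : realType.

(** These powers converge on [[0, 1]] to the indicator of [q < 1/2], threshold
    included, while being polynomials in [q]. With [N = n 2 ^ n], the product
    [N q ^ n] tends to zero for [q < 1/2] and is at least [n] for [1/2 <= q],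
    so that [(1 - q ^ n) ^ N] tends to one, respectively to zero. *)
Definition plateau (n : nat) (q : R) : R := (1 - q ^+ n) ^+ (n * 2 ^ n).

Lemma bernoulli (y : R) n : -1 <= y -> 1 + n%:R * y <= (1 + y) ^+ n.
Proof.
move=> y1; elim: n => [|n IH]; first by rewrite mul0r addr0 expr0.
have h : 0 <= 1 + y by lra.
rewrite exprS; apply: le_trans (ler_wpM2l h IH).
by rewrite -natr1; have : 0 <= n%:R * y ^+ 2 :> R by [rewrite mulr_ge0 ?sqr_ge0|]; nra.
Qed.

Lemma plateau_itv n (q : R) : 0 <= q <= 1 -> 0 <= plateau n q <= 1.
Proof.
move=> /andP[q0 q1]; have h0 : 0 <= q ^+ n by exact: exprn_ge0.
have h1 : q ^+ n <= 1 by exact: exprn_ile1.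
by rewrite /plateau exprn_ge0 ?exprn_ile1//=; lra.
Qed.

(** Bernoulli applied to the square root of [r] leaves a spare geometric factor
    which absorbs the linear growth. *)
Lemma cvg_natM_expr (r : R) : 0 <= r < 1 -> (fun n => n%:R * r ^+ n) @ \oo --> 0.
Proof.
move=> /andP[r0 r1].
have [->|rn0] := eqVneq r 0.
  apply: cvg_near_cst; exists 1%N => //= n; rewrite expr0n => /lt0n_neq0/negbTE ->.
  by rewrite mulr0.
set p := Num.sqrt r; have pr : p ^+ 2 = r by rewrite sqr_sqrtr.
have p0 : 0 < p by rewrite sqrtr_gt0 lt_neqAle eq_sym rn0.
have p1 : p < 1 by nra.
have pi0 : 0 < p^-1 by rewrite invr_gt0.
set d := p^-1 - 1; have d0 : 0 < d by rewrite subr_gt0 invf_gt1.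
have le n : n%:R * r ^+ n <= d^-1 * p ^+ n.
  rewrite -pr -exprM mulnC exprM expr2 mulrA ler_wpM2r ?exprn_ge0 ?(ltW p0)//.
  have := @bernoulli d n; rewrite /d addrCA subrr addr0 => /(_ ltac:(lra)).
  rewrite exprVn => h; rewrite -[leRHS]mul1r ler_pdivlMr// mulrAC.
  rewrite -ler_pdivlMr ?exprn_gt0// mul1r; apply: le_trans h.
  by rewrite /d; lra.
apply: (@squeeze_cvgr _ _ _ _ (cst 0) (fun n => d^-1 * p ^+ n)).
- by near=> n; rewrite le mulr_ge0 ?exprn_ge0.
- exact: cvg_cst.
- by apply: cvg_geometric; rewrite ger0_norm ?(ltW p0).
Unshelve. all: by end_near. Qed.

(** Bernoulli bounds [(1 - y) ^ N] from below by [1 - N y], and, through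
    [(1 - y) ^ N (1 + y) ^ N <= 1], from above by [1 / (1 + N y)]. *)
Lemma cvg_plateau (q : R) : 0 <= q <= 1 ->
  (fun n => plateau n q) @ \oo --> (((q < 2^-1)%R)%:R : R).
Proof.
move=> /[dup] q01 /andP[q0 q1]; have [ql|qg] := ltP q 2^-1.
  have r01 : 0 <= 2 * q < 1 by lra.
  apply: (@squeeze_cvgr _ _ _ _ (fun n => 1 - n%:R * (2 * q) ^+ n) (cst 1)).
  - near=> n; have /andP[_ ->] := plateau_itv n q01; rewrite andbT /plateau.
    have h1 : q ^+ n <= 1 by exact: exprn_ile1.
    have := @bernoulli (- q ^+ n) (n * 2 ^ n) ltac:(lra).
    by apply: le_trans; rewrite exprMn natrM natrX; lra.
  - by rewrite -[X in _ --> X]subr0; apply: cvgB; [exact: cvg_cst|exact: cvg_natM_expr].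
  - exact: cvg_cst.
apply: (@squeeze_cvgr _ _ _ _ (cst 0) (fun n => n.+1%:R^-1)).
- near=> n; have /andP[-> _] := plateau_itv n q01; rewrite /= /plateau.
  set y := q ^+ n; set N := (n * 2 ^ n)%N.
  have y0 : 0 <= y by exact: exprn_ge0.
  have y1 : y <= 1 by exact: exprn_ile1.
  have hN : 1 + n%:R <= (1 + y) ^+ N.
    apply: le_trans (bernoulli N _); last lra.
    rewrite lerD2l /N natrM -mulrA -[leLHS]mulr1 ler_wpM2l//.
    rewrite natrX /y -exprMn exprn_ege1//; lra.
  have hP : (1 - y) ^+ N * (1 + y) ^+ N <= 1.
    by rewrite -exprMn exprn_ile1//; nra.
  rewrite -[leRHS]mul1r ler_pdivlMr// -natr1 [n%:R + 1]addrC; apply: le_trans hP.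
  by rewrite ler_wpM2l// exprn_ge0//; lra.
- exact: cvg_cst.
- exact: cvg_harmonic.
Unshelve. all: by end_near. Qed.

End Plateau.

Section TrigPoly.
Variable R : realType.

Definition ipw (xi : 'I_3 -> R) : R * R * R -> R[i] := pw (fun k => 0 +i* xi k).

Lemma ipwE xi x : ipw xi x =
  cos (\sum_k xi k * crd x k) +i* sin (\sum_k xi k * crd x k).
Proof.
rewrite /ipw /pw pdotE /cexp /= big1 ?expR0 ?mul1r//.
by move=> k _; rewrite mul0r.
Qed.

Lemma ipwD xi eta x : ipw (fun k => xi k + eta k) x = ipw xi x * ipw eta x.
Proof.
rewrite /ipw -[RHS]pwD; congr (pw _ x); apply/funext => k.
by apply: complexP; rewrite !cReImE /= ?addr0.
Qed.

(** Closed under products, and therefore under polynomials, because the product of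
    two exponentials is an exponential; any real frequencies are allowed. *)
Inductive trig_poly : (R * R * R -> R[i]) -> Prop :=
| trig_exp (c : R[i]) (xi : 'I_3 -> R) : trig_poly (fun x => c * ipw xi x)
| trig_add f g : trig_poly f -> trig_poly g -> trig_poly (fun x => f x + g x).

Lemma trig_mul f g : trig_poly f -> trig_poly g -> trig_poly (fun x => f x * g x).
Proof.
move=> tf; elim: tf g => [c xi g|f1 f2 _ IH1 _ IH2 g tg]; last first.
  rewrite (_ : (fun x => _) = fun x => f1 x * g x + f2 x * g x).
    by apply: trig_add; [exact: IH1|exact: IH2].
  by apply/funext => x; rewrite mulrDl.
elim=> [d eta|g1 g2 _ IH1 _ IH2].
  rewrite (_ : (fun x => _) = fun x => (c * d) * ipw (fun k => xi k + eta k) x).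
    exact: trig_exp.
  by apply/funext => x; rewrite ipwD; ring.
rewrite (_ : (fun x => _) = fun x => c * ipw xi x * g1 x + c * ipw xi x * g2 x).
  exact: trig_add.
by apply/funext => x; rewrite mulrDr.
Qed.

Lemma trig_cst c : trig_poly (fun=> c).
Proof.
rewrite (_ : (fun=> c) = fun x => c * ipw (fun=> 0) x); first exact: trig_exp.
apply/funext => x; rewrite ipwE big1 ?cos0 ?sin0 ?mulr1//.
by move=> k _; rewrite mul0r.
Qed.

Lemma trig_pow f n : trig_poly f -> trig_poly (fun x => f x ^+ n).
Proof.
move=> tf; elim: n => [|n IH]; first exact: trig_cst.
rewrite (_ : (fun x => _) = fun x => f x * f x ^+ n); first exact: trig_mul.
by apply/funext => x; rewrite exprS.
Qed.

Lemma trig_prod (I : Type) (r : seq I) (f : I -> R * R * R -> R[i]) :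
  (forall i, trig_poly (f i)) -> trig_poly (fun x => \prod_(i <- r) f i x).
Proof.
move=> tf; elim: r => [|i r IH].
  rewrite (_ : (fun x => _) = fun=> 1); first exact: trig_cst.
  by apply/funext => x; rewrite big_nil.
rewrite (_ : (fun x => _) = fun x => f i x * \prod_(j <- r) f j x).
  exact: trig_mul.
by apply/funext => x; rewrite big_cons.
Qed.

(** The profile across the plane where the coordinate [k] equals [a]: less than
    one half before the plane and more after it, as long as the argument of the
    sine stays strictly between [- pi] and [pi]. *)
Definition step (k : 'I_3) (a c : R) (x : R * R * R) : R :=
  (1 + sin (c * (crd x k - a))) / 2.

Lemma step_itv k a c x : 0 <= step k a c x <= 1.
Proof.
by have := sin_geN1 (c * (crd x k - a)); have := sin_le1 (c * (crd x k - a));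
  rewrite /step; lra.
Qed.

Lemma trig_step k a c : trig_poly (fun x => (step k a c x)%:C).
Proof.
pose e (s : R) : 'I_3 -> R := fun j => if j == k then s else 0.
have ipw_e s x : ipw (e s) x = cos (s * crd x k) +i* sin (s * crd x k).
  rewrite ipwE (bigD1 k)//= big1 => [|j jk]; rewrite /e ?eqxx ?addr0//.
  by rewrite (negbTE jk) mul0r.
pose v : R[i] := (- sin (c * a) / 4) +i* (- cos (c * a) / 4).
pose w : R[i] := (- sin (c * a) / 4) +i* (cos (c * a) / 4).
rewrite (_ : (fun x => _) = fun x => v * ipw (e c) x + w * ipw (e (- c)) x + 2^-1%:C).
  by apply: trig_add; [apply: trig_add; exact: trig_exp|exact: trig_cst].
apply/funext => x; rewrite !ipw_e /step mulrBr sinB !mulNr sinN cosN /v /w.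
by apply: complexP; rewrite !cReImE /=; field.
Qed.

Lemma trig_plateau n k a c : trig_poly (fun x => (plateau n (step k a c x))%:C).
Proof.
rewrite (_ : (fun x => _) =
    fun x => (1 + (-1) * (step k a c x)%:C ^+ n) ^+ (n * 2 ^ n)).
  apply: trig_pow; apply: trig_add; first exact: trig_cst.
  apply: trig_mul; first exact: trig_cst.
  by apply: trig_pow; exact: trig_step.
by apply/funext => x; rewrite /plateau rmorphXn rmorphB rmorph1 rmorphXn mulN1r.
Qed.

Lemma step_lt_half k a c x : `|c * (crd x k - a)| < 2 -> 0 < c ->
  (step k a c x < 2^-1) = (crd x k < a).
Proof.
move=> cx c0; set t := c * (crd x k - a) in cx *.
have pi2 := pi_ge2 R; rewrite ltr_norml in cx; move: cx => /andP[cx1 cx2].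
rewrite /step -/t; have [xa|ax|xa] := ltrgtP (crd x k) a.
- have t0 : t < 0 by rewrite pmulr_rlt0// subr_lt0.
  have : 0 < sin (- t) by apply: sin_gt0_pi; apply/andP; split; lra.
  by rewrite sinN; lra.
- have t0 : 0 < t by rewrite mulr_gt0// subr_gt0.
  have : 0 < sin t by apply: sin_gt0_pi; apply/andP; split; lra.
  by move=> ?; apply/negbTE; rewrite -leNgt; lra.
- by rewrite /t xa subrr mulr0 sin0 addr0 mul1r ltxx.
Qed.

Definition octant (a : 'I_3 -> R) : set (R * R * R) :=
  [set x | forall k, crd x k < a k].

Lemma measurable_octant a : measurable (octant a).
Proof.
rewrite (_ : octant a = \bigcap_(k in [set: 'I_3]) (crd (R:=R))^~ k @^-1` `]-oo, a k[%classic).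
  apply: fin_bigcap_measurable => // k _; rewrite -[X in measurable X]setTI.
  by apply: measurable_crd => //; exact: measurable_itv.
by apply/seteqP; split=> x /= xa k => [_|]; have := xa k; rewrite /= in_itv//=; apply.
Qed.

End TrigPoly.

Section FourierUniqueness.
Variables (R : realType) (Om : set (R * R * R)).
Hypotheses (mOm : measurable Om) (bOm : bounded_set Om).
Variable h : R * R * R -> R.
Hypothesis ih : (leb3 R).-integrable Om (EFin \o h).

Lemma cintegrable_pw z : cintegrable Om (fun x => (h x)%:C * pw z x).
Proof.
have [M [M0 zM]] := bounded_pw z bOm.
have bnd (g : R * R * R -> R) : (forall x, Om x -> `|g x| <= M) -> [bounded g x | x in Om].
  move=> gM; exists M; split; first exact: num_real.
  by move=> y My x Ax; apply: le_trans (gM _ Ax) (ltW My).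
split.
  rewrite (_ : _ \o _ = (EFin \o re (pw z)) \* (EFin \o h))%E.
    apply: integrableMr => //.
      by apply: measurable_funS (measurable_re_pw z).
    by apply: bnd => x /zM[].
  by apply/funext => x; rewrite /= [in LHS]/re cReM mul0r subr0 mulrC.
rewrite (_ : _ \o _ = (EFin \o im (pw z)) \* (EFin \o h))%E.
  apply: integrableMr => //.
    by apply: measurable_funS (measurable_im_pw z).
  by apply: bnd => x /zM[].
by apply/funext => x; rewrite /= [in LHS]/im cImM mul0r addr0 mulrC.
Qed.

Hypothesis h0 : forall xi, cint Om (fun x => (h x)%:C * ipw xi x) = 0.

Lemma trig_orthogonal f : trig_poly f ->
  cintegrable Om (fun x => (h x)%:C * f x) /\ cint Om (fun x => (h x)%:C * f x) = 0.
Proof.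
elim=> [c xi|f1 f2 _ [i1 o1] _ [i2 o2]].
  rewrite (_ : (fun x => _) = fun x => c * ((h x)%:C * ipw xi x)).
    split; first by apply: cintegrableZ => //; exact: cintegrable_pw.
    by rewrite cintZ ?h0 ?mulr0//; exact: cintegrable_pw.
  by apply/funext => x; ring.
rewrite (_ : (fun x => _) = fun x => (h x)%:C * f1 x + (h x)%:C * f2 x).
  by split; [exact: cintegrableD|rewrite cintD// o1 o2 addr0].
by apply/funext => x; rewrite mulrDr.
Qed.

(** The product over the three coordinates of the plateaus of the profiles [step] is
    a trigonometric polynomial, bounded by one, which converges on the domain to
    the indicator of the octant: dominated convergence applies. *)
Lemma octant_orthogonal a : (\int[leb3 R]_(x in Om `&` octant a) (h x)%:E = 0)%E.
Proof.
have [M [M0 OmM]] := bounded_box bOm.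
(* The domain lies within [N] of the planes [crd x k = a k], so that at frequency
   [1 / N] the argument of the sine is at most one and its sign tells on which
   side of the plane a point lies. *)
pose N := M + \sum_k `|a k|.
have N0 : 0 < N by rewrite /N ltr_pwDl// sumr_ge0.
pose c := N^-1.
pose F n x := \prod_k plateau n (step k (a k) c x).
have c0 : 0 < c by rewrite invr_gt0.
have stepE x k : Om x -> (step k (a k) c x < 2^-1) = (crd x k < a k).
  move=> Ox; apply: step_lt_half => //.
  rewrite normrM gtr0_norm// mulrC ltr_pdivrMr//.
  have xM : `|crd x k| <= M.
    have [[x1 x2] x3] := OmM _ Ox; move: x1 x2 x3.
    rewrite /box /= !in_itv /= -!ler_norml.
    by case: k => -[|[|[|//]]] ? ? ? ?.
  have aN : `|a k| <= \sum_k `|a k|.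
    by rewrite (bigD1 k)//= lerDl sumr_ge0.
  have := ler_normB (crd x k) (a k); move: N0; rewrite /N; lra.
have F01 n x : 0 <= F n x <= 1.
  rewrite /F prodr_ge0 ?prodr_ile1//= => k _;
    by have /andP[] := plateau_itv n (step_itv k (a k) c x) => // -> ->.
have mF n : measurable_fun setT (F n).
  apply: measurable_prod => k _; apply: measurable_funX.
  apply: measurable_funB => //; apply: measurable_funX.
  apply: measurable_funM => //; apply: measurable_funD => //.
  apply: measurableT_comp.
    by apply: continuous_measurable_fun; exact: continuous_sin.
  by apply: measurable_funM => //; apply: measurable_funB => //; exact: measurable_crd.
have mh : measurable_fun Om h by apply/measurable_EFinP; exact: measurable_int ih.
have F0 n : (\int[leb3 R]_(x in Om) (h x * F n x)%:E = 0)%E.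
  have tF : trig_poly (fun x => (F n x)%:C).
    rewrite (_ : (fun x => _) = fun x => \prod_k (plateau n (step k (a k) c x))%:C).
      by apply: trig_prod => k; exact: trig_plateau.
    by apply/funext => x; rewrite /F rmorph_prod.
  have [[iF _]] := trig_orthogonal tF; move=> /(congr1 (@complex.Re R)) /=.
  have E : re (fun x => (h x)%:C * (F n x)%:C) = fun x => h x * F n x.
    by apply/funext => x; rewrite /re cReM /= mulr0 subr0.
  rewrite E in iF *; move=> Fn0.
  by rewrite -[LHS]fineK ?[fine _]Fn0//; exact: integrable_fin_num.
have cF x : Om x -> (fun n => F n x) @ \oo --> (\1_(octant a) x : R).
  move=> Ox; rewrite (_ : \1__ _ = \prod_k (((crd x k < a k)%R)%:R : R)); last first.
    rewrite indicE; have [/set_mem xa|/negP xa] := boolP (x \in octant a).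
      by rewrite big1// => k _; rewrite xa.
    suff [k /negbTE kx] : exists k, ~~ (crd x k < a k) by rewrite (bigD1 k)//= kx mul0r.
    apply/existsP; rewrite -negb_forall; apply/negP => /forallP xa'.
    by apply: xa; apply/mem_set.
  apply: cvg_big => [|k _]; first exact: mul_continuous.
  rewrite -stepE//; apply: cvg_plateau; exact: step_itv.
have moct := measurable_octant a.
have mfn n : measurable_fun Om (fun x => (h x * F n x)%:E).
  apply/measurable_EFinP; apply: measurable_funM => //.
  exact: measurable_funS (mF n).
have mf : measurable_fun Om (fun x => (h x * \1_(octant a) x)%:E).
  by apply/measurable_EFinP; apply: measurable_funM => //; exact: measurable_indic.
have cfn : {ae leb3 R, forall x, Om x ->
    (fun n => (h x * F n x)%:E) @ \oo --> (h x * \1_(octant a) x)%:E}.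
  apply: aeW => x Ox; apply: cvg_EFin; first exact: nearW.
  by apply: cvgM; [exact: cvg_cst|exact: cF].
have dfn : {ae leb3 R, forall x n, Om x ->
    (`|(h x * F n x)%:E| <= `|(h x)%:E|)%E}.
  apply: aeW => x n Ox; rewrite lee_fin normrM; have /andP[f0 f1] := F01 n x.
  by rewrite ler_piMr// ger0_norm.
have [_ _ dc] := @dominated_convergence _ _ _ (leb3 R) Om mOm _ _ _ mfn mf cfn (integrable_abse ih) dfn.
rewrite integral_mkcondr; transitivity (\int[leb3 R]_(x in Om) (h x * \1_(octant a) x)%:E)%E.
  apply: eq_integral => x _; rewrite /patch indicE.
  by case: ifP => _; rewrite ?mulr1 ?mulr0.
apply: cvg_unique dc _ => //.
rewrite (_ : [sequence _]_n = fun=> 0%E); first exact: cvg_cst.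
by apply/funext => n; rewrite /= F0.
Qed.

End FourierUniqueness.

Section OctantsGenerate.
Variable R : realType.

Let octants : set (set (R * R * R)) := range (@octant R).

Lemma octantI a b : octant a `&` octant b = octant (fun k => Num.min (a k) (b k)) :> set (R * R * R).
Proof.
apply/seteqP; split=> [x [xa xb] k|x xab]; first by rewrite lt_min xa xb.
by split=> k; have := xab k; rewrite lt_min => /andP[].
Qed.

Lemma sigma_octant_crd k (r : R) :
  <<s octants >> [set x : R * R * R | crd x k < r].
Proof.
pose a (n : nat) : 'I_3 -> R := fun j => if j == k then r else n%:R.
rewrite (_ : [set x | _] = \bigcup_n octant (a n)).
  apply: sigma_algebra_bigcup => n; by apply: sub_sigma_algebra; exists (a n).
apply/seteqP; split=> [x /= xr|x [n _ xa]]; last first.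
  by have := xa k; rewrite /a eqxx.
have [n xn] : exists n : nat, `|x| < n%:R.
  by exists (Num.bound `|x|); exact: archi_boundP.
exists n => // j; rewrite /a; case: eqP => [->//|_].
by apply: le_lt_trans xn; apply: le_trans (ler_norm _) (norm_crd_le _ _).
Qed.

(** The coordinates are measurable for the sigma-algebra of the octants, hence so is
    the identity. *)
Lemma sigma_octant (A : set (R * R * R)) : measurable A -> <<s octants >> A.
Proof.
move=> mA.
have mcrd k : @measurable_fun _ _ (g_sigma_algebraType octants) R setT (fun x : R * R * R => crd x k).
  apply: (measurability _ (RGenInftyO.measurableE R)).
  move=> _ [_ [r ->] <-]; rewrite setTI.
  rewrite (_ : _ @^-1` _ = [set x : R * R * R | crd x k < r]).
    exact: sigma_octant_crd.
  by apply/seteqP; split=> x /=; rewrite in_itv.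
have : @measurable_fun _ _ (g_sigma_algebraType octants) (R * R * R)%type setT id.
  rewrite (_ : id = fun x : R * R * R => ((crd x ord0, crd x (lift ord0 ord0)), crd x ord_max)).
    by apply: measurable_fun_pair => //; exact: measurable_fun_pair.
  by apply/funext => -[[]].
by move=> /(_ measurableT _ mA); rewrite setTI preimage_id.
Qed.

End OctantsGenerate.

Section AlmostEverywhere.
Variables (R : realType) (Om : set (R * R * R)).
Hypotheses (mOm : measurable Om) (bOm : bounded_set Om).
Variable h : R * R * R -> R.
Hypothesis ih : (leb3 R).-integrable Om (EFin \o h).
Hypothesis h0 : forall xi, cint Om (fun x => (h x)%:C * ipw xi x) = 0.

(** The sets against which [h] integrates to zero form a Dynkin system, and octants
    are stable under intersection. *)
Lemma set_orthogonal (A : set (R * R * R)) : measurable A ->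
  (\int[leb3 R]_(x in Om `&` A) (h x)%:E = 0)%E.
Proof.
pose V := [set A | measurable A /\ (\int[leb3 R]_(x in Om `&` A) (h x)%:E = 0)%E].
have iA (B : set (R * R * R)) : measurable B ->
    (leb3 R).-integrable (Om `&` B) (EFin \o h).
  by move=> mB; apply: integrableS ih => //; exact: measurableI.
have i0 : (\int[leb3 R]_(x in Om) (h x)%:E = 0)%E.
  have : trig_poly (fun _ : R * R * R => (1 : R[i])) by exact: trig_cst.
  move=> /(trig_orthogonal mOm bOm ih h0)[_] /(congr1 (@complex.Re R)) /=.
  rewrite (_ : re _ = h) => [h1|]; last by apply/funext => x; rewrite /re mulr1.
  by rewrite -[LHS]fineK ?[fine _]h1//; exact: integrable_fin_num.
have dV : dynkin V.
  split.
  - by split=> //; rewrite setIT.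
  - move=> B [mB B0]; split; first exact: measurableC.
    move: i0; rewrite -{1}(setIT Om) -(setUv B) setIUr integral_setU_EFin//.
    + by rewrite B0 add0e.
    + exact: measurableI.
    + by apply: measurableI => //; exact: measurableC.
    + rewrite -setIUr setUv setIT; apply/measurable_EFinP; exact: measurable_int ih.
    + by apply/eqP/seteqP; split=> // x [[_ Bx] [_ /(_ Bx)]].
  - move=> F tF VF; split.
      by apply: bigcupT_measurable => n; have [] := VF n.
    rewrite setI_bigcupr integral_bigcup.
    + by rewrite eseries0// => n _ _; have [] := VF n.
    + apply: trivIset_setIl; exact: tF.
    + by move=> n; apply: measurableI => //; have [] := VF n.
    + rewrite -setI_bigcupr; apply: iA.
      by apply: bigcupT_measurable => n; have [] := VF n.
move=> mA; suff : V A by case.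
apply: (@lambda_system_subset _ (range (@octant R)) _ setT).
- by move=> _ _ [a _ <-] [b _ <-]; rewrite octantI; eexists.
- exact/dynkin_lambda_system.
- move=> _ [a _ <-]; split; last exact: octant_orthogonal.
  exact: measurable_octant.
- by [].
- exact: sigma_octant.
Qed.

(** The integrals of [h] over the sets where it is positive and where it is
    negative both vanish. *)
Lemma fourier_uniqueness : {ae leb3 R, forall x, Om x -> h x = 0}.
Proof.
have mh : measurable_fun Om h by apply/measurable_EFinP; exact: measurable_int ih.
have half (B : set R) : measurable B ->
    (forall r, B r -> 0 < r) \/ (forall r, B r -> r < 0) ->
    {ae leb3 R, forall x, (Om `&` h @^-1` B) x -> h x = 0}.
  move=> mB sB; set A := Om `&` _.
  have mA : measurable A by exact: mh.
  have A0 : (\int[leb3 R]_(x in A) (h x)%:E = 0)%E.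
    by rewrite /A -[Om in LHS]setIid -setIA; exact: set_orthogonal.
  have : (\int[leb3 R]_(x in A) `|(h x)%:E| = 0)%E.
    case: sB => sB.
      rewrite -[RHS]A0; apply: eq_integral => x /set_mem[_ /sB hx].
      by rewrite gee0_abs// lee_fin ltW.
    rewrite -[RHS]oppe0 -A0 -integralN; last first.
      apply: integrable_add_def => //; apply: integrableS ih => //.
      by move=> x [].
    apply: eq_integral => x /set_mem[_ /sB hx].
    by rewrite lee0_abs// lee_fin ltW.
  move=> /ae_eq_integral_abs => /(_ mA) H.
  have mhA : measurable_fun A (EFin \o h).
    by apply/measurable_EFinP; apply: measurable_funS mh => // x [].
  by have := H mhA; apply: filterS => x /[apply] -[].
have hp := half `]0, +oo[%classic (measurable_itv _).
have hn := half `]-oo, 0[%classic (measurable_itv _).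
have {}hp : {ae leb3 R, forall x, (Om `&` h @^-1` `]0, +oo[) x -> h x = 0}.
  by apply: hp; left => r /=; rewrite in_itv /= andbT.
have {}hn : {ae leb3 R, forall x, (Om `&` h @^-1` `]-oo, 0[) x -> h x = 0}.
  by apply: hn; right => r /=; rewrite in_itv.
apply: (ae3_and hp hn) => x {}hp {}hn Ox; have [h_lt|h_gt|//] := ltrgtP (h x) 0.
- by apply: hn; split=> //=; rewrite in_itv.
- by apply: hp; split=> //=; rewrite in_itv /= h_gt.
Qed.

End AlmostEverywhere.

(** * Fourier coefficients of real functions *)

Lemma ae3_imp (R : realType) (P Q : R * R * R -> Prop) :
  {ae leb3 R, forall x, P x} -> (forall x, P x -> Q x) -> {ae leb3 R, forall x, Q x}.
Proof. by move=> p pq; apply: (ae3_and p p) => x px _; exact: pq. Qed.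

Section FourierCoefficient.
Variables (R : realType) (Om : set (R * R * R)).
Hypotheses (oOm : open Om) (bOm : bounded_set Om).
Let mOm : measurable Om := open_measurable3 oOm.

Definition rint (f : R * R * R -> R) := (leb3 R).-integrable Om (EFin \o f).

Lemma Linfty_integrable f : in_Linfty Om f -> rint f.
Proof.
move=> [mf [M fM]]; apply/integrableP; split; first exact/measurable_EFinP.
have finOm : (leb3 R Om < +oo)%E by exact: bounded_leb3_lty.
apply: (@le_lt_trans _ _ (\int[leb3 R]_(x in Om) `|M|%:E)%E); last first.
  by rewrite integral_cst// lte_mul_pinfty// ?lee_fin.
apply: ae_ge0_le_integral => //.
- by apply: measurableT_comp => //; exact/measurable_EFinP.
- by apply: (ae3_imp fM) => x {}fM Ox; rewrite lee_fin (le_trans (fM Ox))// ler_norm.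
Qed.

Lemma rintD f g : rint f -> rint g -> rint (fun x => f x + g x).
Proof.
move=> rf rg; rewrite /rint (_ : (fun x => _) = fun x => 1 * f x + 1 * g x).
  exact: integrable_Rlin.
by apply/funext => x; rewrite !mul1r.
Qed.

Lemma rintZ a f : rint f -> rint (fun x => a * f x).
Proof.
move=> rf; rewrite /rint (_ : (fun x => _) = fun x => a * f x + 0 * f x).
  exact: integrable_Rlin.
by apply/funext => x; rewrite mul0r addr0.
Qed.

Lemma rintZr a f : rint f -> rint (fun x => f x * a).
Proof.
by move=> /(rintZ a); rewrite /rint; under eq_fun do rewrite mulrC.
Qed.

Lemma rintB f g : rint f -> rint g -> rint (fun x => f x - g x).
Proof.
move=> rf rg; rewrite /rint (_ : (fun x => _) = fun x => 1 * f x + (-1) * g x).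
  exact: integrable_Rlin.
by apply/funext => x; rewrite mul1r mulN1r.
Qed.

Lemma rint_sum (a : 'I_3 -> R) (f : 'I_3 -> R * R * R -> R) :
  (forall i, rint (f i)) -> rint (fun x => \sum_i a i * f i x).
Proof.
move=> rf; rewrite (_ : (fun x => _) = fun x => a ord0 * f ord0 x +
   (a (lift ord0 ord0) * f (lift ord0 ord0) x + a (lift ord0 (lift ord0 ord0)) * f (lift ord0 (lift ord0 ord0)) x)).
  by apply: rintD; [exact: rintZ|apply: rintD; exact: rintZ].
by apply/funext => x; rewrite !big_ord_recl big_ord0 addr0.
Qed.

Variable y : 'I_3 -> R[i].

(** The Fourier coefficient at the complex frequency [- i y]: a real frequency [xi]
    corresponds to [y = i xi]. *)
Definition hat (f : R * R * R -> R) : R[i] := cint Om (fun x => (f x)%:C * pw y x).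

Lemma hatI f : rint f -> cintegrable Om (fun x => (f x)%:C * pw y x).
Proof. by move=> rf; exact: (cintegrable_pw mOm bOm). Qed.

Lemma hatD f g : rint f -> rint g -> hat (fun x => f x + g x) = hat f + hat g.
Proof.
move=> rf rg; rewrite /hat -cintD//; [|exact: hatI..].
by apply: eq_cint => x _; rewrite rmorphD mulrDl.
Qed.

Lemma hatZr a f : rint f -> hat (fun x => f x * a) = hat f * a%:C.
Proof.
move=> rf; rewrite /hat mulrC -cintZ//; last exact: hatI.
by apply: eq_cint => x _; rewrite rmorphM; ring.
Qed.

Lemma hat_ae f g : rint f -> rint g -> {ae leb3 R, forall x, Om x -> f x = g x} ->
  hat f = hat g.
Proof.
move=> rf rg fg; have [rf1 if1] := hatI rf; have [rg1 ig1] := hatI rg.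
rewrite /hat /cint; congr Complex; rewrite /Rintegral; congr fine.
  apply: ae_eq_integral => //; [exact: measurable_int rf1|exact: measurable_int rg1|].
  by apply: (ae3_imp fg) => x {}fg Ox; rewrite /= /re fg.
apply: ae_eq_integral => //; [exact: measurable_int if1|exact: measurable_int ig1|].
by apply: (ae3_imp fg) => x {}fg Ox; rewrite /= /im fg.
Qed.

End FourierCoefficient.

Section FourierContinuity.
Variables (R : realType) (Om : set (R * R * R)).
Hypothesis mOm : measurable Om.
Variable f : R * R * R -> R.
Hypothesis rf : rint Om f.

(** Dominated convergence along [xi + v / (n + 1)], with [f] itself as the bound;
    it is applied to the cosine and to the sine. *)
Lemma cvg_osc0 (g : R -> R) (xi v : 'I_3 -> R) : continuous g ->
  (forall t, `|g t| <= 1) ->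
  (forall n, \int[leb3 R]_(x in Om)
     (f x * g (\sum_k (xi k + n.+1%:R^-1 * v k) * crd x k)) = 0) ->
  \int[leb3 R]_(x in Om) (f x * g (\sum_k xi k * crd x k)) = 0.
Proof.
move=> cg g1 g0.
have mf : measurable_fun Om f by apply/measurable_EFinP; exact: measurable_int rf.
have mg (eta : 'I_3 -> R) :
    measurable_fun Om (fun x => (f x * g (\sum_k eta k * crd x k))%:E).
  apply/measurable_EFinP; apply: measurable_funM => //.
  apply: (@measurable_funS _ _ _ _ setT) => //.
  apply: measurableT_comp; last exact: measurable_lin.
  exact: continuous_measurable_fun.
have c0 : {ae leb3 R, forall x, Om x ->
    (fun n => (f x * g (\sum_k (xi k + n.+1%:R^-1 * v k) * crd x k))%:E) @ \oo -->
    (f x * g (\sum_k xi k * crd x k))%:E}.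
  apply: aeW => x _; apply: cvg_EFin; first exact: nearW.
  apply: cvgM; first exact: cvg_cst.
  apply: continuous_cvg; first exact: cg.
  rewrite (_ : (fun n => _) = fun n : nat => \sum_k xi k * crd x k +
     n.+1%:R^-1 * \sum_k v k * crd x k); last first.
    apply/funext => n; rewrite mulr_sumr -big_split /=; apply: eq_bigr => k _.
    by rewrite mulrDl mulrA.
  rewrite -[X in _ --> X]addr0; apply: cvgD; first exact: cvg_cst.
  rewrite -[X in _ --> X](mul0r (\sum_k v k * crd x k)); apply: cvgMr_tmp.
  exact: cvg_harmonic.
have d0 : {ae leb3 R, forall x n, Om x ->
    (`|(f x * g (\sum_k (xi k + n.+1%:R^-1 * v k) * crd x k))%:E| <= `|(f x)%:E|)%E}.
  by apply: aeW => x n _; rewrite lee_fin normrM ler_piMr.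
have [il _ dc] := @dominated_convergence _ _ _ (leb3 R) Om mOm _ _ _
  (fun n => mg _) (mg xi) c0 (integrable_abse rf) d0.
rewrite /Rintegral; suff -> : (\int[leb3 R]_(x in Om) (f x * g (\sum_k xi k * crd x k))%:E = 0)%E by [].
apply: cvg_unique dc _ => //.
rewrite (_ : [sequence _]_n = fun=> 0%E); first exact: cvg_cst.
apply/funext => n /=.
have fin : (\int[leb3 R]_(x in Om)
    (f x * g (\sum_k (xi k + n.+1%:R^-1 * v k) * crd x k))%:E)%E \is a fin_num.
  apply: integrable_fin_num => //; apply: (@le_integrable _ _ _ (leb3 R) Om mOm _ (EFin \o f)) => //.
    exact: mg.
  by move=> x _; rewrite lee_fin normrM ler_piMr.
by rewrite -(fineK fin); congr (_%:E); exact: g0.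
Qed.

(** It recovers the exceptional frequencies of [coefficient_null], which form a line
    that is left along any transverse direction [v]. *)
Lemma ipw_limit (xi v : 'I_3 -> R) :
  (forall n, cint Om (fun x => (f x)%:C * ipw (fun k => xi k + n.+1%:R^-1 * v k) x) = 0) ->
  cint Om (fun x => (f x)%:C * ipw xi x) = 0.
Proof.
move=> h.
have reE eta : re (fun x => (f x)%:C * ipw eta x) = fun x => f x * cos (\sum_k eta k * crd x k).
  by apply/funext => x; rewrite /re ipwE /=; ring.
have imE eta : im (fun x => (f x)%:C * ipw eta x) = fun x => f x * sin (\sum_k eta k * crd x k).
  by apply/funext => x; rewrite /im ipwE /=; ring.
apply: complexP => /=.
  rewrite reE; apply: (@cvg_osc0 _ xi v); first exact: continuous_cos.
    by move=> t; rewrite ler_norml cos_geN1 cos_le1.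
  by move=> n; have /(congr1 (@complex.Re R)) /= := h n; rewrite reE.
rewrite imE; apply: (@cvg_osc0 _ xi v); first exact: continuous_sin.
  exact: sin_max.
by move=> n; have /(congr1 (@complex.Im R)) /= := h n; rewrite imE.
Qed.

End FourierContinuity.

(** * Integration by parts against test functions *)

Section IntegrationByParts.
Variable R : realType.

Lemma ord3_2 : (2%:R : 'I_3) = ord_max. Proof. exact/val_inj. Qed.

Lemma of_col_delta (k : 'I_3) : of_col (delta_mx k 0 : 'cV[R]_3) =
  ((k == 0%N :> nat)%:R, (k == 1%N :> nat)%:R, (k == 2%N :> nat)%:R).
Proof.
rewrite /of_col !mxE !eqxx !andbT ord3_2.
by case: k => -[|[|[|//]]] ?.
Qed.

Lemma slice_is_derive (f : R * R * R -> R) (e a : R * R * R) (t : R) :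
  differentiable f (t *: e + a) ->
  is_derive t 1 (fun s => f (s *: e + a)) ('D_e f (t *: e + a)).
Proof.
move=> df; have E : (fun h : R => h^-1 *: (((fun s => f (s *: e + a)) \o shift t)
      (h *: 1) - f (t *: e + a))) =
    (fun h : R => h^-1 *: ((f \o shift (t *: e + a)) (h *: e) - f (t *: e + a))).
  by apply/funext => h /=; rewrite -[h *: 1]/(h * 1) mulr1 scalerDl addrA.
split; first by rewrite /derivable E; exact: diff_derivable.
by rewrite /derive E.
Qed.

(** The fundamental theorem of calculus on a segment beyond whose ends the function
    vanishes. *)
Lemma slice_integral0 (f : R * R * R -> R) (e a : R * R * R) (M : R) :
  (forall x, differentiable f x) -> continuous (fun x => 'D_e f x) ->
  (forall t, M < `|t| -> f (t *: e + a) = 0 /\ 'D_e f (t *: e + a) = 0) ->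
  (\int[@lebesgue_measure R]_t ('D_e f (t *: e + a))%:E = 0)%E.
Proof.
move=> df cf f0; pose N := `|M| + 1.
have N0 : 0 < N by rewrite ltr_wpDl.
have MN : M < N by rewrite ltr_pwDr// ler_norm.
rewrite (_ : (\int[_]_t _)%E =
    (\int[lebesgue_measure]_(t in `[(- N)%R, N]) ('D_e f (t *: e + a))%:E)%E); last first.
  rewrite [RHS]integral_mkcond; apply: eq_integral => t _; rewrite /patch.
  case: ifPn => // /negP tN; rewrite (f0 t _).2//.
  rewrite ltNge; apply/negP => tM; apply: tN; apply/mem_set => /=.
  by rewrite in_itv /= -ler_norml (le_trans tM)// ltW.
have cs : continuous (fun t : R => t *: e + a).
  move=> t; apply: cvgD; last exact: cvg_cst.
  by apply: cvgZr_tmp; exact: cvg_id.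
have cF : continuous (fun t : R => f (t *: e + a)).
  move=> t; apply: continuous_comp; first exact: cs.
  exact: differentiable_continuous.
have cDf : continuous (fun t : R => 'D_e f (t *: e + a)).
  have : continuous ((fun x => 'D_e f x) \o (fun t : R => t *: e + a)).
    by move=> t; apply: continuous_comp; [exact: cs|exact: cf].
  by [].
rewrite (@continuous_FTC2 _ _ (fun t => f (t *: e + a)))//.
- by rewrite !(f0 _ _).1 ?subee// ?normrN gtr0_norm.
- by rewrite gtrN.
- by apply: continuous_subspaceT; exact: cDf.
- split.
  + by move=> t _; have [] := slice_is_derive (df (t *: e + a)).
  + by apply: cvg_at_right_filter; exact: cF.
  + by apply: cvg_at_left_filter; exact: cF.
- move=> t _; rewrite derive1E.
  by have [_ ->] := slice_is_derive (df (t *: e + a)).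
Qed.

Lemma bounded_support_integrable d (T : measurableType d)
    (mu : {measure set T -> \bar R}) (g : T -> R) (A : set T) (B : R) :
  measurable A -> (mu A < +oo)%E -> measurable_fun setT g ->
  (forall x, `|g x| <= B) -> (forall x, ~ A x -> g x = 0) ->
  mu.-integrable setT (EFin \o g).
Proof.
move=> mA Aoo mg gB g0.
have iA : mu.-integrable A (EFin \o g).
  apply: measurable_bounded_integrable => //; first exact: measurable_funS mg.
  exists B; split; first exact: num_real.
  by move=> y By x _; apply: le_trans (ltW By).
have := (integrable_mkcond (EFin \o g) mA).1 iA.
rewrite (_ : _ \_ A = EFin \o g)//; apply/funext => x; rewrite /patch.
by case: ifPn => // /negP xA; rewrite /= g0// => Ax; apply: xA; exact/mem_set.
Qed.

(** Vanishing of the integral of a derivative: along lines in the direction of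
    differentiation the fundamental theorem of calculus applies, and Fubini
    integrates over the lines. *)
Lemma integral_partial0 (f : R * R * R -> R) (k : 'I_3) (M B : R) :
  (forall x, differentiable f x) -> continuous (partial k f) ->
  (forall x, M < `|x| -> f x = 0 /\ partial k f x = 0) ->
  (forall x, `|partial k f x| <= B) ->
  (leb3 R).-integrable setT (EFin \o partial k f) /\
  (\int[leb3 R]_x (partial k f x)%:E = 0)%E.
Proof.
move=> df cf f0 fB; set g := partial k f.
have mg : measurable_fun setT g by exact: continuous_measurable3.
have out3 x : ~ (box M `*` box M `*` box M) x -> M < `|x|.
  move=> nx; rewrite ltNge norm3_le; apply/negP => /and3P[x1 x2 x3].
  by apply: nx; split; [split|]; rewrite /box /= in_itv /= -ler_norml.
have ig : (leb3 R).-integrable setT (EFin \o g).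
  apply: (@bounded_support_integrable _ _ (leb3 R) g
    (box M `*` box M `*` box M) B) => //.
  - exact: measurable_box3.
  - exact: box3_lty.
  - by move=> x /out3/f0[].
split=> //.
have gE x : g x = 'D_(of_col (delta_mx k 0)) f x by [].
have coordM (y : R * R * R) (t : R) : M < `|t| ->
    t = y.1.1 \/ t = y.1.2 \/ t = y.2 -> M < `|y|.
  move=> Mt ty; apply: lt_le_trans Mt _.
  have := lexx `|y|; rewrite norm3_le => /and3P[y1 y2 y3].
  by case: ty => [->|[->|->]].
have kcases : k = 0%N :> nat \/ k = 1%N :> nat \/ k = 2%N :> nat.
  by case: (k) => -[|[|[|//]]] ? /=; tauto.
have ek := of_col_delta k.
have [k2|k2] : (k = 2%N :> nat) \/ (k != 2%N :> nat) by case: eqP; [left|right].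
  rewrite -(@integral12_prod_meas1 _ _ _ _ _ (leb2 R) (@lebesgue_measure R) _ ig).
  apply: integral0_eq => p _; rewrite /fubini_F.
  have out (r : R) : M < `|r| -> f (r *: of_col (delta_mx k 0) + (p, 0)) = 0 /\
      partial k f (r *: of_col (delta_mx k 0) + (p, 0)) = 0.
    move=> Mr; apply: f0; apply: (coordM _ r) => //; right; right.
    by rewrite ek k2 /= -[_%:R]/1 -[r *: 1]/(r * 1) mulr1 addr0.
  rewrite -[RHS](slice_integral0 df cf out); apply: eq_integral => r _ /=.
  have -> // : r *: of_col (delta_mx k 0) + (p, 0) = (p, r).
  rewrite ek k2 /=; case: p {out} => p1 p2; apply/pair_equal_spec; split; [apply/pair_equal_spec; split|];
  by rewrite /= -[r *: _]/(r * _) ?mulr0 ?mulr1 ?add0r ?addr0.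
rewrite -(@integral21_prod_meas1 _ _ _ _ _ (leb2 R) (@lebesgue_measure R) _ ig).
apply: integral0_eq => t _; rewrite /fubini_G.
have igt : (leb2 R).-integrable setT (fun p => (g (p, t))%:E).
  apply: (@bounded_support_integrable _ _ (leb2 R) (fun p => g (p, t))
    (box M `*` box M) B) => //.
  - by apply: measurableX; exact: measurable_itv.
  - exact: box2_lty.
  - by apply: measurableT_comp => //; exact: measurable_fun_pair.
  - move=> p np; have [] := f0 (p, t); last by [].
    by apply: out3 => -[].
have [k1|k1] : (k = 1%N :> nat) \/ (k != 1%N :> nat) by case: eqP; [left|right].
  rewrite -(@integral12_prod_meas1 _ _ _ _ _ (@lebesgue_measure R) (@lebesgue_measure R) _ igt).
  apply: integral0_eq => a _; rewrite /fubini_F.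
  have out (r : R) : M < `|r| -> f (r *: of_col (delta_mx k 0) + (a, 0, t)) = 0 /\
      partial k f (r *: of_col (delta_mx k 0) + (a, 0, t)) = 0.
    move=> Mr; apply: f0; apply: (coordM _ r) => //; right; left.
    by rewrite ek k1 /= -[_%:R]/1 -[r *: 1]/(r * 1) mulr1 addr0.
  rewrite -[RHS](slice_integral0 df cf out); apply: eq_integral => r _ /=.
  have -> // : r *: of_col (delta_mx k 0) + (a, 0, t) = (a, r, t).
  rewrite ek k1 /=; apply/pair_equal_spec; split; [apply/pair_equal_spec; split|];
  by rewrite /= -[r *: _]/(r * _) ?mulr0 ?mulr1 ?add0r ?addr0.
have k0 : k = 0%N :> nat by case: kcases k1 k2 => [//|[->|->]].
rewrite -(@integral21_prod_meas1 _ _ _ _ _ (@lebesgue_measure R) (@lebesgue_measure R) _ igt).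
apply: integral0_eq => a _; rewrite /fubini_G.
have out (r : R) : M < `|r| -> f (r *: of_col (delta_mx k 0) + (0, a, t)) = 0 /\
    partial k f (r *: of_col (delta_mx k 0) + (0, a, t)) = 0.
  move=> Mr; apply: f0; apply: (coordM _ r) => //; left.
  by rewrite ek k0 /= -[_%:R]/1 -[r *: 1]/(r * 1) mulr1 addr0.
rewrite -[RHS](slice_integral0 df cf out); apply: eq_integral => r _ /=.
have -> // : r *: of_col (delta_mx k 0) + (0, a, t) = (r, a, t).
  rewrite ek k0 /=; apply/pair_equal_spec; split; [apply/pair_equal_spec; split|];
  by rewrite /= -[r *: _]/(r * _) ?mulr0 ?mulr1 ?add0r ?addr0.
Qed.

End IntegrationByParts.

Section TestFunctions.
Variable R : realType.

Lemma compact_support_bounded (g : R * R * R -> R) (K : set (R * R * R)) :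
  continuous g -> compact K -> (forall x, ~ K x -> g x = 0) ->
  exists B, forall x, `|g x| <= B.
Proof.
move=> cg cK g0.
have : compact [set g x | x in K].
  by apply: continuous_compact => //; exact: continuous_subspaceT.
move=> /compact_bounded[M [_ KM]]; exists (`|M| + 1) => x.
have [Kx|/g0->] := pselect (K x); last by rewrite normr0 addr_ge0.
by apply: (KM (`|M| + 1)); [rewrite ltr_pwDr// ler_norm|exists x].
Qed.

Lemma compact_support_integrable (g : R * R * R -> R) (K : set (R * R * R)) :
  continuous g -> compact K -> (forall x, ~ K x -> g x = 0) ->
  (leb3 R).-integrable setT (EFin \o g).
Proof.
move=> cg cK g0; have [B gB] := compact_support_bounded cg cK g0.
have [M [_ KM]] := bounded_box (compact_bounded cK).
apply: (@bounded_support_integrable _ _ _ (leb3 R) g (box M `*` box M `*` box M) B) => //.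
- exact: measurable_box3.
- exact: box3_lty.
- exact: continuous_measurable3.
- by move=> x nx; apply: g0 => /KM.
Qed.

Variable Om : set (R * R * R).
Hypothesis oOm : open Om.
Let mOm : measurable Om := open_measurable3 oOm.

Lemma smooth_differentiable (f : R * R * R -> R) x : smooth f -> differentiable f x.
Proof. by move=> /(_ [::] x). Qed.

Lemma smooth_partial_continuous (f : R * R * R -> R) k : smooth f ->
  continuous (partial k f).
Proof. by move=> sf x; apply: differentiable_continuous; exact: (sf [:: k] x). Qed.

Lemma smooth_continuous (f : R * R * R -> R) : smooth f -> continuous f.
Proof. by move=> sf x; apply: differentiable_continuous; exact: (sf [::] x). Qed.

Lemma test_fun_out (phi : R * R * R -> R) k x :
  ~ closure [set x | phi x != 0] x -> phi x = 0 /\ partial k phi x = 0.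
Proof.
move=> nx.
have near0 : \forall y \near x, phi y = 0.
  have : nbhs x (~` closure [set x | phi x != 0]).
    by apply: open_nbhs_nbhs; split => //; exact/closed_openC/closed_closure.
  apply: filterS => y ny; apply/eqP/negPn/negP => phiy; apply: ny.
  exact: subset_closure.
split; first exact: nbhs_singleton near0.
by rewrite /partial (@near_eq_derive _ _ _ phi (cst 0))//; exact: derive_cst.
Qed.

(** The product [u phi] is differentiable with compact support, so the integral of
    its derivative vanishes. *)
Lemma test_fun_parts (u phi : R * R * R -> R) k : smooth u -> test_fun Om phi ->
  [/\ (leb3 R).-integrable Om (EFin \o (fun x => u x * partial k phi x)),
      (leb3 R).-integrable Om (EFin \o (fun x => partial k u x * phi x)) &
      \int[leb3 R]_(x in Om) (u x * partial k phi x) =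
      - \int[leb3 R]_(x in Om) (partial k u x * phi x)].
Proof.
move=> su tphi; have [sphi cK KOm] := tphi.
set K := closure _ in cK KOm.
have out x : ~ K x -> phi x = 0 /\ partial k phi x = 0 by exact: test_fun_out.
have cu := smooth_continuous su; have cphi := smooth_continuous sphi.
have cdu := smooth_partial_continuous (k := k) su.
have cdphi := smooth_partial_continuous (k := k) sphi.
set f1 := fun x => u x * partial k phi x.
set f2 := fun x => partial k u x * phi x.
have c1 : continuous f1 by move=> x; apply: cvgM; [exact: cu|exact: cdphi].
have c2 : continuous f2 by move=> x; apply: cvgM; [exact: cdu|exact: cphi].
have z1 x : ~ K x -> f1 x = 0 by move=> /out[_ ?]; rewrite /f1 (_ : partial k phi x = 0) ?mulr0.
have z2 x : ~ K x -> f2 x = 0 by move=> /out[? _]; rewrite /f2 (_ : phi x = 0) ?mulr0.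
have i1 := compact_support_integrable c1 cK z1.
have i2 := compact_support_integrable c2 cK z2.
have j1 : (leb3 R).-integrable Om (EFin \o f1) by apply: integrableS i1.
have j2 : (leb3 R).-integrable Om (EFin \o f2) by apply: integrableS i2.
split => //; apply/eqP; rewrite -addr_eq0 -RintegralD//.
pose f x := u x * phi x.
have df x : differentiable f x.
  by apply: differentiableM; exact: smooth_differentiable.
have pf : partial k f = fun x => f1 x + f2 x.
  apply/funext => x; rewrite /partial deriveM; try exact: diff_derivable (smooth_differentiable _ _).
  by rewrite /f1 /f2 /partial /GRing.scale /= [phi x * _]mulrC.
have cpf : continuous (partial k f).
  by rewrite pf => x; apply: cvgD; [exact: c1|exact: c2].
have zpf x : ~ K x -> partial k f x = 0 by move=> nx; rewrite pf z1// z2// addr0.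
have [B fB] := compact_support_bounded cpf cK zpf.
have [M [_ KM]] := bounded_box (compact_bounded cK).
have outM x : M < `|x| -> ~ K x.
  move=> Mx /KM[[x1 x2] x3]; move: Mx; rewrite ltNge norm3_le => /negP; apply.
  by move: x1 x2 x3; rewrite /box /= !in_itv /= -!ler_norml => -> -> ->.
have [ipf ipf0] := integral_partial0 df cpf (M := M) (B := B)
   (fun x Mx => conj (etrans (congr1 (fun t => u x * t) (out x (outM x Mx)).1) (mulr0 _))
                 (zpf x (outM x Mx))) fB.
rewrite -[X in _ == X]/(fine 0%E) -ipf0 /Rintegral; apply/eqP; congr fine.
rewrite integral_mkcond; apply: eq_integral => x _; rewrite /patch.
case: ifPn => [_|/negP xOm]; first by rewrite pf.
by rewrite zpf// => /KOm xOm'; apply: xOm; exact/mem_set.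
Qed.

End TestFunctions.

(** * Plane waves solve the Lame system *)

Section SmoothWaves.
Variable R : realType.

Definition wave (c : R[i]) (z : 'I_3 -> R[i]) (x : R * R * R) : R[i] := c * pw z x.

Lemma re_waveE c z x : re (wave c z) x =
  expR (\sum_k complex.Re (z k) * crd x k) *
  (complex.Re c * cos (\sum_k complex.Im (z k) * crd x k) -
   complex.Im c * sin (\sum_k complex.Im (z k) * crd x k)).
Proof. by rewrite /re /wave /pw pdotE cReM /cexp /=; ring. Qed.

(** Multiplying the amplitude by [- i] turns imaginary parts into real parts, so
    that regularity has to be studied for real parts only. *)
Lemma im_wave c z : im (wave c z) = re (wave ((0 -i* 1) * c) z).
Proof.
by apply/funext => x; rewrite /im /re /wave -mulrA !cReImE /=; ring.
Qed.

Lemma differentiable_crd k x : differentiable (fun y : R * R * R => crd y k) x.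
Proof.
have d1 (U V : normedModType R) (y : U * V) : differentiable (@fst U V : U * V -> U) y.
  by apply: linear_differentiable => p; exact: cvg_fst.
have d2 (U V : normedModType R) (y : U * V) : differentiable (@snd U V : U * V -> V) y.
  by apply: linear_differentiable => p; exact: cvg_snd.
case: k => -[|[|[|//]]] ?; rewrite /crd /=.
- exact: (@differentiable_comp _ _ _ _ (@fst (R * R)%type R) (@fst R R)).
- exact: (@differentiable_comp _ _ _ _ (@fst (R * R)%type R) (@snd R R)).
- exact: d2.
Qed.

Lemma differentiable_lin (a : 'I_3 -> R) x :
  differentiable (fun y => \sum_k a k * crd y k) x.
Proof.
rewrite (_ : (fun y => _) = \sum_k (fun y => a k * crd y k)); last first.
  by apply/funext => y; rewrite fct_sumE.
apply: differentiable_sum => k.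
by apply: differentiableM => //; exact: differentiable_crd.
Qed.

Lemma differentiable_re_wave c z x : differentiable (re (wave c z)) x.
Proof.
rewrite (_ : re _ = fun x => expR (\sum_k complex.Re (z k) * crd x k) *
  (complex.Re c * cos (\sum_k complex.Im (z k) * crd x k) -
   complex.Im c * sin (\sum_k complex.Im (z k) * crd x k))); last first.
  by apply/funext => y; rewrite re_waveE.
have comp (f : R -> R) (a : 'I_3 -> R) : (forall t, derivable f t 1) ->
    differentiable (fun x => f (\sum_k a k * crd x k)) x.
  move=> df; apply: (@differentiable_comp _ _ _ _ (fun x => \sum_k a k * crd x k) f).
    exact: differentiable_lin.
  exact/derivable1_diffP.
apply: differentiableM; first exact: (comp expR).
apply: differentiableB; apply: differentiableM => //.
  exact: (comp cos).
exact: (comp sin).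
Qed.

(** Both sides are compared with the derivative at zero of the restriction to the
    line through [x] in the direction [k], where the wave is explicit. *)
Lemma partial_re_wave c z k : partial k (re (wave c z)) = re (wave (c * z k) z).
Proof.
apply/funext => x; rewrite /partial; set e := of_col _.
have := @slice_is_derive R (re (wave c z)) e x 0.
rewrite scale0r add0r => /(_ (differentiable_re_wave c z x)) H.
have crdE s j : crd (s *: e + x) j = s * (j == k)%:R + crd x j.
  rewrite /e of_col_delta /crd.
  case: j => -[|[|[|//]]] ?; case: (k) => -[|[|[|//]]] ? /=;
    by rewrite ?[_ == _]/true ?[_ == _]/false.
have linE (a : 'I_3 -> R) s : \sum_j a j * crd (s *: e + x) j =
    s * a k + \sum_j a j * crd x j.
  rewrite (bigD1 k)//= [in RHS](bigD1 k)//= crdE eqxx mulr1 mulrDr -!addrA.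
  congr (_ + _); first by rewrite mulrC.
  congr (_ + _); apply: eq_bigr => j jk; by rewrite crdE (negbTE jk) mulr0 add0r.
set p := \sum_j complex.Re (z j) * crd x j.
set q := \sum_j complex.Im (z j) * crd x j.
have H2 : is_derive (0 : R) 1 (fun s => expR (s * complex.Re (z k) + p) *
    (complex.Re c * cos (s * complex.Im (z k) + q) -
     complex.Im c * sin (s * complex.Im (z k) + q)))
    (re (wave (c * z k) z) x).
  apply: is_derive_eq; rewrite re_waveE -/p -/q !cReImE /=.
  rewrite /GRing.scale /= !mul0r !add0r; ring.
have E : (fun s => re (wave c z) (s *: e + x)) = (fun s => expR (s * complex.Re (z k) + p) *
    (complex.Re c * cos (s * complex.Im (z k) + q) -
     complex.Im c * sin (s * complex.Im (z k) + q))).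
  by apply/funext => s; rewrite re_waveE !linE.
rewrite E in H; by rewrite -(@derive_val _ _ _ _ _ _ _ H) (@derive_val _ _ _ _ _ _ _ H2).
Qed.

(** A derivative of a wave is a wave with another amplitude. *)
Lemma smooth_re_wave c z : smooth (re (wave c z)).
Proof.
move=> s x; suff [c' ->] : exists c', foldr (@partial R) (re (wave c z)) s = re (wave c' z).
  exact: differentiable_re_wave.
elim: s => [|k s [c' IH]] /=; first by exists c.
by exists (c' * z k); rewrite IH partial_re_wave.
Qed.

Lemma smooth_im_wave c z : smooth (im (wave c z)).
Proof. by rewrite im_wave; exact: smooth_re_wave. Qed.

Lemma partial_im_wave c z k : partial k (im (wave c z)) = im (wave (c * z k) z).
Proof. by rewrite im_wave partial_re_wave im_wave mulrA. Qed.

Lemma cpartial_wave c z k : cpartial k (wave c z) = wave (c * z k) z.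
Proof.
apply/funext => x; rewrite /cpartial partial_re_wave partial_im_wave.
by rewrite /re /im; case: (wave _ _ x).
Qed.

End SmoothWaves.

Section WaveFields.
Variable R : realType.

Lemma measurable_re_wave c z : measurable_fun setT (re (@wave R c z)).
Proof. by apply: continuous_measurable3; exact/smooth_continuous/smooth_re_wave. Qed.

Lemma measurable_im_wave c z : measurable_fun setT (im (@wave R c z)).
Proof. by rewrite im_wave; exact: measurable_re_wave. Qed.

Lemma re_wave_bounded c z (A : set (R * R * R)) : bounded_set A ->
  exists M : R, forall x, A x -> `|re (wave c z) x| <= M.
Proof.
move=> /(bounded_pw z)[M [M0 zM]].
exists (`|complex.Re c| * M + `|complex.Im c| * M) => x /zM[rM iM].
rewrite /re /wave cReM; apply: le_trans (ler_normB _ _) _.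
by rewrite (normrM (complex.Re c)) (normrM (complex.Im c)); apply: lerD; apply: ler_wpM2l.
Qed.

Lemma sqnorm_wave_bounded c z (A : set (R * R * R)) : bounded_set A ->
  exists M : R, forall x, A x -> sqnorm (wave c z x) <= M.
Proof.
move=> bA; have [M rM] := re_wave_bounded c z bA.
have [N iN] := re_wave_bounded ((0 -i* 1) * c) z bA.
exists (M ^+ 2 + N ^+ 2) => x Ax; have /= := rM _ Ax; have /= := iN _ Ax.
rewrite -im_wave /re /im => h1 h2; rewrite /sqnorm; apply: lerD.
  by rewrite -real_normK ?num_real// ler_sqr ?nnegrE//; apply: le_trans h2.
by rewrite -real_normK ?num_real// ler_sqr ?nnegrE//; apply: le_trans h1.
Qed.

Lemma sqnorm_ge0 (w : R[i]) : 0 <= sqnorm w.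
Proof. by rewrite /sqnorm addr_ge0// sqr_ge0. Qed.

Lemma measurable_sqnorm_wave c z :
  measurable_fun setT (fun x => sqnorm (@wave R c z x)).
Proof.
by apply: measurable_funD; apply: measurable_funX;
  [exact: measurable_re_wave|exact: measurable_im_wave].
Qed.

Lemma bounded_integral_lty d (T : measurableType d) (mu : {measure set T -> \bar R})
    (D : set T) (F : T -> R) (M : R) :
  measurable D -> (mu D < +oo)%E -> measurable_fun D F ->
  (forall x, D x -> 0 <= F x <= M) -> (\int[mu]_(x in D) (F x)%:E < +oo)%E.
Proof.
move=> mD Doo mF FM; have iF : mu.-integrable D (EFin \o F).
  apply: measurable_bounded_integrable => //; exists M; split; first exact: num_real.
  move=> y My x Dx; have /andP[F0 F1] := FM x Dx.
  by rewrite /= ger0_norm// (le_trans F1)// ltW.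
by have := integrable_lty mD iF.
Qed.

Definition wfield (a z : 'I_3 -> R[i]) : vfield R := fun j => wave (a j) z.
Definition wgrad (a z : 'I_3 -> R[i]) : gradient R := fun i j => wave (a j * z i) z.

Variable Om : set (R * R * R).
Hypotheses (oOm : open Om) (bOm : bounded_set Om).
Let mOm : measurable Om := open_measurable3 oOm.

Lemma wave_L2 c z : in_L2 Om (wave c z).
Proof.
split.
  by split; [apply: measurable_funS (measurable_re_wave c z)|
             apply: measurable_funS (measurable_im_wave c z)].
have [M cM] := sqnorm_wave_bounded c z bOm.
apply: (@bounded_integral_lty _ _ (leb3 R) Om (fun x => sqnorm (wave c z x)) M) => //.
- exact: bounded_leb3_lty.
- by apply: measurable_funS (measurable_sqnorm_wave c z).
- by move=> x Ox; rewrite sqnorm_ge0 cM.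
Qed.

Lemma wave_test c z phi k : test_fun Om phi ->
  [/\ cintegrable Om (fun x => wave c z x * (partial k phi x)%:C),
      cintegrable Om (fun x => wave c z x * (phi x)%:C) &
      cint Om (fun x => wave c z x * (partial k phi x)%:C) =
      - cint Om (fun x => wave (c * z k) z x * (phi x)%:C)].
Proof.
move=> tphi.
have reM (f : R * R * R -> R[i]) (g : R * R * R -> R) :
    re (fun x => f x * (g x)%:C) = fun x => re f x * g x.
  by apply/funext => x; rewrite /re cReM /= mulr0 subr0.
have imM (f : R * R * R -> R[i]) (g : R * R * R -> R) :
    im (fun x => f x * (g x)%:C) = fun x => im f x * g x.
  by apply/funext => x; rewrite /im cImM /= mulr0 add0r.
have [i1 _ e1] := test_fun_parts oOm k (smooth_re_wave c z) tphi.
have [i3 _ e3] := test_fun_parts oOm k (smooth_im_wave c z) tphi.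
split.
- by split; rewrite ?reM ?imM.
- have ph : (leb3 R).-integrable setT (EFin \o phi).
    have [sphi cK _] := tphi.
    apply: (compact_support_integrable (smooth_continuous sphi) cK) => x.
    by move=> /(test_fun_out k)[].
  have iph : (leb3 R).-integrable Om (EFin \o phi) by apply: integrableS ph.
  have := cintegrable_pw mOm bOm iph z.
  move=> /(cintegrableZ mOm c); apply: eq_cintegrable => // x _.
  by rewrite /wave; ring.
- rewrite /cint !reM !imM e1 e3 partial_re_wave partial_im_wave.
  by apply: complexP.
Qed.

Lemma wave_in_H1 c z : in_H1 Om (wave c z) (fun k => wave (c * z k) z).
Proof.
split; first exact: wave_L2.
move=> k; split; first exact: wave_L2.
by move=> phi tphi; have [] := wave_test c z k tphi.
Qed.

Lemma wfield_H1 a z : H1_field Om (wfield a z) (wgrad a z).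
Proof. by move=> j; exact: wave_in_H1. Qed.

(** Integration by parts moves every derivative from the test function to the wave,
    where it becomes a factor [z]; what is left is the algebraic system times one
    integral. *)
Lemma wfield_lame lam mu rho w a z :
  (forall j, mu%:C * (\sum_i z i * z i) * a j +
     (lam + mu)%:C * (\sum_i a i * z i) * z j + (w ^+ 2 * rho)%:C * a j = 0) ->
  lame_eq Om lam mu rho w (wfield a z) (wgrad a z).
Proof.
move=> sym phi tphi j; rewrite /wfield /wgrad.
pose P := fun x => pw z x * (phi x)%:C.
pose Q k := fun x => pw z x * (partial k phi x)%:C.
have w1 x : pw z x = wave 1 z x by rewrite /wave mul1r.
have iP : cintegrable Om P.
  by have [_ + _] := wave_test 1 z j tphi; apply: eq_cintegrable => // x _; rewrite /P w1.
have iQ k : cintegrable Om (Q k).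
  by have [+ _ _] := wave_test 1 z k tphi; apply: eq_cintegrable => // x _; rewrite /Q w1.
have QP k : cint Om (Q k) = - (z k * cint Om P).
  have [_ _ E] := wave_test 1 z k tphi.
  rewrite (eq_cint (g := fun x => wave 1 z x * (partial k phi x)%:C)); last first.
    by move=> x _; rewrite /Q w1.
  rewrite E -cintZ//; congr (- _); apply: eq_cint => x _.
  by rewrite /wave /P mul1r mulrA.
rewrite (eq_cint (g := fun x => \sum_i (- mu%:C * a j * z i) * Q i x +
   (- ((lam + mu)%:C * \sum_k a k * z k) * Q j x + ((w ^+ 2 * rho)%:C * a j) * P x))); last first.
  move=> x _; rewrite addrA; congr (_ + _ + _).
  - by rewrite mulr_sumr -sumrN; apply: eq_bigr => i _; rewrite /wave /Q; ring.
  - by rewrite /wave -mulr_suml /Q; ring.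
  - by rewrite /wave /P; ring.
have iZ (c : R[i]) f : cintegrable Om f -> cintegrable Om (fun x => c * f x).
  exact: cintegrableZ.
rewrite cintD//; [|by apply: cintegrable_sum => // i; exact: iZ|
  by apply: cintegrableD => //; exact: iZ].
rewrite cint_sum//; last by move=> i; exact: iZ.
rewrite cintD//; [|exact: iZ..].
transitivity ((mu%:C * (\sum_i z i * z i) * a j +
     (lam + mu)%:C * (\sum_i a i * z i) * z j + (w ^+ 2 * rho)%:C * a j) * cint Om P).
  transitivity (\sum_i (mu%:C * a j * cint Om P) * (z i * z i) +
      ((lam + mu)%:C * (\sum_k a k * z k) * (z j * cint Om P) +
       (w ^+ 2 * rho)%:C * a j * cint Om P)); last by rewrite -mulr_sumr; ring.
  congr (_ + (_ + _)).
  - by apply: eq_bigr => i _; rewrite cintZ// QP; ring.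
  - by rewrite cintZ// QP; ring.
  - by rewrite cintZ.
by rewrite sym mul0r.
Qed.

End WaveFields.

Section WaveTrace.
Variable R : realType.

Lemma open_square (r : R) : open (square r).
Proof.
have -> : square r = (fun y : R * R => `|y|) @^-1` [set t | t < r] by [].
by apply: open_comp; [move=> y _; exact: norm_continuous|exact: open_lt].
Qed.

Lemma square_box (r : R) : square r `<=` box r `*` box r.
Proof.
move=> y /= yr; have := ltW yr; rewrite prod_normE ge_max => /andP[y1 y2].
by split; rewrite /box /= in_itv /= -ler_norml.
Qed.

Lemma square_lty (r : R) : (leb2 R (square r) < +oo)%E.
Proof.
apply: le_lt_trans (box2_lty r); apply: le_measure; rewrite ?inE.
- by apply: open_measurable2; exact: open_square.
- by apply: measurableX; exact: measurable_itv.
- exact: square_box.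
Qed.

Lemma measurable_square (r : R) : measurable (square r).
Proof. by apply: open_measurable2; exact: open_square. Qed.

Lemma near_dist_lt (x : R * R) (d : R) : 0 < d -> \forall t \near x, `|x - t| < d.
Proof.
by move=> d0; apply: (@cvgr_dist_lt R (R * R)%type _ (nbhs x) _ id x) => //; exact: cvg_id.
Qed.

(** The first derivatives of a chart are only Lipschitz on the open square, which
    still makes the surface density measurable. *)
Lemma lipschitz_measurable (D : set (R * R)) (f : R * R -> R) (K : R) : open D ->
  (forall y z, D y -> D z -> `|f y - f z| <= K * `|y - z|) -> measurable_fun D f.
Proof.
move=> oD fK; apply: continuous_measurable2 => // x Dx.
apply/cvgrPdist_lt => e e0.
have K0 : 0 < `|K| + 1 by rewrite ltr_wpDl.
have : \forall t \near x, D t /\ `|x - t| < e / (`|K| + 1).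
  apply: filterI; first exact: open_nbhs_nbhs.
  have d0 : 0 < e / (`|K| + 1) by rewrite divr_gt0.
  exact: near_dist_lt.
apply: filterS => t [Dt xt]; apply: le_lt_trans (fK _ _ Dx Dt) _.
apply: (@le_lt_trans _ _ ((`|K| + 1) * `|x - t|)).
  by rewrite ler_wpM2r// (le_trans (ler_norm _))// lerDl.
by rewrite mulrC -ltr_pdivlMr.
Qed.

Variable c : chart R.

Let D := square (chart_rad c).
Let G := fun y => chart_map c y (chart_fun c y).

Lemma graph_crd y k : crd (G y) k = crd (chart_ctr c) k +
  \sum_j chart_rot c k j * crd (y, chart_fun c y) j.
Proof.
rewrite /G /chart_map; set v := _ *m _.
have -> : crd (chart_ctr c + of_col v) k = crd (chart_ctr c) k + v k 0.
  rewrite /crd /of_col ord3_2; case: k => -[|[|[|//]]] ? /=; congr (_ + v _ _);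
  exact/val_inj.
congr (_ + _); rewrite mxE; apply: eq_bigr => j _; congr (_ * _).
by rewrite mxE.
Qed.

Variable Om : set (R * R * R).
Hypothesis cOm : C11_chart Om c.

Lemma chart_fun_measurable : measurable_fun D (chart_fun c).
Proof.
have [_ _ [dg _] _ _] := cOm.
apply: continuous_measurable2 => [|x Dx]; first exact: open_square.
exact/differentiable_continuous/dg.
Qed.

Lemma graph_measurable : measurable_fun D G.
Proof.
have mD : measurable D := measurable_square _.
have mg := chart_fun_measurable.
have mc j : measurable_fun D (fun y => crd (y, chart_fun c y) j).
  case: j => -[|[|[|//]]] ?; rewrite /crd /=.
  - by apply: measurable_funS measurable_fst.
  - by apply: measurable_funS measurable_snd.
  - exact: mg.
have mG k : measurable_fun D (fun y => crd (G y) k).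
  rewrite (_ : (fun y => _) = fun y => crd (chart_ctr c) k +
    \sum_j chart_rot c k j * crd (y, chart_fun c y) j); last first.
    by apply/funext => y; rewrite graph_crd.
  apply: measurable_funD => //; apply: measurable_sum => j.
  exact: measurable_funM.
(* Extended by zero, the coordinates are measurable on the whole plane and can be
   put together. *)
have mG' k : measurable_fun setT ((fun y => crd (G y) k) \_ D).
  exact: (measurable_restrictT _ mD).1 (mG k).
pose G' y := (((fun y => crd (G y) ord0) \_ D) y,
  ((fun y => crd (G y) (lift ord0 ord0)) \_ D) y,
  ((fun y => crd (G y) ord_max) \_ D) y).
have mGT : measurable_fun setT G'.
  by apply: measurable_fun_pair => //; exact: measurable_fun_pair.
apply: (@eq_measurable_fun _ _ _ _ _ G') => [y Dy|].
  by rewrite /G' /patch Dy.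
exact: measurable_funS mGT.
Qed.

Lemma graph_bounded : bounded_set (G @` D).
Proof.
have [_ [r0 h0] _ gh _] := cOm.
pose B := `|chart_ctr c| + \sum_k \sum_j `|chart_rot c k j| * (chart_rad c + chart_hgt c).
exists B; split; first exact: num_real.
move=> M BM _ [y Dy <-]; apply: le_trans (ltW BM).
have crdB k : `|crd (G y) k| <= B.
  rewrite graph_crd; apply: le_trans (ler_normD _ _) _; apply: lerD.
    exact: norm_crd_le.
  apply: le_trans (ler_norm_sum _ _ _) _.
  apply: (@le_trans _ _ (\sum_j `|chart_rot c k j| * (chart_rad c + chart_hgt c))).
    apply: ler_sum => j _; rewrite normrM ler_wpM2l//.
    apply: le_trans (norm_crd_le _ _) _; rewrite prod_normE ge_max /=.
    have := gh _ Dy; have : `|y| < chart_rad c by [].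
    by move=> ? ?; apply/andP; split; lra.
  by rewrite [leRHS](bigD1 k)//= lerDl sumr_ge0// => i _; rewrite sumr_ge0// => j _; rewrite mulr_ge0//; lra.
rewrite norm3_le; apply/and3P; split.
- exact: (crdB ord0).
- exact: (crdB (lift ord0 ord0)).
- exact: (crdB ord_max).
Qed.

(** Over a chart everything is bounded: the graph lies in a bounded set, and the
    derivatives of [chart_fun], being Lipschitz on a bounded square, are bounded. *)
Lemma wave_L2_chart a z : cmeasurable D (on_graph c (wave a z)) /\
  (surf_sqint c (wave a z) < +oo)%E.
Proof.
have mD : measurable D := measurable_square _.
have mG := graph_measurable.
have [_ [r0 h0] [dg [K gK]] _ _] := cOm.
split.
  split; [exact: (measurableT_comp (measurable_re_wave a z) mG)|
          exact: (measurableT_comp (measurable_im_wave a z) mG)].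
pose g1 := 'D_(1, 0) (chart_fun c); pose g2 := 'D_(0, 1) (chart_fun c).
have mg1 : measurable_fun D g1.
  apply: (@lipschitz_measurable _ _ K); first exact: open_square.
  by move=> y y' Dy Dy'; exact: (gK y y' Dy Dy').1.
have mg2 : measurable_fun D g2.
  apply: (@lipschitz_measurable _ _ K); first exact: open_square.
  by move=> y y' Dy Dy'; exact: (gK y y' Dy Dy').2.
have D0 : D 0 by rewrite /D /square /= normr0.
have lipB (f : R * R -> R) : (forall y y', D y -> D y' -> `|f y - f y'| <= K * `|y - y'|) ->
    forall y, D y -> f y ^+ 2 <= (`|f 0| + `|K| * chart_rad c) ^+ 2.
  move=> fK y Dy; rewrite -(real_normK (num_real (f y))) ler_sqr ?nnegrE ?addr_ge0//; last first.
    by rewrite mulr_ge0// ltW.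
  have -> : f y = f 0 + (f y - f 0) by rewrite addrC subrK.
  apply: le_trans (ler_normD _ _) _; rewrite lerD2l; apply: le_trans (fK _ _ Dy D0) _.
  rewrite subr0; apply: (@le_trans _ _ (`|K| * `|y|)).
    by rewrite ler_wpM2r// ler_norm.
  by rewrite ler_wpM2l//; exact: ltW.
have [B1 hB1] : exists B, forall y, D y -> g1 y ^+ 2 <= B.
  by eexists; apply: lipB => y y' Dy Dy'; exact: (gK y y' Dy Dy').1.
have [B2 hB2] : exists B, forall y, D y -> g2 y ^+ 2 <= B.
  by eexists; apply: lipB => y y' Dy Dy'; exact: (gK y y' Dy Dy').2.
have [M hM] := sqnorm_wave_bounded a z graph_bounded.
pose S y := Num.sqrt (1 + g1 y ^+ 2 + g2 y ^+ 2).
apply: (@bounded_integral_lty _ _ _ (leb2 R) D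
  (fun y => sqnorm (wave a z (G y)) * S y) (M * Num.sqrt (1 + B1 + B2))) => //.
- exact: square_lty.
- apply: measurable_funM.
    exact: (measurableT_comp (measurable_sqnorm_wave a z) mG).
  have msqrt : measurable_fun setT (@Num.sqrt R).
    by apply: continuous_measurable_fun; exact: sqrt_continuous.
  apply: (measurableT_comp msqrt).
  exact: (measurable_funD (measurable_funD (measurable_cst (1 : R))
    (measurable_funX 2 mg1)) (measurable_funX 2 mg2)).
- move=> y Dy; rewrite mulr_ge0 ?sqnorm_ge0 ?sqrtr_ge0//=.
  apply: ler_pM; rewrite ?sqnorm_ge0 ?sqrtr_ge0//.
    by apply: hM; exists y.
  by apply: ler_wsqrtr; apply: lerD; [rewrite lerD2l; exact: hB1|exact: hB2].
Qed.

End WaveTrace.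

Section WaveTraceField.
Variables (R : realType) (Om : set (R * R * R)).
Hypotheses (oOm : open Om) (bOm : bounded_set Om).

Lemma sqnorm0 : sqnorm (0 : R[i]) = 0.
Proof. by rewrite /sqnorm /= expr0n addr0. Qed.

(** A wave is smooth on the whole space, so the constant sequence approximates it. *)
Lemma wave_trace a z : trace Om (wave a z) (fun k => wave (a * z k) z) (wave a z).
Proof.
split; first by move=> c cOm; exact: (wave_L2_chart cOm).
exists (fun=> wave a z); split.
- by move=> n; split; [exact: smooth_re_wave|exact: smooth_im_wave].
- split=> [|k].
    rewrite (_ : (fun n => _) = fun=> 0%E); first exact: cvg_cst.
    apply/funext => n; apply: integral0_eq => x _.
    by rewrite subrr sqnorm0.
  rewrite (_ : (fun n => _) = fun=> 0%E); first exact: cvg_cst.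
  apply/funext => n; apply: integral0_eq => x _.
  by rewrite cpartial_wave subrr sqnorm0.
- move=> c cOm; rewrite (_ : (fun n => _) = fun=> 0%E); first exact: cvg_cst.
  apply/funext => n; apply: integral0_eq => x _.
  by rewrite /on_graph subrr sqnorm0 mul0r.
Qed.

Lemma wfield_trace a z : trace_field Om (wfield a z) (wgrad a z) (wfield a z).
Proof. by move=> j; exact: wave_trace. Qed.

Lemma wfield_Hhalf a z : Hhalf Om (wfield a z).
Proof.
by exists (wfield a z), (wgrad a z); split; [exact: wfield_H1|exact: wfield_trace].
Qed.

End WaveTraceField.

(** * Transversely isotropic tensors *)

Section NormalForm.
Variable R : realType.
Implicit Types (u v w t : 'cV[R]_3).

Definition lin (g : 'cV[R]_3 -> R) : Prop :=
  forall a u v, g (a *: u + v) = a * g u + g v.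

Definition bas (i : 'I_3) : 'cV[R]_3 := delta_mx i 0.

Lemma lin_bas g u : lin g -> g u = \sum_i u i 0 * g (bas i).
Proof.
move=> lg; have lg0 : g 0 = 0.
  by have := lg (-1) 0 0; rewrite scaler0 addr0 mulN1r addNr.
rewrite [in LHS](matrix_sum_delta u).
have lgS (r : seq 'I_3) (f : 'I_3 -> 'cV[R]_3) :
    g (\sum_(i <- r) f i) = \sum_(i <- r) g (f i).
  elim: r => [|i r IH]; first by rewrite !big_nil.
  by rewrite !big_cons -IH -[f i]scale1r lg mul1r scale1r.
rewrite lgS; apply: eq_bigr => i _; rewrite big_ord1.
by rewrite -[_ *: _]addr0 lg lg0 addr0 /bas.
Qed.

Lemma lin_coord i : lin (fun u => u i 0).
Proof. by move=> a u v; rewrite !mxE. Qed.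

Lemma lin_sum (c : 'I_3 -> R) (g : 'I_3 -> 'cV[R]_3 -> R) : (forall i, lin (g i)) ->
  lin (fun u => \sum_i c i * g i u).
Proof.
move=> lg a u v; rewrite mulr_sumr -big_split /=; apply: eq_bigr => i _.
by rewrite lg; ring.
Qed.

Lemma lin_suml (c : 'I_3 -> R) (g : 'I_3 -> 'cV[R]_3 -> R) : (forall i, lin (g i)) ->
  lin (fun u => \sum_i g i u * c i).
Proof.
move=> lg a u v; rewrite mulr_sumr -big_split /=; apply: eq_bigr => i _.
by rewrite lg; ring.
Qed.

(** A four-linear form, so that a tensor and its change of frame are the same
    form evaluated at different vectors. *)
Definition lin4 (F : 'cV[R]_3 -> 'cV[R]_3 -> 'cV[R]_3 -> 'cV[R]_3 -> R) : Prop :=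
  [/\ forall v w t, lin (fun u => F u v w t), forall u w t, lin (fun v => F u v w t),
      forall u v t, lin (fun w => F u v w t) & forall u v w, lin (fun t => F u v w t)].

Lemma lin4_ext F G : lin4 F -> lin4 G ->
  (forall i j k l, F (bas i) (bas j) (bas k) (bas l) = G (bas i) (bas j) (bas k) (bas l)) ->
  forall u v w t, F u v w t = G u v w t.
Proof.
move=> [F1 F2 F3 F4] [G1 G2 G3 G4] FG u v w t.
rewrite (lin_bas u (F1 v w t)) (lin_bas u (G1 v w t)); apply: eq_bigr => i _; congr (_ * _).
rewrite (lin_bas v (F2 _ w t)) (lin_bas v (G2 _ w t)); apply: eq_bigr => j _; congr (_ * _).
rewrite (lin_bas w (F3 _ _ t)) (lin_bas w (G3 _ _ t)); apply: eq_bigr => k _; congr (_ * _).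
by rewrite (lin_bas t (F4 _ _ _)) (lin_bas t (G4 _ _ _)); apply: eq_bigr => l _; congr (_ * _).
Qed.

Definition form4 (c : 'I_3 -> 'I_3 -> 'I_3 -> 'I_3 -> R) u v w t : R :=
  \sum_i u i 0 * \sum_j v j 0 * \sum_k w k 0 * \sum_l t l 0 * c i j k l.

Lemma lin4_form4 c : lin4 (form4 c).
Proof.
split.
- by move=> v w t; apply: lin_suml => i; exact: lin_coord.
- by move=> u w t; apply: lin_sum => i; apply: lin_suml => j; exact: lin_coord.
- by move=> u v t; do 2! apply: lin_sum => ?; apply: lin_suml => k; exact: lin_coord.
- by move=> u v w; do 3! apply: lin_sum => ?; apply: lin_suml => l; exact: lin_coord.
Qed.

Lemma sum_bas i (f : 'I_3 -> R) : \sum_j bas i j 0 * f j = f i.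
Proof.
rewrite (bigD1 i)//= big1 => [|j /negbTE ji]; rewrite mxE ?ji ?eqxx ?mul1r ?addr0//.
by rewrite mul0r.
Qed.

Lemma mulmx_bas (A : 'M[R]_3) p i : (A *m bas p) i 0 = A i p.
Proof.
by rewrite mxE -(sum_bas p (fun q => A i q)); apply: eq_bigr => q _; rewrite mulrC.
Qed.

Lemma form4_bas c i j k l : form4 c (bas i) (bas j) (bas k) (bas l) = c i j k l.
Proof. by rewrite /form4 !sum_bas. Qed.

Lemma lin4_mul F (A : 'M[R]_3) : lin4 F ->
  lin4 (fun u v w t => F (A *m u) (A *m v) (A *m w) (A *m t)).
Proof.
move=> [F1 F2 F3 F4].
by split=> x y z a u v; rewrite mulmxDr -scalemxAr ?F1 ?F2 ?F3 ?F4.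
Qed.

Definition dot u v : R := \sum_i u i 0 * v i 0.

Lemma lin_dotl v : lin (dot ^~ v).
Proof. by apply: lin_suml => i; exact: lin_coord. Qed.

Lemma lin_dotr u : lin (dot u).
Proof. by apply: lin_sum => i; exact: lin_coord. Qed.

Lemma dot_bas i j : dot (bas i) (bas j) = (i == j)%:R.
Proof. by rewrite /dot sum_bas mxE eqxx andbT eq_sym. Qed.

Lemma dotE u v : dot u v = (u^T *m v) 0 0.
Proof. by rewrite mxE; apply: eq_bigr => i _; rewrite mxE. Qed.

(** The five tensors built from the metric and [e] that have the elastic
    symmetries; they span the transversely isotropic tensors
    ([ti_form_unique]). *)
Definition ti_form (c1 c2 c3 c4 c5 : R) (e u v w t : 'cV[R]_3) : R :=
  c1 * (dot u v * dot w t) + c2 * (dot u w * dot v t + dot u t * dot v w) +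
  c3 * (dot e u * dot e v * dot w t + dot u v * dot e w * dot e t) +
  c4 * (dot e u * dot e w * dot v t + dot e u * dot e t * dot v w +
        dot e v * dot e w * dot u t + dot e v * dot e t * dot u w) +
  c5 * (dot e u * dot e v * dot e w * dot e t).

Lemma lin4_ti_form c1 c2 c3 c4 c5 e : lin4 (ti_form c1 c2 c3 c4 c5 e).
Proof.
by split=> x y z a u v; rewrite /ti_form ?(lin_dotr _ a) ?(lin_dotl _ a); ring.
Qed.

End NormalForm.

Section TransverseIsotropy.
Variable R : realType.
Implicit Types (u v w t : 'cV[R]_3).

Let E0 : 'I_3 := ord0.
Let E1 : 'I_3 := lift ord0 ord0.
Let E2 : 'I_3 := ord_max.

Lemma ord3_cases (p : 'I_3) : p = ord0 \/ p = lift ord0 ord0 \/ p = ord_max.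
Proof.
by case: p => -[|[|[|//]]] ?; [left|right; left|right; right]; exact/val_inj.
Qed.

Lemma reflection_bas (k p : 'I_3) :
  (reflection R k)^T *m bas R p = (if p == k then -1 else 1) *: bas R p.
Proof.
by apply/matrixP => i j; rewrite ord1 mulmx_bas !mxE eqxx andbT [p == i]eq_sym mulr_natr.
Qed.

Lemma rotation_bas (th : R) :
  [/\ (rotation3 th)^T *m bas R E0 = cos th *: bas R E0 - sin th *: bas R E1,
      (rotation3 th)^T *m bas R E1 = sin th *: bas R E0 + cos th *: bas R E1 &
      (rotation3 th)^T *m bas R E2 = bas R E2].
Proof.
by split; apply/matrixP => i j; rewrite ord1 mulmx_bas !mxE;
  have [->|[->|->]] := ord3_cases i; rewrite /=
   ?(mulr0, mulr1, addr0, add0r, subr0, sub0r, oppr0).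
Qed.

Lemma pi_quarter (p := pi / 4 : R) : [/\ cos p ^+ 2 = 2^-1, sin p ^+ 2 = 2^-1 &
  0 <= p <= 2 * pi].
Proof.
have h : cos (p + p) = 0.
  by rewrite (_ : p + p = pi / 2) ?cos_pihalf// /p; field.
have h1 := cos2Dsin2 p; rewrite cosD in h; have p0 := pi_ge0 R.
by split; [move: h h1; rewrite !expr2; lra|move: h h1; rewrite !expr2; lra|rewrite /p; lra].
Qed.

Lemma rotation_quarter : 0 <= (pi : R) / 2 <= 2 * pi.
Proof. by have := pi_ge0 R; lra. Qed.

Variable F : 'cV[R]_3 -> 'cV[R]_3 -> 'cV[R]_3 -> 'cV[R]_3 -> R.
Hypothesis lF : lin4 F.
Hypothesis F_ij : forall u v w t, F u v w t = F v u w t.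
Hypothesis F_ijkl : forall u v w t, F u v w t = F w t u v.
Hypothesis F_ti : forall Q, TI_matrices Q -> forall u v w t,
  F (Q^T *m u) (Q^T *m v) (Q^T *m w) (Q^T *m t) = F u v w t.

Let b p q r s := F (bas R p) (bas R q) (bas R r) (bas R s).

(** Reflections kill every component in which some index occurs an odd number of
    times, and the quarter turn exchanges the directions [0] and [1]. This leaves
    six components; the eighth turn relates three of them. *)
Lemma ti_form_unique u v w t : F u v w t =
  ti_form (b E0 E0 E1 E1) (b E0 E1 E0 E1) (b E0 E0 E2 E2 - b E0 E0 E1 E1)
    (b E0 E2 E0 E2 - b E0 E1 E0 E1)
    (b E2 E2 E2 E2 - b E0 E0 E1 E1 - 2 * b E0 E1 E0 E1
      - 2 * (b E0 E0 E2 E2 - b E0 E0 E1 E1) - 4 * (b E0 E2 E0 E2 - b E0 E1 E0 E1))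
    (bas R E2) u v w t.
Proof.
have [F1 F2 F3 F4] := lF.
have Z1 a x y z r : F (a *: x) y z r = a * F x y z r.
  have z0 : F 0 y z r = 0 by have := F1 y z r (-1) 0 0; rewrite scaler0 addr0 mulN1r addNr.
  by rewrite -[_ *: _]addr0 F1 z0 addr0.
have Z2 a x y z r : F x (a *: y) z r = a * F x y z r by rewrite F_ij Z1 F_ij.
have Z3 a x y z r : F x y (a *: z) r = a * F x y z r by rewrite F_ijkl Z1 F_ijkl.
have Z4 a x y z r : F x y z (a *: r) = a * F x y z r by rewrite F_ijkl Z2 F_ijkl.
have refl k p q r s : b p q r s = (if p == k then -1 else 1) * ((if q == k then -1 else 1) *
    ((if r == k then -1 else 1) * ((if s == k then -1 else 1) * b p q r s))).
  rewrite {1}/b -(F_ti (Q := reflection R k)); last by left; exists k.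
  by rewrite !reflection_bas Z1 Z2 Z3 Z4.
have [q0 q1 q2] := rotation_bas (pi / 2).
rewrite cos_pihalf sin_pihalf !scale0r !scale1r sub0r addr0 in q0 q1.
have rotQ (th : R) : 0 <= th <= 2 * pi -> TI_matrices (rotation3 th) by move=> ?; right; exists th.
have rot := F_ti (rotQ _ rotation_quarter).
have N1 : - bas R E1 = (-1) *: bas R E1 by rewrite scaleN1r.
have r1 : b E0 E0 E0 E0 = b E1 E1 E1 E1.
  by rewrite {1}/b -rot !q0 N1 Z1 Z2 Z3 Z4 /b; ring.
have r2 : b E0 E0 E2 E2 = b E1 E1 E2 E2.
  by rewrite {1}/b -rot !q0 !q2 N1 Z1 Z2 /b; ring.
have r3 : b E0 E2 E0 E2 = b E1 E2 E1 E2.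
  by rewrite {1}/b -rot !q0 !q2 N1 Z1 Z3 /b; ring.
have s1 p q r s : b p q r s = b q p r s by exact: F_ij.
have s2 p q r s : b p q r s = b r s p q by exact: F_ijkl.
have s3 p q r s : b p q r s = b p q s r by rewrite s2 s1 s2.
(* The eighth turn maps the first direction to the diagonal of the first two. *)
have r4 : b E0 E0 E0 E0 = b E0 E0 E1 E1 + 2 * b E0 E1 E0 E1.
  have [cc ss pq] := pi_quarter.
  have [h0 _ _] := rotation_bas (pi / 4).
  set c := cos _ in cc h0; set s := sin _ in ss h0.
  have odd p q r l : b p q r l = - b p q r l -> b p q r l = 0 by move=> ?; lra.
  have o1 : b E0 E0 E0 E1 = 0 by apply: odd; rewrite {1}(refl E1) /=; ring.
  have o2 : b E0 E0 E1 E0 = 0 by apply: odd; rewrite {1}(refl E1) /=; ring.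
  have o3 : b E0 E1 E0 E0 = 0 by apply: odd; rewrite {1}(refl E1) /=; ring.
  have o4 : b E1 E0 E0 E0 = 0 by apply: odd; rewrite {1}(refl E1) /=; ring.
  have o5 : b E1 E1 E1 E0 = 0 by apply: odd; rewrite {1}(refl E0) /=; ring.
  have o6 : b E1 E1 E0 E1 = 0 by apply: odd; rewrite {1}(refl E0) /=; ring.
  have o7 : b E1 E0 E1 E1 = 0 by apply: odd; rewrite {1}(refl E0) /=; ring.
  have o8 : b E0 E1 E1 E1 = 0 by apply: odd; rewrite {1}(refl E0) /=; ring.
  have : b E0 E0 E0 E0 = (c ^+ 2) ^+ 2 * b E0 E0 E0 E0 + (s ^+ 2) ^+ 2 * b E1 E1 E1 E1 +
     c ^+ 2 * s ^+ 2 * (b E0 E0 E1 E1 + b E0 E1 E0 E1 + b E0 E1 E1 E0 +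
       b E1 E0 E0 E1 + b E1 E0 E1 E0 + b E1 E1 E0 E0).
    rewrite {1}/b -(F_ti (rotQ _ pq)) !h0 -scaleNr.
    rewrite F1 Z1 !F2 !Z2 !F3 !Z3 !F4 !Z4.
    rewrite -/(b E0 E0 E0 E1) -/(b E0 E0 E1 E0) -/(b E0 E1 E0 E0) -/(b E1 E0 E0 E0).
    rewrite -/(b E1 E1 E1 E0) -/(b E1 E1 E0 E1) -/(b E1 E0 E1 E1) -/(b E0 E1 E1 E1).
    by rewrite o1 o2 o3 o4 o5 o6 o7 o8 /b; ring.
  rewrite cc ss -r1.
  have := s1 E0 E1 E0 E1; have := s3 E0 E1 E0 E1; have := s2 E0 E0 E1 E1.
  have := s3 E1 E0 E0 E1; rewrite !expr2; lra.
apply: lin4_ext => //; first exact: lin4_ti_form.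
move=> p q r s; rewrite /ti_form !dot_bas -/(b p q r s).
have := refl E0 p q r s; have := refl E1 p q r s; have := refl E2 p q r s.
have := s1 p q r s; have := s3 p q r s; have := s2 p q r s.
have := s1 q p s r; have := s3 q p r s; have := s2 q p r s; have := s2 p q s r; have := s2 q p s r.
have [->|[->|->]] := ord3_cases p; have [->|[->|->]] := ord3_cases q;
have [->|[->|->]] := ord3_cases r; have [->|[->|->]] := ord3_cases s;
rewrite -/E0 -/E1 -/E2 /=; lra.
Qed.

End TransverseIsotropy.

Section RotatedAxis.
Variables (R : realType) (S : 'M[R]_3).
Hypothesis SS : S^T *m S = 1%:M.
Let SSt : S *m S^T = 1%:M. Proof. exact: mulmx1C. Qed.
Let e := S *m bas R ord_max.

Lemma dot_mul u v : dot (S^T *m u) (S^T *m v) = dot u v.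
Proof. by rewrite !dotE trmx_mul trmxK mulmxA -(mulmxA u^T) SSt mulmx1. Qed.

Lemma dot_axis u : dot (bas R ord_max) (S^T *m u) = dot e u.
Proof. by rewrite !dotE /e trmx_mul mulmxA. Qed.

Lemma ti_form_rotate c1 c2 c3 c4 c5 u v w t :
  ti_form c1 c2 c3 c4 c5 (bas R ord_max) (S^T *m u) (S^T *m v) (S^T *m w) (S^T *m t) =
  ti_form c1 c2 c3 c4 c5 e u v w t.
Proof. by rewrite /ti_form !dot_mul !dot_axis. Qed.

Variable c : 'I_3 -> 'I_3 -> 'I_3 -> 'I_3 -> R.
Hypothesis c_ij : forall i j k l, c i j k l = c j i k l.
Hypothesis c_ijkl : forall i j k l, c i j k l = c k l i j.
Hypothesis c_ti : forall Q0, TI_matrices Q0 -> let Q := S *m Q0 *m S^T in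
  forall i j k l, \sum_p \sum_q \sum_r \sum_s
    Q i p * Q j q * Q k r * Q l s * c p q r s = c i j k l.

(** Being linear combinations of the components of [c] with constant coefficients,
    these inherit measurability and integrability when [c] depends on a point. *)
Definition frame4 p q r s : R :=
  form4 c (S *m bas R p) (S *m bas R q) (S *m bas R r) (S *m bas R s).

(** In the rotated frame the axis is the third basis vector and the rotated group
    becomes the standard one, so [ti_form_unique] applies; [ti_form] depends on the
    frame only through scalar products. *)
Lemma ti_tensorE (i0 := ord0 : 'I_3) (i1 := lift ord0 ord0 : 'I_3) (i2 := ord_max : 'I_3)
    (c1 := frame4 i0 i0 i1 i1) (c2 := frame4 i0 i1 i0 i1)
    (c3 := frame4 i0 i0 i2 i2 - c1) (c4 := frame4 i0 i2 i0 i2 - c2)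
    (c5 := frame4 i2 i2 i2 i2 - c1 - 2 * c2 - 2 * c3 - 4 * c4) i j k l :
  c i j k l = ti_form c1 c2 c3 c4 c5 e (bas R i) (bas R j) (bas R k) (bas R l).
Proof.
pose F u v w t := form4 c (S *m u) (S *m v) (S *m w) (S *m t).
have lF : lin4 F by apply: lin4_mul; exact: lin4_form4.
have [L1 L2 L3 L4] := lin4_form4 c.
have lH : lin4 (fun u v w t => form4 c v u w t) by split.
have Fij u v w t : form4 c u v w t = form4 c v u w t.
  apply: (lin4_ext (lin4_form4 c) lH) => i' j' k' l'.
  by rewrite !form4_bas.
have lG : lin4 (fun u v w t => form4 c w t u v) by split.
have Fijkl u v w t : form4 c u v w t = form4 c w t u v.
  apply: (lin4_ext (lin4_form4 c) lG) => i' j' k' l'.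
  by rewrite !form4_bas.
have F_ti Q0 : TI_matrices Q0 -> forall u v w t,
    F (Q0^T *m u) (Q0^T *m v) (Q0^T *m w) (Q0^T *m t) = F u v w t.
  move=> tQ u v w t; pose Q := S *m Q0 *m S^T.
  have QT p q : Q^T p q = Q q p by rewrite mxE.
  have Qc x : S *m (Q0^T *m x) = Q^T *m (S *m x).
    by rewrite /Q !trmx_mul trmxK -!mulmxA (mulmxA S^T) SS mul1mx.
  rewrite /F !Qc; set u' := S *m u; set v' := S *m v; set w' := S *m w; set t' := S *m t.
  apply: (lin4_ext (lin4_mul Q^T (lin4_form4 c)) (lin4_form4 c)) => i' j' k' l'.
  rewrite form4_bas -[RHS](c_ti tQ) -/Q /form4.
  apply: eq_bigr => p _; rewrite mulmx_bas QT mulr_sumr; apply: eq_bigr => q _.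
  rewrite mulmx_bas QT mulrA mulr_sumr; apply: eq_bigr => r _.
  rewrite mulmx_bas QT mulrA mulr_sumr; apply: eq_bigr => s _.
  by rewrite mulmx_bas QT mulrA.
have := ti_form_unique lF (fun u v w t => Fij _ _ _ _) (fun u v w t => Fijkl _ _ _ _) F_ti
   (S^T *m bas R i) (S^T *m bas R j) (S^T *m bas R k) (S^T *m bas R l).
rewrite {1}/F !mulmxA SSt !mul1mx form4_bas => ->.
by rewrite ti_form_rotate.
Qed.

Variable d : 'I_3 -> 'I_3 -> R.
Hypothesis d_ti : forall Q0, TI_matrices Q0 -> let Q := S *m Q0 *m S^T in
  forall i j, \sum_p \sum_q Q i p * Q j q * d p q = d i j.

Definition form2 (u v : 'cV[R]_3) : R := \sum_i u i 0 * \sum_j v j 0 * d i j.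
Definition frame2 p q : R := form2 (S *m bas R p) (S *m bas R q).

(** The analogue of [ti_tensorE] for two indices: reflections make the matrix
    diagonal and the quarter turn identifies the first two entries. *)
Lemma ti_densityE (r1 := frame2 ord0 ord0) (r2 := frame2 ord_max ord_max - r1) i j :
  d i j = r1 * dot (bas R i) (bas R j) + r2 * (dot e (bas R i) * dot e (bas R j)).
Proof.
have l1 v : lin (form2 ^~ v) by apply: lin_suml => k; exact: lin_coord.
have l2 u : lin (form2 u) by apply: lin_sum => ?; apply: lin_suml => k; exact: lin_coord.
have ext (f g : 'cV[R]_3 -> 'cV[R]_3 -> R) : (forall v, lin (f ^~ v)) ->
    (forall u, lin (f u)) -> (forall v, lin (g ^~ v)) -> (forall u, lin (g u)) ->
    (forall i j, f (bas R i) (bas R j) = g (bas R i) (bas R j)) -> forall u v, f u v = g u v.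
  move=> f1 f2 g1 g2 fg u v.
  rewrite (lin_bas u (f1 v)) (lin_bas u (g1 v)); apply: eq_bigr => p _; congr (_ * _).
  by rewrite (lin_bas v (f2 _)) (lin_bas v (g2 _)); apply: eq_bigr => q _; congr (_ * _).
have form2_bas p q : form2 (bas R p) (bas R q) = d p q by rewrite /form2 !sum_bas.
pose F u v := form2 (S *m u) (S *m v).
have F_ti Q0 : TI_matrices Q0 -> forall u v, F (Q0^T *m u) (Q0^T *m v) = F u v.
  move=> tQ u v; pose Q := S *m Q0 *m S^T.
  have QT p q : Q^T p q = Q q p by rewrite mxE.
  have Qc x : S *m (Q0^T *m x) = Q^T *m (S *m x).
    by rewrite /Q !trmx_mul trmxK -!mulmxA (mulmxA S^T) SS mul1mx.
  rewrite /F !Qc; set u' := S *m u; set v' := S *m v.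
  apply: (ext (fun u v => form2 (Q^T *m u) (Q^T *m v)) form2) => //.
  - by move=> x a y z; rewrite mulmxDr -scalemxAr l1.
  - by move=> x a y z; rewrite mulmxDr -scalemxAr l2.
  - move=> i' j'; rewrite form2_bas -[RHS](d_ti tQ) -/Q /form2.
    apply: eq_bigr => p _; rewrite mulmx_bas QT mulr_sumr; apply: eq_bigr => q _.
    by rewrite mulmx_bas QT mulrA.
have f1 v : lin (F ^~ v) by move=> a x y; rewrite /F mulmxDr -scalemxAr l1.
have f2 u : lin (F u) by move=> a x y; rewrite /F mulmxDr -scalemxAr l2.
have z1 a x y : F (a *: x) y = a * F x y.
  have z0 : F 0 y = 0 by have := f1 y (-1) 0 0; rewrite scaler0 addr0 mulN1r addNr.
  by rewrite -[_ *: _]addr0 f1 z0 addr0.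
have z2 a x y : F x (a *: y) = a * F x y.
  have z0 : F x 0 = 0 by have := f2 x (-1) 0 0; rewrite scaler0 addr0 mulN1r addNr.
  by rewrite -[_ *: _]addr0 f2 z0 addr0.
have refl k p q : F (bas R p) (bas R q) =
    (if p == k then -1 else 1) * ((if q == k then -1 else 1) * F (bas R p) (bas R q)).
  rewrite -{1}(F_ti (reflection R k)); last by left; exists k.
  by rewrite !reflection_bas z1 z2.
have rot : F (bas R ord0) (bas R ord0) = F (bas R (lift ord0 ord0)) (bas R (lift ord0 ord0)).
  rewrite -(F_ti (rotation3 (pi / 2))); last by right; exists (pi / 2) => //; exact: rotation_quarter.
  have [-> _ _] := rotation_bas (pi / 2 : R).
  by rewrite cos_pihalf sin_pihalf scale0r scale1r sub0r -scaleN1r z1 z2; ring.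
have FE : forall u v, F u v = r1 * dot u v + r2 * (dot (bas R ord_max) u * dot (bas R ord_max) v).
  apply: ext => //.
  - by move=> v a x y; rewrite (lin_dotl _ a) (lin_dotr _ a); ring.
  - by move=> u a x y; rewrite !(lin_dotr _ a); ring.
  move=> p q; rewrite !dot_bas /r2 /r1 /frame2 -!/(F _ _).
  have := refl ord0 p q; have := refl (lift ord0 ord0) p q; have := refl ord_max p q.
  have [->|[->|->]] := ord3_cases p; have [->|[->|->]] := ord3_cases q;
    rewrite /=; lra.
have := FE (S^T *m bas R i) (S^T *m bas R j).
by rewrite {1}/F !mulmxA SSt !mul1mx form2_bas dot_mul !dot_axis.
Qed.

End RotatedAxis.

(** * The symbol of the perturbation determines it *)

Lemma sum_ord3 (V : nmodType) (f : 'I_3 -> V) :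
  \sum_i f i = f ord0 + f (lift ord0 ord0) + f ord_max.
Proof.
rewrite !big_ord_recl big_ord0 addr0 addrA; congr (_ + f _); exact/val_inj.
Qed.

Section Algebra.
Variable R : realType.
Local Notation C := R[i].
Implicit Types (x y z a e : 'I_3 -> C).

Let i0 : 'I_3 := ord0.
Let i1 : 'I_3 := lift ord0 ord0.
Let i2 : 'I_3 := ord_max.

Definition cdot x y : C := \sum_i x i * y i.

Lemma cdotE x y : cdot x y = x i0 * y i0 + x i1 * y i1 + x i2 * y i2.
Proof. exact: sum_ord3. Qed.

Definition cross x y : 'I_3 -> C := fun i => nth 0
  [:: x i1 * y i2 - x i2 * y i1; x i2 * y i0 - x i0 * y i2; x i0 * y i1 - x i1 * y i0] i.

Lemma cdot_crossl x y : cdot x (cross x y) = 0.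
Proof. by rewrite cdotE /cross /=; ring. Qed.

Lemma cdot_crossr x y : cdot (cross x y) y = 0.
Proof. by rewrite cdotE /cross /=; ring. Qed.

Lemma cdotC x y : cdot x y = cdot y x.
Proof. by rewrite !cdotE; ring. Qed.

Lemma cdot_cross x y z : cdot (cross x y) (cross x z) =
  cdot x x * cdot y z - cdot x y * cdot x z.
Proof. by rewrite !cdotE /cross /=; ring. Qed.

Lemma cdot_cross_swap x y z : cdot y (cross x z) = - cdot (cross x y) z.
Proof. by rewrite !cdotE /cross /=; ring. Qed.

(** The square of the triple product is the Gram determinant: it eliminates the
    triple product, which scalar products determine only up to sign. *)
Lemma triple_sqr x y z : cdot (cross x y) z ^+ 2 =
  cdot x x * (cdot y y * cdot z z - cdot y z ^+ 2)
  - cdot x y * (cdot x y * cdot z z - cdot y z * cdot x z)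
  + cdot x z * (cdot x y * cdot y z - cdot y y * cdot x z).
Proof. by rewrite !cdotE /cross /=; ring. Qed.

Lemma cdot_comb (s t : C) x y z :
  cdot (fun i => s * x i + t * y i) z = s * cdot x z + t * cdot y z.
Proof. by rewrite !cdotE; ring. Qed.

Lemma cdot_combr (s t : C) x y z :
  cdot z (fun i => s * x i + t * y i) = s * cdot z x + t * cdot z y.
Proof. by rewrite !cdotE; ring. Qed.

Lemma cdot_comb_sqr (s t : C) x y :
  cdot (fun i => s * x i + t * y i) (fun i => s * x i + t * y i) =
  s ^+ 2 * cdot x x + 2 * s * t * cdot x y + t ^+ 2 * cdot y y.
Proof. by rewrite !cdotE; ring. Qed.

(** Splitting [y] into two complex wave vectors of prescribed square and
    prescribed component along [e]: the correction orthogonal to [y] has two free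
    components, along the projection of [e] and along [cross e y], and the square
    root of a complex number fixes the second one. *)
Lemma split_wave_vector e y (s q : C) : cdot e e = 1 ->
  cdot y y - cdot e y ^+ 2 != 0 ->
  exists z z', [/\ forall i, z i + z' i = y i, cdot z z = q /\ cdot z' z' = q,
    cdot e z = cdot e y / 2 + s & cdot e z' = cdot e y / 2 - s].
Proof.
set yy := cdot y y; set ey := cdot e y; set W := _ - _ => ee W0.
pose k := q - yy / 4; pose tau := sqrtc ((k - s ^+ 2 * yy / W) / W).
pose m i := yy * e i + (- ey) * y i; pose w := cross e y.
pose eta i := (s / W) * m i + tau * w i.
have ww : cdot w w = W by rewrite /w cdot_cross ee mul1r /W expr2.
have we : cdot e w = 0 by exact: cdot_crossl.
have wy : cdot w y = 0 by exact: cdot_crossr.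
have em : cdot e m = W by rewrite /m cdot_combr ee -/ey /W; ring.
have my : cdot m y = 0 by rewrite /m cdot_comb -/yy -/ey; ring.
have mm : cdot m m = yy * W.
  by rewrite {2}/m cdot_combr my cdotC em; ring.
have mw : cdot m w = 0.
  by rewrite /m cdot_comb we cdotC wy; ring.
have eta_y : cdot eta y = 0 by rewrite /eta cdot_comb my wy; ring.
have eta_e : cdot e eta = s by rewrite /eta cdot_combr em we; field.
have eta_eta : cdot eta eta = k.
  have e1 : cdot eta m = s * yy.
    by rewrite /eta cdot_comb mm [cdot w m]cdotC mw; field.
  have e2 : cdot eta w = tau * W.
    by rewrite /eta cdot_comb mw ww; ring.
  rewrite {2}/eta cdot_combr e1 e2.
  have tt : tau ^+ 2 = (k - s ^+ 2 * yy / W) / W by exact: sqr_sqrtc.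
  have -> : s / W * (s * yy) + tau * (tau * W) = s ^+ 2 * yy / W + tau ^+ 2 * W by ring.
  by rewrite tt; field.
exists (fun i => 2^-1 * y i + 1 * eta i), (fun i => 2^-1 * y i + (-1) * eta i); split.
- by move=> i; field.
- rewrite !(cdot_comb_sqr _ _ y eta) [cdot y eta]cdotC eta_y eta_eta -/yy /k.
  by split; field.
- by rewrite (cdot_combr _ _ y eta) eta_e -/ey; field.
- by rewrite (cdot_combr _ _ y eta) eta_e -/ey; field.
Qed.

(** The bilinear symbol of the perturbation on a pair of waves with wave vectors
    [z], [z'] and polarizations [a], [a']. *)
Definition symbol (C1 C2 C3 C4 C5 r1 r2 w2 : C) e z a z' a' : C :=
  C1 * (cdot z a * cdot z' a')
  + C2 * (cdot z z' * cdot a a' + cdot z a' * cdot a z')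
  + C3 * (cdot e z * cdot e a * cdot z' a' + cdot z a * cdot e z' * cdot e a')
  + C4 * (cdot e z * cdot e z' * cdot a a' + cdot e z * cdot e a' * cdot a z'
          + cdot e a * cdot e z' * cdot z a' + cdot e a * cdot e a' * cdot z z')
  + C5 * (cdot e z * cdot e a * cdot e z' * cdot e a')
  - w2 * (r1 * cdot a a' + r2 * (cdot e a * cdot e a')).

(** The isotropic system at frequency [w] for a plane wave, each derivative being
    replaced by a factor [z]. *)
Definition admissible (lam mu rho w : R) z a : Prop := forall j,
  mu%:C * cdot z z * a j + (lam + mu)%:C * cdot a z * z j + (w ^+ 2 * rho)%:C * a j = 0.

Section Symbol.
Variables (lam mu rho : R) (e : 'I_3 -> C) (y : 'I_3 -> C) (C1 C2 C3 C4 C5 r1 r2 : C).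
Hypotheses (mu0 : 0 < mu) (lam0 : 0 < lam + 2 * mu) (rho0 : 0 < rho).
Hypotheses (ee : cdot e e = 1) (ey : cdot y y - cdot e y ^+ 2 != 0) (yy : cdot y y != 0).

Definition null_symbol w := forall z a z' a', (forall i, z i + z' i = y i) ->
  admissible lam mu rho w z a -> admissible lam mu rho w z' a' ->
  symbol C1 C2 C3 C4 C5 r1 r2 (w ^+ 2)%:C e z a z' a' = 0.

Let qS w : C := (- (w ^+ 2 * rho / mu))%:C.
Let qP w : C := (- (w ^+ 2 * rho / (lam + 2 * mu)))%:C.

Lemma admissible_S w z a : cdot z z = qS w -> cdot a z = 0 -> admissible lam mu rho w z a.
Proof.
move=> zz az j; rewrite zz az mulr0 mul0r addr0 -mulrDl.
have -> : mu%:C * qS w + (w ^+ 2 * rho)%:C = 0; last by rewrite mul0r.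
have h : mu * - (w ^+ 2 * rho / mu) + w ^+ 2 * rho = 0.
  by field; rewrite gt_eqF.
by rewrite /qS -rmorphM -rmorphD h rmorph0.
Qed.

Lemma admissible_P w z : cdot z z = qP w -> admissible lam mu rho w z z.
Proof.
move=> zz j; rewrite zz.
have -> : mu%:C * qP w * z j + (lam + mu)%:C * qP w * z j + (w ^+ 2 * rho)%:C * z j =
    ((mu + (lam + mu)) * - (w ^+ 2 * rho / (lam + 2 * mu)) + w ^+ 2 * rho)%:C * z j.
  by rewrite /qP !rmorphD !rmorphM !rmorphD /=; ring.
have h : (mu + (lam + mu)) * - (w ^+ 2 * rho / (lam + 2 * mu)) + w ^+ 2 * rho = 0.
  by field; rewrite gt_eqF.
by rewrite h rmorph0 mul0r.
Qed.

Let E := cdot e y / 2.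

Lemma cdot_split z z' q : (forall i, z i + z' i = y i) -> cdot z z = q -> cdot z' z' = q ->
  cdot z z' = cdot y y / 2 - q.
Proof.
move=> zz' zq z'q; have : cdot y y = cdot z z + cdot z' z' + 2 * cdot z z'.
  by rewrite !cdotE -!zz'; ring.
by move=> ->; rewrite zq z'q; field.
Qed.

(** The polarizations [cross e z] and [cross e z'] are orthogonal to [e] and to their
    wave vectors, so that only [C2], [C4] and [r1] are seen. *)
Lemma symbol_SH w s : null_symbol w -> let q := qS w in let p := cdot y y / 2 - q in
  let sg := s ^+ 2 in
  C2 * (2 * p ^+ 2 - q ^+ 2 - 3 * p * (E ^+ 2 - sg) + 2 * q * (E ^+ 2 + sg))
  + C4 * ((E ^+ 2 - sg) * (p - E ^+ 2 + sg))
  - (w ^+ 2)%:C * r1 * (p - E ^+ 2 + sg) = 0.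
Proof.
move=> nul q p sg; have [z [z' [zz' [zq z'q] ez ez']]] := split_wave_vector s q ee ey.
have pE : cdot z z' = p by exact: cdot_split.
have := nul z (cross e z) z' (cross e z') zz'
  (admissible_S zq (cdot_crossr _ _)) (admissible_S z'q (cdot_crossr _ _)).
have D2 := triple_sqr e z z'; rewrite ee zq z'q pE ez ez' -/E in D2.
rewrite /symbol !cdot_crossl !cdot_cross ![cdot _ (cross e _)]cdotC !cdot_crossr ee.
rewrite [cdot (cross e z') z]cdotC cdot_cross_swap pE ez ez' -/E.
set D := cdot _ _ in D2 *.
rewrite -[X in _ = X -> _]/0 => <-; rewrite [RHS](_ : _ = C2 * (p * (1 * p - (E + s) * (E - s)) - D ^+ 2)
   + C4 * ((E + s) * (E - s) * (1 * p - (E + s) * (E - s)))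
   - (w ^+ 2)%:C * (r1 * (1 * p - (E + s) * (E - s)))); last by ring.
by rewrite D2 /sg; ring.
Qed.

(** The polarizations are [e] projected orthogonally to [z], respectively [z'], and
    scaled by [qS w] to avoid dividing by it. *)
Lemma symbol_SV w s : C2 = 0 -> C4 = 0 -> r1 = 0 -> null_symbol w ->
  (C5 * (E ^+ 2 - s ^+ 2) - (w ^+ 2)%:C * r2) *
  ((qS w - (E + s) ^+ 2) * (qS w - (E - s) ^+ 2)) = 0.
Proof.
move=> c2 c4 rr nul; have [z [z' [zz' [zq z'q] ez ez']]] := split_wave_vector s (qS w) ee ey.
pose a i := qS w * e i + (- (E + s)) * z i; pose a' i := qS w * e i + (- (E - s)) * z' i.
have az : cdot a z = 0 by rewrite /a cdot_comb zq ez -/E; ring.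
have az' : cdot a' z' = 0 by rewrite /a' cdot_comb z'q ez' -/E; ring.
have := nul z a z' a' zz' (admissible_S zq az) (admissible_S z'q az').
rewrite /symbol c2 c4 rr [cdot z a]cdotC az [cdot z' a']cdotC az' ez ez' -/E.
have -> : cdot e a = qS w - (E + s) ^+ 2 by rewrite /a cdot_combr ee ez -/E; ring.
have -> : cdot e a' = qS w - (E - s) ^+ 2 by rewrite /a' cdot_combr ee ez' -/E; ring.
by move=> <-; ring.
Qed.

(** The polarization of a pressure wave is its wave vector, so that [cdot z a] no
    longer vanishes and [C1] and [C3] are seen. *)
Lemma symbol_PP w s : C2 = 0 -> C4 = 0 -> C5 = 0 -> r1 = 0 -> r2 = 0 -> null_symbol w ->
  C1 * qP w ^+ 2 + C3 * (2 * qP w * (E ^+ 2 + s ^+ 2)) = 0.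
Proof.
move=> c2 c4 c5 rr1 rr2 nul.
have [z [z' [zz' [zq z'q] ez ez']]] := split_wave_vector s (qP w) ee ey.
have := nul z z z' z' zz' (admissible_P zq) (admissible_P z'q).
rewrite /symbol c2 c4 c5 rr1 rr2 zq z'q ez ez' -/E.
by move=> <-; ring.
Qed.

Variables (w1 w2 : R).
Hypotheses (w1_gt0 : 0 < w1) (w2_gt0 : 0 < w2) (w12 : w1 <> w2).
Hypotheses (nul1 : null_symbol w1) (nul2 : null_symbol w2).
(* True when [y] is purely imaginary and the axis real. It is what keeps the
   squared length of the projected polarizations of [symbol_SV] from vanishing. *)
Hypothesis E_im : complex.Re (cdot e y) = 0.

(** Each family of waves gives a polynomial identity in the free parameter [s], read
    off at two or three values of [s]. *)
Lemma symbol_injective :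
  [/\ C1 = 0, C2 = 0, C3 = 0, C4 = 0 & C5 = 0] /\ r1 = 0 /\ r2 = 0.
Proof.
have nz (n : nat) : n.+1%:R != 0 :> C by rewrite pnatr_eq0.
have h10 := symbol_SH 0 nul1; have h11 := symbol_SH 1 nul1; have h12 := symbol_SH 2 nul1.
have h20 := symbol_SH 0 nul2; have h21 := symbol_SH 1 nul2.
cbv zeta in h10, h11, h12, h20, h21.
(* In [s ^ 2] the relation [symbol_SH] has degree two, with leading coefficient
   [- C4]. The weights 1, -4, 3 at [s ^ 2 = 4, 1, 0] annihilate polynomials of
   degree at most one. *)
have c4 : C4 = 0.
  apply/eqP; rewrite -(mulrI_eq0 _ (@mulfI _ 12 _)) ?nz//; apply/eqP.
  rewrite -[RHS](_ : - (0 - 4 * 0 + 3 * 0) = 0); last by ring.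
  by rewrite -{1}h12 -{1}h11 -{1}h10; ring.
(* The coefficient of [s ^ 2] once [C4 = 0]. Since [qS w] is proportional to
   [w ^ 2], the relations at two frequencies separate [C2] from [r1]. *)
have lin (w : R) : null_symbol w ->
    C2 * (3 * (cdot y y / 2) - qS w) = (w ^+ 2)%:C * r1.
  move=> nul; have h0 := symbol_SH 0 nul; have h1 := symbol_SH 1 nul; cbv zeta in h0, h1.
  apply/eqP; rewrite -subr_eq0; apply/eqP.
  rewrite -[RHS](_ : 0 - 0 = 0); last by ring.
  by rewrite -{1}h1 -{1}h0 c4; ring.
have l1 := lin _ nul1; have l2 := lin _ nul2.
have w12n : (w1 ^+ 2 - w2 ^+ 2)%:C != 0.
  rewrite -[X in _ != X](rmorph0 (real_complex R)) (inj_eq (@complexI R)) subr_eq0.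
  by rewrite eqrXn2 ?ltW//; exact/eqP.
have c2 : C2 = 0.
  have : C2 * (3 * (cdot y y / 2) * (w1 ^+ 2 - w2 ^+ 2)%:C) = 0.
    have qq : (w1 ^+ 2)%:C * qS w2 = (w2 ^+ 2)%:C * qS w1.
      by rewrite /qS -!rmorphM; congr (_%:C); ring.
    transitivity ((w1 ^+ 2)%:C * (C2 * (3 * (cdot y y / 2) - qS w2))
      - (w2 ^+ 2)%:C * (C2 * (3 * (cdot y y / 2) - qS w1))
      + C2 * ((w1 ^+ 2)%:C * qS w2 - (w2 ^+ 2)%:C * qS w1)).
      by rewrite rmorphB; ring.
    by rewrite l1 l2 qq; ring.
  move/eqP; rewrite mulf_eq0 => /orP[/eqP//|].
  by rewrite !mulf_eq0 (negbTE w12n) (negbTE yy) invr_eq0 !(negbTE (nz _)).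
have w1n : (w1 ^+ 2)%:C != 0.
  by rewrite -[X in _ != X](rmorph0 (real_complex R)) (inj_eq (@complexI R)) expf_neq0// gt_eqF.
have rr1 : r1 = 0.
  by move: l1; rewrite c2 mul0r => /esym/eqP; rewrite mulf_eq0 (negbTE w1n) => /eqP.
(* For real nonzero [s] the square [(E + s) ^ 2] is not a negative number, as [E] is
   purely imaginary, whereas [qS w1] is one: the polarizations do not
   degenerate. *)
have sv s : s != 0 -> C5 * (E ^+ 2 - s%:C ^+ 2) = (w1 ^+ 2)%:C * r2.
  move=> s0; have /eqP := symbol_SV s%:C c2 c4 rr1 nul1.
  rewrite mulf_eq0 subr_eq0 => /orP[/eqP//|].
  have q0 : - (w1 ^+ 2 * rho / mu) < 0.
    by rewrite oppr_lt0 divr_gt0// mulr_gt0// exprn_gt0.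
  have [t Et] : exists t, E = 0 +i* t.
    exists (complex.Im E); apply: complexP => //=.
    rewrite /E (_ : 2^-1 = (2^-1 : R)%:C); last by rewrite fmorphV rmorph_nat.
    by rewrite cReM E_im /=; ring.
  have key (s' : R) : s' != 0 -> qS w1 - (E + s'%:C) ^+ 2 != 0.
    move=> s'0; rewrite subr_eq0 Et; apply/eqP => H.
    have := congr1 (@complex.Re R) H; have := congr1 (@complex.Im R) H.
    rewrite expr2 !cReImE /= => hI hR.
    have st : s' * t = 0 by lra.
    move/eqP: st; rewrite mulf_eq0 (negbTE s'0) => /eqP t0.
    have := sqr_ge0 s'; move: hR q0; rewrite t0 expr2; lra.
  rewrite mulf_eq0 (negbTE (key s s0)) /=.
  have := key (- s); rewrite oppr_eq0 rmorphN => /(_ s0)/negbTE ->; by [].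
have c5 : C5 = 0.
  have s1 := sv 1 (oner_neq0 _); have s2 : C5 * (E ^+ 2 - 2%:C ^+ 2) = (w1 ^+ 2)%:C * r2.
    by apply: sv; rewrite pnatr_eq0.
  apply/eqP; rewrite -(mulrI_eq0 _ (@mulfI _ 3 _)) ?nz//; apply/eqP.
  rewrite -[RHS](subrr ((w1 ^+ 2)%:C * r2)) -{1}s1 -s2 rmorph1 rmorph_nat; ring.
have rr2 : r2 = 0.
  have /esym/eqP := sv 1 (oner_neq0 _).
  by rewrite c5 mul0r mulf_eq0 (negbTE w1n) => /eqP.
have qn : qP w1 != 0.
  rewrite /qP -[X in _ != X](rmorph0 (real_complex R)) (inj_eq (@complexI R)).
  by rewrite oppr_eq0 gt_eqF// divr_gt0// mulr_gt0// exprn_gt0.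
have p0 := symbol_PP 0 c2 c4 c5 rr1 rr2 nul1.
have p1 := symbol_PP 1 c2 c4 c5 rr1 rr2 nul1.
have c3 : C3 = 0.
  have /eqP : C3 * (2 * qP w1) = 0.
    by rewrite -[RHS](subrr 0) -{1}p1 -p0; ring.
  by rewrite !mulf_eq0 (negbTE qn) (negbTE (nz 1%N)) !orbF => /eqP.
have c1 : C1 = 0.
  move/eqP: p0; rewrite c3 mul0r addr0 mulf_eq0 expf_eq0 (negbTE qn) andbF orbF.
  by move/eqP.
by [].
Qed.

End Symbol.
End Algebra.

Section Contraction.
Variable R : realType.
Implicit Types z a : 'I_3 -> R[i].

(** The sums over four indices factor into scalar products. *)
Lemma symbol_contraction (C1 C2 C3 C4 C5 r1 r2 W : R[i]) (e z a z' a' : 'I_3 -> R[i])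
    (D := fun i j => (i == j :> 'I_3)%:R : R[i]) :
  symbol C1 C2 C3 C4 C5 r1 r2 W e z a z' a' =
  \sum_i \sum_j \sum_k \sum_l (z i * a j * z' k * a' l) *
    (C1 * (D i j * D k l) + C2 * (D i k * D j l + D i l * D j k) +
     C3 * (e i * e j * D k l + D i j * e k * e l) +
     C4 * (e i * e k * D j l + e i * e l * D j k + e j * e k * D i l + e j * e l * D i k) +
     C5 * (e i * e j * e k * e l))
  - W * \sum_i \sum_k (a i * a' k) * (r1 * D i k + r2 * (e i * e k)).
Proof.
rewrite /symbol !cdotE !sum_ord3 /D !eqxx.
pose n01 := erefl : (ord0 == lift ord0 ord0 :> 'I_3) = false.
pose n02 := erefl : (ord0 == ord_max :> 'I_3) = false.
pose n12 := erefl : (lift ord0 ord0 == ord_max :> 'I_3) = false.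
pose n10 := erefl : (lift ord0 ord0 == ord0 :> 'I_3) = false.
pose n20 := erefl : (ord_max == ord0 :> 'I_3) = false.
pose n21 := erefl : (ord_max == lift ord0 ord0 :> 'I_3) = false.
rewrite n01 n02 n12 n10 n20 n21 -[nat_of_bool false]/0%N -[nat_of_bool true]/1%N.
ring.
Qed.

End Contraction.

(** * From vanishing data to vanishing perturbations *)

Section Identity.
Variables (R : realType) (Om : set (R * R * R)).
Hypotheses (oOm : open Om) (bOm : bounded_set Om).
Let mOm : measurable Om := open_measurable3 oOm.
Variables (dC : tensor4 R) (drho : tensor2 R).
Hypothesis idC : forall i j k l, rint Om (dC i j k l).
Hypothesis idrho : forall i k, rint Om (drho i k).
Variables (lam mu rho w : R) (L : vfield R -> vfield R -> R[i]).
Hypothesis L_DN : linearized_DN Om lam mu rho w dC drho L.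
Hypothesis L0 : zero_operator Om L.

Lemma admissible_lame z a : admissible lam mu rho w z a ->
  lame_eq Om lam mu rho w (wfield a z) (wgrad a z).
Proof. by move=> az; apply: wfield_lame. Qed.

(** The product of the two waves is the exponential of [y], so that the bilinear form
    of the linearized map becomes a combination of Fourier coefficients. *)
Lemma wave_pair_identity (y z a z' a' : 'I_3 -> R[i]) : (forall i, z i + z' i = y i) ->
  admissible lam mu rho w z a -> admissible lam mu rho w z' a' ->
  \sum_i \sum_j \sum_k \sum_l (z i * a j * z' k * a' l) * hat Om y (dC i j k l)
  - (w ^+ 2)%:C * \sum_i \sum_k (a i * a' k) * hat Om y (drho i k) = 0.
Proof.
move=> zz' az az'; have yE : y = fun i => z i + z' i by apply/funext => i; rewrite zz'.
have [_ Lrep] := L_DN.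
have := Lrep (wfield a z) (wfield a' z') _ _ _ _ (wfield_H1 oOm bOm a z)
  (admissible_lame az) (wfield_trace Om a z) (wfield_H1 oOm bOm a' z')
  (admissible_lame az') (wfield_trace Om a' z').
rewrite L0; [|exact: wfield_Hhalf..] => h; rewrite [RHS]h.
pose FC i j k l x := (z i * a j * z' k * a' l) * ((dC i j k l x)%:C * pw y x).
pose Fr i k x := (a i * a' k) * ((drho i k x)%:C * pw y x).
have hC i j k l : cintegrable Om (fun x => (dC i j k l x)%:C * pw y x) by exact: hatI.
have hr i k : cintegrable Om (fun x => (drho i k x)%:C * pw y x) by exact: hatI.
have iC i j k l : cintegrable Om (FC i j k l) by exact: cintegrableZ.
have ir i k : cintegrable Om (Fr i k) by exact: cintegrableZ.
have iC1 i j k : cintegrable Om (fun x => \sum_l FC i j k l x) by exact: cintegrable_sum.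
have iC2 i j : cintegrable Om (fun x => \sum_k \sum_l FC i j k l x).
  exact: cintegrable_sum.
have iC3 i : cintegrable Om (fun x => \sum_j \sum_k \sum_l FC i j k l x).
  exact: cintegrable_sum.
have iC4 : cintegrable Om (fun x => \sum_i \sum_j \sum_k \sum_l FC i j k l x).
  exact: cintegrable_sum.
have ir1 i : cintegrable Om (fun x => \sum_k Fr i k x) by exact: cintegrable_sum.
have ir2 : cintegrable Om (fun x => \sum_i \sum_k Fr i k x) by exact: cintegrable_sum.
rewrite [RHS](eq_cint (g := fun x => \sum_i \sum_j \sum_k \sum_l FC i j k l x
    + (- (w ^+ 2)%:C) * \sum_i \sum_k Fr i k x)); last first.
  move=> x _; rewrite mulNr; congr (_ - _ * _).
    by do 4! (apply: eq_bigr => ? _); rewrite /FC yE pwD /wgrad /wave; ring.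
  by do 2! (apply: eq_bigr => ? _); rewrite /Fr yE pwD /wfield /wave; ring.
rewrite (cintD mOm iC4 (cintegrableZ mOm _ ir2)).
rewrite (cint_sum mOm _ iC3) (cintZ mOm _ ir2) mulNr; congr (_ - _ * _).
  apply: eq_bigr => i _; rewrite (cint_sum mOm _ (iC2 i)); apply: eq_bigr => j _.
  rewrite (cint_sum mOm _ (iC1 i j)); apply: eq_bigr => k _.
  rewrite (cint_sum mOm _ (iC i j k)); apply: eq_bigr => l _.
  exact/esym/(cintZ mOm _ (hC i j k l)).
rewrite (cint_sum mOm _ ir1); apply: eq_bigr => i _.
rewrite (cint_sum mOm _ (ir i)); apply: eq_bigr => k _.
exact/esym/(cintZ mOm _ (hr i k)).
Qed.

End Identity.

Section Genericity.
Variables (R : realType) (e : 'I_3 -> R).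
Hypothesis ee : \sum_i e i ^+ 2 = 1.

(** For a unit vector [e], the squared distance from [xi] to the line it spans. *)
Definition axis_dist2 (xi : 'I_3 -> R) : R :=
  \sum_i xi i ^+ 2 - (\sum_i e i * xi i) ^+ 2.

Lemma axis_dist2E xi :
  axis_dist2 xi = \sum_i (xi i - (\sum_j e j * xi j) * e i) ^+ 2.
Proof.
rewrite /axis_dist2; set s := \sum_j e j * xi j.
have E : \sum_i (xi i - s * e i) ^+ 2 =
    \sum_i xi i ^+ 2 - 2 * s * \sum_i e i * xi i + s ^+ 2 * \sum_i e i ^+ 2.
  by rewrite !big_ord_recl !big_ord0; ring.
by rewrite E ee -/s; ring.
Qed.

Lemma axis_dist2_ge0 xi : 0 <= axis_dist2 xi.
Proof. by rewrite axis_dist2E sumr_ge0// => i _; rewrite sqr_ge0. Qed.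

(** On the line spanned by [e], moving by [t v] changes the squared distance from
    zero to [t ^ 2] times that of [v]; some basis vector is off the line. *)
Lemma axis_dist2_perturb xi : axis_dist2 xi = 0 ->
  exists v, forall t, t != 0 -> axis_dist2 (fun k => xi k + t * v k) != 0.
Proof.
move=> /eqP; rewrite axis_dist2E psumr_eq0 => [/allP xi0|i _]; last exact: sqr_ge0.
set s := \sum_j e j * xi j in xi0.
have xiE i : xi i = s * e i.
  have := xi0 i (mem_index_enum i); rewrite sqrf_eq0 => /eqP; lra.
have [v v0] : exists v, axis_dist2 v != 0.
  apply: contrapT => /forallNP h.
  pose d (k i : 'I_3) : R := (i == k)%:R.
  have hd k : e k ^+ 2 = 1.
    have := h (d k); rewrite /axis_dist2 => /negP; rewrite negbK subr_eq0 => /eqP.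
    rewrite (bigD1 k)//= [X in _ = X ^+ 2](bigD1 k)//= /d eqxx expr1n mulr1.
    by rewrite !big1 ?addr0// => i /negbTE ->; rewrite ?mulr0 ?expr0n.
  move: ee; rewrite (eq_bigr (fun=> 1)) => [|i _]; last exact: hd.
  by rewrite !big_ord_recl big_ord0; lra.
exists v => t t0; rewrite (_ : axis_dist2 _ = t ^+ 2 * axis_dist2 v).
  by rewrite mulf_neq0 ?expf_neq0.
rewrite /axis_dist2.
have -> : \sum_i (xi i + t * v i) ^+ 2 =
    s ^+ 2 * \sum_i e i ^+ 2 + 2 * s * t * \sum_i e i * v i + t ^+ 2 * \sum_i v i ^+ 2.
  by rewrite !big_ord_recl !big_ord0 !xiE; ring.
have -> : \sum_i e i * (xi i + t * v i) = s * \sum_i e i ^+ 2 + t * \sum_i e i * v i.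
  by rewrite !big_ord_recl !big_ord0 !xiE; ring.
by rewrite ee; ring.
Qed.

End Genericity.

Section Assembly.
Variables (R : realType) (Om : set (R * R * R)) (e : 'cV[R]_3).
Hypotheses (oOm : open Om) (bOm : bounded_set Om) (e_unit : \sum_i e i 0 ^+ 2 = 1).
Let mOm : measurable Om := open_measurable3 oOm.
Let ec (i : 'I_3) : R[i] := (e i 0)%:C.

Lemma dot_bas_axis i : dot e (bas R i) = e i 0.
Proof. by rewrite -(sum_bas i (fun j => e j 0)); apply: eq_bigr => j _; rewrite mulrC. Qed.

Section Hat.
Variables (c1 c2 c3 c4 c5 : R * R * R -> R) (r1 r2 : R * R * R -> R).
Hypotheses (ic1 : rint Om c1) (ic2 : rint Om c2) (ic3 : rint Om c3) (ic4 : rint Om c4)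
  (ic5 : rint Om c5) (ir1 : rint Om r1) (ir2 : rint Om r2).
Variable y : 'I_3 -> R[i].
Let D (i j : 'I_3) : R[i] := (i == j)%:R.

(** The axis is constant, so the Fourier transform acts on the coefficient functions
    alone. *)
Lemma hat_ti_form f i j k l : rint Om f ->
  {ae leb3 R, forall x, Om x -> f x =
    ti_form (c1 x) (c2 x) (c3 x) (c4 x) (c5 x) e (bas R i) (bas R j) (bas R k) (bas R l)} ->
  hat Om y f = hat Om y c1 * (D i j * D k l) + hat Om y c2 * (D i k * D j l + D i l * D j k) +
     hat Om y c3 * (ec i * ec j * D k l + D i j * ec k * ec l) +
     hat Om y c4 * (ec i * ec k * D j l + ec i * ec l * D j k + ec j * ec k * D i l +
        ec j * ec l * D i k) +
     hat Om y c5 * (ec i * ec j * ec k * ec l).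
Proof.
move=> rf fE; pose d (i j : 'I_3) : R := (i == j)%:R.
have dD p q : D p q = (d p q)%:C by rewrite /D /d rmorph_nat.
pose g x := c1 x * (d i j * d k l) + c2 x * (d i k * d j l + d i l * d j k) +
     c3 x * (e i 0 * e j 0 * d k l + d i j * e k 0 * e l 0) +
     c4 x * (e i 0 * e k 0 * d j l + e i 0 * e l 0 * d j k + e j 0 * e k 0 * d i l +
        e j 0 * e l 0 * d i k) + c5 x * (e i 0 * e j 0 * e k 0 * e l 0).
have ig : rint Om g by rewrite /g; do 4! (apply: rintD => //; last exact: rintZr); exact: rintZr.
rewrite (hat_ae oOm bOm y rf ig); last first.
  by apply: (ae3_imp fE) => x {}fE Ox; rewrite fE// /ti_form !dot_bas !dot_bas_axis.
rewrite /g.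
rewrite (hatD oOm bOm); [|by do 3! (apply: rintD => //; last exact: rintZr); exact: rintZr|exact: rintZr].
rewrite (hatD oOm bOm); [|by do 2! (apply: rintD => //; last exact: rintZr); exact: rintZr|exact: rintZr].
rewrite (hatD oOm bOm); [|by do 1! (apply: rintD => //; last exact: rintZr); exact: rintZr|exact: rintZr].
rewrite (hatD oOm bOm); [|exact: rintZr..].
by rewrite !(hatZr oOm bOm)// !rmorphD !rmorphM /= !dD.
Qed.

Lemma hat_ti_density f i k : rint Om f ->
  {ae leb3 R, forall x, Om x -> f x = r1 x * dot (bas R i) (bas R k) +
    r2 x * (dot e (bas R i) * dot e (bas R k))} ->
  hat Om y f = hat Om y r1 * D i k + hat Om y r2 * (ec i * ec k).
Proof.
move=> rf fE; pose g x := r1 x * (i == k)%:R + r2 x * (e i 0 * e k 0).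
have ig : rint Om g by apply: rintD => //; exact: rintZr.
rewrite (hat_ae oOm bOm y rf ig); last first.
  by apply: (ae3_imp fE) => x {}fE Ox; rewrite fE// !dot_bas !dot_bas_axis.
rewrite /g (hatD oOm bOm); [|exact: rintZr..].
by rewrite !(hatZr oOm bOm)// !rmorphM /= rmorph_nat.
Qed.

End Hat.

(** The hypothesis [ey] of [symbol_injective] means that [xi] is off the axis, and the
    hypothesis [yy] that it is nonzero. *)
Lemma imaginary_vector (xi : 'I_3 -> R) (y := fun k => 0 +i* xi k) :
  [/\ cdot ec ec = 1, cdot y y - cdot ec y ^+ 2 = (- axis_dist2 (fun i => e i 0) xi)%:C,
      cdot y y = (- \sum_i xi i ^+ 2)%:C & complex.Re (cdot ec y) = 0].
Proof.
have ecy : cdot ec y = 0 +i* \sum_i e i 0 * xi i.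
  by rewrite cdotE /ec /y sum_ord3; apply: complexP; rewrite !cReImE /=; ring.
have yy : cdot y y = (- \sum_i xi i ^+ 2)%:C.
  by rewrite cdotE /y sum_ord3; apply: complexP; rewrite !cReImE /=; ring.
split=> //; last by rewrite ecy.
- rewrite /cdot -[RHS](rmorph1 (real_complex R)) -e_unit rmorph_sum.
  by apply: eq_bigr => i _; rewrite rmorphXn expr2.
- rewrite yy ecy /axis_dist2; apply: complexP; rewrite !cReImE /=; ring.
Qed.

End Assembly.

Section MainLemmas.
Variables (R : realType) (Om : set (R * R * R)) (e : 'cV[R]_3).
Hypotheses (oOm : open Om) (bOm : bounded_set Om) (e_unit : \sum_i e i 0 ^+ 2 = 1).
Let mOm : measurable Om := open_measurable3 oOm.
Variables (lam0 mu0 rho0 w1 w2 : R) (dC : tensor4 R) (drho : tensor2 R)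
    (Lam1 Lam2 : vfield R -> vfield R -> R[i]).
Hypotheses (mu0_gt0 : 0 < mu0) (lam0_mu0 : 0 < 3 * lam0 + 2 * mu0)
    (rho0_gt0 : 0 < rho0) (w1_gt0 : 0 < w1) (w2_gt0 : 0 < w2) (w12 : w1 <> w2).
Hypothesis idC : forall i j k l, rint Om (dC i j k l).
Hypothesis idrho : forall i k, rint Om (drho i k).
Hypotheses (Lam1_DN : linearized_DN Om lam0 mu0 rho0 w1 dC drho Lam1)
    (Lam2_DN : linearized_DN Om lam0 mu0 rho0 w2 dC drho Lam2)
    (Lam1_0 : zero_operator Om Lam1) (Lam2_0 : zero_operator Om Lam2).
Variables (c1 c2 c3 c4 c5 : R * R * R -> R) (r1 r2 : R * R * R -> R).
Hypotheses (ic1 : rint Om c1) (ic2 : rint Om c2) (ic3 : rint Om c3) (ic4 : rint Om c4)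
  (ic5 : rint Om c5) (ir1 : rint Om r1) (ir2 : rint Om r2).
Hypothesis dC_form : {ae leb3 R, forall x, Om x -> forall i j k l, dC i j k l x =
    ti_form (c1 x) (c2 x) (c3 x) (c4 x) (c5 x) e (bas R i) (bas R j) (bas R k) (bas R l)}.
Hypothesis drho_form : {ae leb3 R, forall x, Om x -> forall i k, drho i k x =
    r1 x * dot (bas R i) (bas R k) + r2 x * (dot e (bas R i) * dot e (bas R k))}.

Let ec (i : 'I_3) : R[i] := (e i 0)%:C.

(** Testing the linearized map on pairs of waves says exactly that the symbol whose
    coefficients are the Fourier coefficients is null. *)
Lemma null_symbol_hat y w L : linearized_DN Om lam0 mu0 rho0 w dC drho L ->
  zero_operator Om L ->
  null_symbol lam0 mu0 rho0 ec y (hat Om y c1) (hat Om y c2) (hat Om y c3)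
    (hat Om y c4) (hat Om y c5) (hat Om y r1) (hat Om y r2) w.
Proof.
move=> L_DN L_0 z a z' a' zz' az az'.
rewrite symbol_contraction -[RHS](wave_pair_identity oOm bOm idC idrho L_DN L_0 zz' az az').
congr (_ - _ * _).
  do 4! (apply: eq_bigr => ? _); congr (_ * _); apply/esym.
  apply: (hat_ti_form oOm bOm) => //.
  by apply: (ae3_imp dC_form) => x h Ox; exact: h.
do 2! (apply: eq_bigr => ? _); congr (_ * _); apply/esym.
apply: (hat_ti_density oOm bOm) => //.
by apply: (ae3_imp drho_form) => x h Ox; exact: h.
Qed.

Lemma fourier_coefficients0 (xi : 'I_3 -> R) (y := fun k => 0 +i* xi k) :
  axis_dist2 (fun i => e i 0) xi != 0 ->
  [/\ hat Om y c1 = 0, hat Om y c2 = 0, hat Om y c3 = 0, hat Om y c4 = 0 & hat Om y c5 = 0] /\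
  hat Om y r1 = 0 /\ hat Om y r2 = 0.
Proof.
move=> gxi; have [ee ey yy ey0] := imaginary_vector e_unit xi.
have Rn (r : R) : r != 0 -> r%:C != 0.
  by move=> r0; rewrite -(rmorph0 (real_complex R)) (inj_eq (@complexI R)).
have d_gt0 : 0 < axis_dist2 (fun i => e i 0) xi.
  by rewrite lt_neqAle eq_sym gxi axis_dist2_ge0.
apply: (@symbol_injective _ lam0 mu0 rho0 ec y _ _ _ _ _ _ _ mu0_gt0 _ rho0_gt0 ee _ _
   w1 w2 w1_gt0 w2_gt0 w12).
- by move: lam0_mu0 mu0_gt0; lra.
- by rewrite ey; apply: Rn; rewrite oppr_eq0.
- rewrite yy; apply: Rn; rewrite oppr_eq0 gt_eqF//.
  by move: d_gt0; rewrite /axis_dist2 subr_gt0; apply: le_lt_trans; exact: sqr_ge0.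
- exact: null_symbol_hat Lam1_DN Lam1_0.
- exact: null_symbol_hat Lam2_DN Lam2_0.
- exact: ey0.
Qed.

(** Frequencies on the axis, not reached by pairs of waves, are limits of
    frequencies off the axis. *)
Lemma coefficient_null f : rint Om f ->
  (forall xi, axis_dist2 (fun i => e i 0) xi != 0 -> hat Om (fun k => 0 +i* xi k) f = 0) ->
  {ae leb3 R, forall x, Om x -> f x = 0}.
Proof.
move=> rf f0; apply: (fourier_uniqueness mOm bOm rf) => xi.
have [d0|d0] := eqVneq (axis_dist2 (fun i => e i 0) xi) 0; last exact: f0.
have [v vP] := axis_dist2_perturb e_unit d0.
apply: (ipw_limit mOm rf (v := v)) => n; apply: f0; apply: vP.
by rewrite invr_eq0 pnatr_eq0.
Qed.

Lemma perturbation_null : {ae leb3 R, forall x, Om x ->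
    (forall i j k l, dC i j k l x = 0) /\ (forall i k, drho i k x = 0)}.
Proof.
have n1 := coefficient_null ic1 (fun xi h => let: conj (And5 h _ _ _ _) _ := fourier_coefficients0 h in h).
have n2 := coefficient_null ic2 (fun xi h => let: conj (And5 _ h _ _ _) _ := fourier_coefficients0 h in h).
have n3 := coefficient_null ic3 (fun xi h => let: conj (And5 _ _ h _ _) _ := fourier_coefficients0 h in h).
have n4 := coefficient_null ic4 (fun xi h => let: conj (And5 _ _ _ h _) _ := fourier_coefficients0 h in h).
have n5 := coefficient_null ic5 (fun xi h => let: conj (And5 _ _ _ _ h) _ := fourier_coefficients0 h in h).
have m1 := coefficient_null ir1 (fun xi h => (fourier_coefficients0 h).2.1).
have m2 := coefficient_null ir2 (fun xi h => (fourier_coefficients0 h).2.2).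
have n12 : {ae leb3 R, forall x, Om x -> c1 x = 0 /\ c2 x = 0}.
  by apply: (ae3_and n1 n2) => x h h' Ox; split; [exact: h|exact: h'].
have n34 : {ae leb3 R, forall x, Om x -> c3 x = 0 /\ c4 x = 0}.
  by apply: (ae3_and n3 n4) => x h h' Ox; split; [exact: h|exact: h'].
have n14 : {ae leb3 R, forall x, Om x -> [/\ c1 x = 0, c2 x = 0, c3 x = 0 & c4 x = 0]}.
  by apply: (ae3_and n12 n34) => x h h' Ox; have [? ?] := h Ox; have [? ?] := h' Ox.
have nC : {ae leb3 R, forall x, Om x -> forall i j k l, dC i j k l x = 0}.
  have n15 := ae3_and n14 n5 (fun x h h' => conj h h').
  apply: (ae3_and dC_form n15) => x h [h14 h5] Ox i j k l; rewrite h//.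
  have [-> -> -> ->] := h14 Ox; rewrite h5// /ti_form; ring.
have nr : {ae leb3 R, forall x, Om x -> forall i k, drho i k x = 0}.
  have m12 := ae3_and m1 m2 (fun x h h' => conj h h').
  by apply: (ae3_and drho_form m12) => x h [h1 h2] Ox i k; rewrite h// h1// h2//; ring.
by apply: (ae3_and nC nr) => x h h' Ox; split; [exact: h|exact: h'].
Qed.

End MainLemmas.

Lemma rint_frame4 (R : realType) (Om : set (R * R * R)) (oOm : open Om) (S : 'M[R]_3)
    (dC : tensor4 R) p q r s : (forall i j k l, rint Om (dC i j k l)) ->
  rint Om (fun x => frame4 S (fun i j k l => dC i j k l x) p q r s).
Proof.
move=> idC; rewrite /frame4 /form4.
by do 4! (apply: rint_sum => // ?).
Qed.

Lemma rint_frame2 (R : realType) (Om : set (R * R * R)) (oOm : open Om) (S : 'M[R]_3)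
    (d : tensor2 R) p q : (forall i j, rint Om (d i j)) ->
  rint Om (fun x => frame2 S (fun i j => d i j x) p q).
Proof.
move=> id; rewrite /frame2 /form2.
by do 2! (apply: rint_sum => // ?).
Qed.

Theorem theorem2 (R : realType) (Om : set (R * R * R)) (e : 'cV[R]_3)
    (lam0 mu0 rho0 w1 w2 : R) (dC : tensor4 R) (drho : tensor2 R)
    (Lam1 Lam2 : vfield R -> vfield R -> R[i])
    (Om_open : open Om) (Om_conn : connected Om) (Om_bnd : bounded_set Om)
    (Om_C11 : C11_boundary Om)
    (e_unit : \sum_i e i 0 ^+ 2 = 1)
    (mu0_gt0 : 0 < mu0) (lam0_mu0 : 0 < 3 * lam0 + 2 * mu0)
    (rho0_gt0 : 0 < rho0)
    (w1_gt0 : 0 < w1) (w2_gt0 : 0 < w2) (w12 : w1 <> w2)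
    (w1_reg : not_dirichlet_eigenvalue Om lam0 mu0 rho0 w1)
    (w2_reg : not_dirichlet_eigenvalue Om lam0 mu0 rho0 w2)
    (dC_pert : elastic_perturbation Om dC)
    (drho_pert : density_perturbation Om drho)
    (dC_drho_TI : transversely_isotropic Om e dC drho)
    (Lam1_DN : linearized_DN Om lam0 mu0 rho0 w1 dC drho Lam1)
    (Lam2_DN : linearized_DN Om lam0 mu0 rho0 w2 dC drho Lam2)
    (Lam1_0 : zero_operator Om Lam1) (Lam2_0 : zero_operator Om Lam2) :
  {ae leb3 R, forall x, Om x ->
    (forall i j k l, dC i j k l x = 0) /\ (forall i k, drho i k x = 0)}.
Proof.
have [dC_Loo dC_sym] := dC_pert; have [drho_Loo _] := drho_pert.
have [S [[SS _] Se TI]] := dC_drho_TI.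
have idC i j k l : rint Om (dC i j k l) by exact: Linfty_integrable.
have idrho i k : rint Om (drho i k) by exact: Linfty_integrable.
have eE : e = S *m bas R ord_max by rewrite -Se ord3_2.
pose i0 : 'I_3 := ord0; pose i1 : 'I_3 := lift ord0 ord0; pose i2 : 'I_3 := ord_max.
pose fr p q r s x := frame4 S (fun i j k l => dC i j k l x) p q r s.
pose c1 := fr i0 i0 i1 i1; pose c2 := fr i0 i1 i0 i1.
pose c3 x := fr i0 i0 i2 i2 x - c1 x; pose c4 x := fr i0 i2 i0 i2 x - c2 x.
pose c5 x := fr i2 i2 i2 i2 x - c1 x - 2 * c2 x - 2 * c3 x - 4 * c4 x.
pose r1 x := frame2 S (fun i j => drho i j x) ord0 ord0.
pose r2 x := frame2 S (fun i j => drho i j x) ord_max ord_max - r1 x.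
have ifr p q r s : rint Om (fr p q r s) by exact: rint_frame4.
have ic3 : rint Om c3 by apply: rintB => //; exact: ifr.
have ic4 : rint Om c4 by apply: rintB => //; exact: ifr.
have ir1 : rint Om r1 by exact: rint_frame2.
apply: (@perturbation_null R Om e Om_open Om_bnd e_unit lam0 mu0 rho0 w1 w2 dC drho
  Lam1 Lam2 mu0_gt0 lam0_mu0 rho0_gt0 w1_gt0 w2_gt0 w12 idC idrho Lam1_DN Lam2_DN Lam1_0 Lam2_0
  c1 c2 c3 c4 c5 r1 r2) => //.
- exact: ifr.
- exact: ifr.
- have ic1 : rint Om c1 := ifr _ _ _ _; have ic2 : rint Om c2 := ifr _ _ _ _.
  have B f g := @rintB _ _ Om_open f g; have Z a f := @rintZ _ _ Om_open a f.
  exact: (B _ _ (B _ _ (B _ _ (B _ _ (ifr i2 i2 i2 i2) ic1) (Z _ _ ic2)) (Z _ _ ic3)) (Z _ _ ic4)).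
- by apply: rintB => //; exact: rint_frame2.
- apply: (ae3_and dC_sym TI) => x sym ti Ox i j k l; rewrite eE.
  apply: (@ti_tensorE R S SS (fun i j k l => dC i j k l x)).
  + by move=> a b c d; have [] := sym Ox a b c d.
  + by move=> a b c d; have [_ ->] := sym Ox a b c d.
  + by move=> Q0 /(ti Ox)[].
- apply: (ae3_imp TI) => x ti Ox i k; rewrite eE.
  apply: (@ti_densityE R S SS (fun i j => drho i j x)).
  by move=> Q0 /(ti Ox)[].
Qed.
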